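(* Let $f_0$, $(g_k)_k$, $\varpi_1,\varpi_2,\varpi_3$ be data as in the context and let $K\subset C^*$ be a compact set. For every $\varepsilon>0$ there exists a sequence of corrugation numbers $N_*=(N_{k,i})_{k\ge 1,\,i\in\{1,2,3\}}$ (positive integers), for which the 3-corrugated process is well defined and converges to a map $f_\infty$ which is $C^1$ on $C^*$, such that $$\|\Phi_{\infty}-df_{\infty}\|_{K,\infty}\leq \varepsilon,$$ where $\Phi_\infty$ is the formal analogue of $df_\infty$ built with the same $N_*$.
   Context: Fix $\rho_0\in\,]0,1[$. $C=[\rho_0,1]\times\mathbb{R}/2\pi\mathbb{Z}$ is the annulus $\{\rho_0\le\rho\le1\}$ of the closed unit disk $D^2$ in polar coordinates $(\rho,\varphi)$, $\widetilde C=[\rho_0,1]\times\mathbb{R}$, $C^*=C\setminus\{\rho=1\}$; $(\partial_\rho,\partial_\varphi)$ is direct and identifies tangent spaces with $\mathbb{R}^2$. $h=4\frac{d\rho^2+\rho^2d\varphi^2}{(1-\rho^2)^2}$ is the hyperbolic metric. Linear maps carry the operator norm, symmetric bilinear forms the norm $\|b\|=\sup_{v\ne0}|b(v,v)|/\|v\|^2$; $\|\cdot\|_{K,\infty}$ is the supremum over $K$. For a linear map or differential $\Psi$, $\Psi^*\langle\cdot,\cdot\rangle(v,w)=\langle\Psi v,\Psi w\rangle$; $\wedge$ is the cross product in $\mathbb{E}^3$. $J_0$ is the Bessel function of the first kind of order 0, $\kappa_0$ its first positive zero, $J_0^{-1}:\,]0,1]\to[0,\kappa_0[$ the inverse of $J_0|_{[0,\kappa_0[}$.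 Data. $\varpi_1,\varpi_2,\varpi_3:\widetilde C\to\mathbb{R}$ are affine with $\varpi_i(\rho,\varphi+2\pi)-\varpi_i(\rho,\varphi)\in\mathbb{Z}$ and, with $\ell_i=d\varpi_i$, $(\ell_i\otimes\ell_i)_i$ is a basis of the symmetric bilinear forms on $\mathbb{R}^2$; $(H_i)_i$ is its dual basis and $\mathcal C=\{\sum_i\eta_i\ell_i\otimes\ell_i:\eta_1,\eta_2,\eta_3>0\}$. $f_0:C\to\mathbb{E}^3$ is a smooth immersion, $(g_k)_{k\ge0}$ is an increasing sequence of smooth metrics on $C$ with $g_0=f_0^*\langle\cdot,\cdot\rangle$, converging to $h$ on $C^*$, such that $g_k-g_{k-1}\in C^\infty(C,\mathcal C)$ for all $k\ge1$ and $\sum_k\|g_k-g_{k-1}\|_{K',\infty}^{1/2}<+\infty$ for every compact $K'\subset C^*$. Frame. For an injective linear map $\Psi:\mathbb{R}^2\to\mathbb{E}^3$ and a nonzero linear form $\ell$, let $(v,w)$ be a direct basis with $\ell(v)>0$, $w\in\ker\ell$; $\mathbf w=\Psi(w)/\|\Psi(w)\|$, $\mathbf n=\frac{\Psi(v)\wedge\Psi(w)}{\|\Psi(v)\wedge\Psi(w)\|}$, $\mathbf t=\mathbf w\wedge\mathbf n$; $u$ is the vector with $\Psi(u)$ collinear to $\mathbf t$ and $\ell(u)=1$. For $\eta\ge0$ put $r=\sqrt{\eta+\|\Psi(u)\|^2}$ and $\alpha=J_0^{-1}(\|\Psi(u)\|/r)$. Corrugation process $CP(f,\eta,\varpi,N)$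 ($f$ a smooth immersion, $\eta>0$ smooth, $N\ge1$ an integer): at each point $p$, let $\mathbf t,\mathbf w,\mathbf n$, $u$, $r$, $\alpha$ be the frame, vector and numbers associated with $\Psi=df(p)$, $\ell=d\varpi$ and $\eta=\eta(p)$ (so $\mathbf w=\frac{df(w)}{\|df(w)\|}$, $\mathbf n=\frac{df(v)\wedge df(w)}{\|df(v)\wedge df(w)\|}$, $\mathbf t=\mathbf w\wedge\mathbf n$ with $(v,w)$ a direct basis such that $d\varpi(v)>0$ and $w\in\ker d\varpi$; $df(u)$ is collinear to $\mathbf t$ with $d\varpi(u)=1$; $r=\sqrt{\eta+\|df(u)\|^2}$, $\alpha=J_0^{-1}(\|df(u)\|/r)$), and set $\gamma(\cdot,s)=r(\cos(\alpha\cos2\pi s)\,\mathbf t+\sin(\alpha\cos2\pi s)\,\mathbf n)$, $\overline\gamma=\int_0^1\gamma(\cdot,s)ds$ and $CP(f,\eta,\varpi,N)(p)=f(p)+\frac1N\int_0^{N\varpi(p)}(\gamma(p,s)-\overline\gamma(p))ds$. The 3-corrugated process is $f_{1,0}=f_0$, $f_{k,i}=CP(f_{k,i-1},\eta_{k,i},\varpi_i,N_{k,i})$ with $\eta_{k,i}=H_i(g_k-f_{k,i-1}^*\langle\cdot,\cdot\rangle)$, $f_{k+1,0}=f_{k,3}=:f_k$; it is well defined if all $f_{k,i-1}$ are immersions and all $\eta_{k,i}>0$. $f_\infty$ is the limit of $(f_k)_k$. Formal corrugation process: $FCP(\Phi,\eta,\varpi,N)=\Phi+\big(r(\cos\theta\,\mathbf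 t+\sin\theta\,\mathbf n)-\Phi(u)\big)\otimes d\varpi$ with $\theta=\alpha\cos(2\pi N\varpi)$, computed pointwise with $\Psi=\Phi(p)$, $\ell=d\varpi$. Formal analogue: $\Phi_{1,0}=df_0$, $\Phi_{k,i}=FCP(\Phi_{k,i-1},H_i(g_k-\Phi_{k,i-1}^*\langle\cdot,\cdot\rangle),\varpi_i,N_{k,i})$, $\Phi_{k+1,0}=\Phi_{k,3}$; this sequence is well defined for every choice of positive integers $N_{k,i}$ and converges on $C^*$ to a continuous map $\Phi_\infty:C^*\to\mathcal L(\mathbb{R}^2,\mathbb{E}^3)$. *)

(* Defs.v *)
(* Stdlib reals with Coquelicot.

   Points and tangent vectors of the strip are elements of R * R, vectors of
   E^3 are elements of R * R * R; the norm that Coquelicot puts on these products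
   is the Euclidean one.  A map on the annulus C is a map on R * R of which only
   the restriction to the strip [rho0,1] x R matters, and which is 2 pi-periodic
   in phi there. *)
From Stdlib Require Export Reals.
From Stdlib Require Import ClassicalEpsilon Factorial List Lra.
From Coquelicot Require Export Coquelicot.

Open Scope R_scope.

Notation plane := (R * R)%type.
Notation E3 := (R * R * R)%type.

Definition the {A : Type} (a0 : A) (P : A -> Prop) : A := epsilon (inhabits a0) P.

(** * Linear algebra *)

(* A linear map from R^2 to V, given by the images of d_rho and d_phi. *)
Definition lin_app {V : NormedModule R_AbsRing} (Psi : V * V) (v : plane) : V :=
  plus (scal (fst v) (fst Psi)) (scal (snd v) (snd Psi)).

Definition injective_lin (Psi : E3 * E3) : Prop :=
  forall v : plane, lin_app Psi v = zero -> v = zero.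

Definition form_app (l v : plane) : R := fst l * fst v + snd l * snd v.

Definition tensor (x : E3) (l : plane) : E3 * E3 :=
  (scal (fst l) x, scal (snd l) x).

Definition det (v w : plane) : R := fst v * snd w - snd v * fst w.

Definition dot (x y : E3) : R :=
  fst (fst x) * fst (fst y) + snd (fst x) * snd (fst y) + snd x * snd y.

Definition cross (x y : E3) : E3 :=
  ( snd (fst x) * snd y - snd x * snd (fst y),
    snd x * fst (fst y) - fst (fst x) * snd y,
    fst (fst x) * snd (fst y) - snd (fst x) * fst (fst y) ).

Definition normalize (x : E3) : E3 := scal (/ norm x) x.

(* A symmetric bilinear form on R^2, given by its coefficients
   (b(d_rho,d_rho), b(d_rho,d_phi), b(d_phi,d_phi)). *)
Notation sym2 := (R * R * R)%type.

Definition bil (b : sym2) (v w : plane) : R :=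
  fst (fst b) * (fst v * fst w)
  + snd (fst b) * (fst v * snd w + snd v * fst w)
  + snd b * (snd v * snd w).

Definition square (l : plane) : sym2 :=
  (fst l * fst l, fst l * snd l, snd l * snd l).

Definition pullback (Psi : E3 * E3) : sym2 :=
  (dot (fst Psi) (fst Psi), dot (fst Psi) (snd Psi), dot (snd Psi) (snd Psi)).

Lemma bil_square (l v w : plane) :
  bil (square l) v w = form_app l v * form_app l w.
Proof. unfold bil, square, form_app; simpl; ring. Qed.

Lemma bil_pullback (Psi : E3 * E3) (v w : plane) :
  bil (pullback Psi) v w = dot (lin_app Psi v) (lin_app Psi w).
Proof.
destruct Psi as [[[a1 a2] a3] [[b1 b2] b3]], v as [v1 v2], w as [w1 w2].
unfold bil, pullback, dot, lin_app, plus, scal; simpl.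
unfold plus, scal; simpl; unfold mult; simpl; ring.
Qed.

Lemma norm_dot (x : E3) : norm x = sqrt (dot x x).
Proof.
destruct x as [[a b] c]; unfold norm, dot; simpl.
unfold prod_norm; simpl; unfold norm; simpl; unfold abs; simpl.
unfold prod_norm; simpl; unfold norm; simpl; unfold abs; simpl.
f_equal; rewrite !Rmult_1_r, sqrt_sqrt by
  (apply Rplus_le_le_0_compat; apply Rle_0_sqr).
now rewrite <- !Rabs_mult, !Rabs_pos_eq by apply Rle_0_sqr.
Qed.

(** * Norms, as suprema in [0,+oo] *)

Definition op_norm (Psi : E3 * E3) : Rbar :=
  Lub_Rbar (fun x => exists v : plane, v <> zero /\ x = norm (lin_app Psi v) / norm v).

Definition sym_norm (b : sym2) : Rbar :=
  Lub_Rbar (fun x => exists v : plane, v <> zero /\ x = Rabs (bil b v v) / norm v ^ 2).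

(* The least upper bound in Rbar of the values F p, for p in K. *)
Definition sup_on (K : plane -> Prop) (F : plane -> Rbar) : Rbar :=
  Lub_Rbar (fun x => exists p, K p /\ Rbar_le x (F p)).

(** * Maps on the annulus *)

Definition strip (rho0 : R) (p : plane) : Prop := rho0 <= fst p <= 1.

Definition strip_star (rho0 : R) (p : plane) : Prop := rho0 <= fst p < 1.

Definition compact_set {T : UniformSpace} (K : T -> Prop) : Prop :=
  forall (I : Type) (O : I -> T -> Prop),
    (forall i, open (O i)) -> (forall x, K x -> exists i, O i x) ->
    exists s : list I, forall x, K x -> exists i, In i s /\ O i x.

(* A compact subset of C^* = C \ {rho = 1} is the image of a compact subset of
   [rho0,1[ x R; the functions whose suprema are taken are periodic in phi, so
   that it may be replaced by the latter. *)
Definition compact_in_Cstar (rho0 : R) (K : plane -> Prop) : Prop :=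
  compact_set K /\ forall p, K p -> strip_star rho0 p.

Definition periodic {A : Type} (rho0 : R) (f : plane -> A) : Prop :=
  forall p, strip rho0 p -> f (fst p, snd p + 2 * PI) = f p.

(* Differentials are relative to D, hence one-sided at boundary points. *)
Definition has_differential {V : NormedModule R_AbsRing} (D : plane -> Prop)
    (f : plane -> V) (p : plane) (L : V * V) : Prop :=
  filterdiff f (within D (locally p)) (lin_app L).

Definition differential {V : NormedModule R_AbsRing} (D : plane -> Prop)
    (f : plane -> V) (p : plane) : V * V :=
  the (zero, zero) (has_differential D f p).

Fixpoint class_C {V : NormedModule R_AbsRing} (D : plane -> Prop) (n : nat)
    (f : plane -> V) : Prop :=
  match n with
  | O => continuous_on D f
  | S m => exists f1 f2 : plane -> V,
      (forall p, D p -> has_differential D f p (f1 p, f2 p)) /\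
      class_C D m f1 /\ class_C D m f2
  end.

Definition smooth_on_C {V : NormedModule R_AbsRing} (rho0 : R) (f : plane -> V) : Prop :=
  periodic rho0 f /\ forall n, class_C (strip rho0) n f.

Definition smooth_immersion (rho0 : R) (f : plane -> E3) : Prop :=
  smooth_on_C rho0 f /\
  forall p, strip rho0 p -> injective_lin (differential (strip rho0) f p).

Definition smooth_metric (rho0 : R) (g : plane -> sym2) : Prop :=
  smooth_on_C rho0 g /\
  forall p, strip rho0 p -> forall v : plane, v <> zero -> 0 < bil (g p) v v.

Definition hyperbolic (p : plane) : sym2 :=
  (4 / (1 - fst p ^ 2) ^ 2, 0, 4 * fst p ^ 2 / (1 - fst p ^ 2) ^ 2).

(** * The Bessel function J_0 *)

Definition J0 (x : R) : R :=
  Series (fun m => (-1) ^ m / INR (fact m) ^ 2 * (x / 2) ^ (2 * m)).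

Definition kappa0 : R :=
  the 0 (fun x => 0 < x /\ J0 x = 0 /\ forall y, 0 < y < x -> J0 y <> 0).

Definition J0_inv (y : R) : R := the 0 (fun a => 0 <= a < kappa0 /\ J0 a = y).

(** * The frame associated with Psi, l and eta *)

(* A direct basis (v,w) with l(v) > 0 and w in ker l.  Any other one has the form
   (a v + b w, c w) with a, c > 0, and yields the same frame. *)
Definition basis_v (l : plane) : plane := l.
Definition basis_w (l : plane) : plane := (- snd l, fst l).

Lemma basis_vw (l : plane) : l <> zero ->
  0 < det (basis_v l) (basis_w l) /\ 0 < form_app l (basis_v l) /\
  form_app l (basis_w l) = 0.
Proof.
destruct l as [a b]; intros Hl; unfold det, form_app, basis_v, basis_w; simpl.
assert (H : 0 < a * a + b * b).
{ destruct (Req_dec a 0) as [Ha|Ha]; [destruct (Req_dec b 0) as [Hb|Hb]|].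
  - now destruct Hl; rewrite Ha, Hb.
  - generalize (Rle_0_sqr a) (Rlt_0_sqr b Hb); unfold Rsqr; lra.
  - generalize (Rlt_0_sqr a Ha) (Rle_0_sqr b); unfold Rsqr; lra. }
repeat split; lra.
Qed.

Definition frame_w (Psi : E3 * E3) (l : plane) : E3 :=
  normalize (lin_app Psi (basis_w l)).

Definition frame_n (Psi : E3 * E3) (l : plane) : E3 :=
  normalize (cross (lin_app Psi (basis_v l)) (lin_app Psi (basis_w l))).

Definition frame_t (Psi : E3 * E3) (l : plane) : E3 :=
  cross (frame_w Psi l) (frame_n Psi l).

Definition frame_u (Psi : E3 * E3) (l : plane) : plane :=
  the (0, 0) (fun u =>
    form_app l u = 1 /\ exists c : R, lin_app Psi u = scal c (frame_t Psi l)).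

Definition frame_r (Psi : E3 * E3) (l : plane) (eta : R) : R :=
  sqrt (eta + norm (lin_app Psi (frame_u Psi l)) ^ 2).

Definition frame_alpha (Psi : E3 * E3) (l : plane) (eta : R) : R :=
  J0_inv (norm (lin_app Psi (frame_u Psi l)) / frame_r Psi l eta).

Definition circle (Psi : E3 * E3) (l : plane) (eta theta : R) : E3 :=
  scal (frame_r Psi l eta)
    (plus (scal (cos theta) (frame_t Psi l)) (scal (sin theta) (frame_n Psi l))).

(** * Corrugation processes *)

Record affine_form := Affine { aff_lin : plane; aff_cst : R }.

Definition aff_app (w : affine_form) (p : plane) : R :=
  form_app (aff_lin w) p + aff_cst w.

(* Coquelicot has no CompleteNormedModule structure on products. *)
Definition RInt_E3 (F : R -> E3) (a b : R) : E3 :=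
  ( RInt (fun s => fst (fst (F s))) a b,
    RInt (fun s => snd (fst (F s))) a b,
    RInt (fun s => snd (F s)) a b ).

Definition gamma (Psi : E3 * E3) (l : plane) (eta s : R) : E3 :=
  circle Psi l eta (frame_alpha Psi l eta * cos (2 * PI * s)).

Definition gamma_bar (Psi : E3 * E3) (l : plane) (eta : R) : E3 :=
  RInt_E3 (gamma Psi l eta) 0 1.

Definition CP (rho0 : R) (f : plane -> E3) (eta : plane -> R) (w : affine_form)
    (N : nat) (p : plane) : E3 :=
  let Psi := differential (strip rho0) f p in
  let l := aff_lin w in
  plus (f p)
    (scal (/ INR N)
       (RInt_E3 (fun s => minus (gamma Psi l (eta p) s) (gamma_bar Psi l (eta p)))
                0 (INR N * aff_app w p))).

Definition FCP (Phi : plane -> E3 * E3) (eta : plane -> R) (w : affine_form)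
    (N : nat) (p : plane) : E3 * E3 :=
  let Psi := Phi p in
  let l := aff_lin w in
  let theta := frame_alpha Psi l (eta p) * cos (2 * PI * INR N * aff_app w p) in
  plus Psi
    (tensor (minus (circle Psi l (eta p) theta) (lin_app Psi (frame_u Psi l))) l).

(* In what follows the indices i of w_i, H_i and N_{k,i} range over {1,2,3}; the
   values at other natural numbers are not used. *)

(* H_i (g - f^* <.,.>) and H_i (g - Phi^* <.,.>) *)
Definition eta_of (Hi : sym2 -> R) (g : plane -> sym2) (Phi : plane -> E3 * E3)
    (p : plane) : R :=
  Hi (minus (g p) (pullback (Phi p))).

Section Process.

Variables (rho0 : R) (w : nat -> affine_form) (H : nat -> sym2 -> R)
  (f0 : plane -> E3) (g : nat -> plane -> sym2) (N : nat -> nat -> nat).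

Fixpoint corr_round (k : nat) (f : plane -> E3) (i : nat) : plane -> E3 :=
  match i with
  | O => f
  | S j =>
      let f' := corr_round k f j in
      CP rho0 f' (eta_of (H i) (g k) (differential (strip rho0) f')) (w i) (N k i)
  end.

(* f_k, which is f_0 for k = 0 and f_{k,3} for k >= 1 *)
Fixpoint corr_end (k : nat) : plane -> E3 :=
  match k with
  | O => f0
  | S m => corr_round k (corr_end m) 3
  end.

(* f_{k,i}, for k >= 1 and 0 <= i <= 3 *)
Definition corr (k i : nat) : plane -> E3 := corr_round k (corr_end (pred k)) i.

(* eta_{k,i} *)
Definition corr_eta (k i : nat) : plane -> R :=
  eta_of (H i) (g k) (differential (strip rho0) (corr k (pred i))).

Definition corr_well_defined : Prop :=
  forall k i, (1 <= k)%nat -> (1 <= i <= 3)%nat ->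
    smooth_immersion rho0 (corr k (pred i)) /\
    forall p, strip rho0 p -> 0 < corr_eta k i p.

Fixpoint formal_round (k : nat) (Phi : plane -> E3 * E3) (i : nat) :
    plane -> E3 * E3 :=
  match i with
  | O => Phi
  | S j =>
      let Phi' := formal_round k Phi j in
      FCP Phi' (eta_of (H i) (g k) Phi') (w i) (N k i)
  end.

(* Phi_{k,3}, and d f_0 for k = 0 *)
Fixpoint formal_end (k : nat) : plane -> E3 * E3 :=
  match k with
  | O => differential (strip rho0) f0
  | S m => formal_round k (formal_end m) 3
  end.

(* Phi_{k,i}, for k >= 1 and 0 <= i <= 3 *)
Definition formal (k i : nat) : plane -> E3 * E3 :=
  formal_round k (formal_end (pred k)) i.

Definition formal_well_defined : Prop :=
  forall k i, (1 <= k)%nat -> (1 <= i <= 3)%nat -> forall p, strip rho0 p ->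
    injective_lin (formal k (pred i) p) /\
    0 <= eta_of (H i) (g k) (formal k (pred i)) p.

End Process.

(** * The data *)

Definition basis_of_sym2 (l : nat -> plane) : Prop :=
  (forall b : sym2, exists c : nat -> R,
     b = sum_n_m (fun i => scal (c i) (square (l i))) 1 3) /\
  (forall c : nat -> R,
     sum_n_m (fun i => scal (c i) (square (l i))) 1 3 = zero ->
     forall i, (1 <= i <= 3)%nat -> c i = 0).

Definition dual_basis (l : nat -> plane) (H : nat -> sym2 -> R) : Prop :=
  (forall i, (1 <= i <= 3)%nat -> is_linear (H i)) /\
  (forall i j, (1 <= i <= 3)%nat -> (1 <= j <= 3)%nat ->
     H i (square (l j)) = if Nat.eqb i j then 1 else 0).

Definition cone (l : nat -> plane) (b : sym2) : Prop :=
  exists c : nat -> R, (forall i, (1 <= i <= 3)%nat -> 0 < c i) /\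
    b = sum_n_m (fun i => scal (c i) (square (l i))) 1 3.

Record corrugation_data (rho0 : R) (w : nat -> affine_form) (H : nat -> sym2 -> R)
    (f0 : plane -> E3) (g : nat -> plane -> sym2) : Prop := {
  data_rho0 : 0 < rho0 < 1;
  data_w_period : forall i, (1 <= i <= 3)%nat -> forall p, strip rho0 p ->
    exists z : Z, aff_app (w i) (fst p, snd p + 2 * PI) - aff_app (w i) p = IZR z;
  data_w_basis : basis_of_sym2 (fun i => aff_lin (w i));
  data_H : dual_basis (fun i => aff_lin (w i)) H;
  data_f0 : smooth_immersion rho0 f0;
  data_g_metric : forall k, smooth_metric rho0 (g k);
  data_g_incr : forall k p v, strip rho0 p -> bil (g k p) v v <= bil (g (S k) p) v v;
  data_g_0 : forall p, strip rho0 p ->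
    g O p = pullback (differential (strip rho0) f0 p);
  data_g_lim : forall p, strip_star rho0 p ->
    filterlim (fun k => g k p) eventually (locally (hyperbolic p));
  data_g_cone : forall k,
    smooth_on_C rho0 (fun p => minus (g (S k) p) (g k p)) /\
    forall p, strip rho0 p ->
      cone (fun i => aff_lin (w i)) (minus (g (S k) p) (g k p));
  data_g_summable : forall K, compact_in_Cstar rho0 K ->
    ex_series (fun k =>
      sqrt (real (sup_on K (fun p => sym_norm (minus (g (S k) p) (g k p))))))
}.

(* Main.v *)
(* One step of the formal process adds eta l (x) l to the pulled back metric exactly, since
   it replaces Psi(u) by a vector of length r orthogonal to Psi(w); and it moves Psi by at
   most sqrt(7 eta) |l|.  Hence Phi_k pulls the Euclidean metric back to g_k whatever the
   numbers N, and Phi_k converges because the square roots are summable.  On the other hand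
   J_0(alpha) is the mean of cos(alpha cos 2 pi s), so the mean of gamma is Psi(u), and the
   differential of CP(f) is FCP(df) up to O(1/N), uniformly on the annulus.  Choosing the N
   one after the other, the real process stays as close as desired to the metrics g_k, so
   it is well defined and df_k is Cauchy on compact sets of C^*, with the same bounds on the
   increments.  Finally, take k0 such that both tails after k0 are at most eps/3 on K: it
   remains to make |Phi_k0 - df_k0| <= eps/3, a finite number of steps, where FCP is
   uniformly continuous near the compact set of the Psi inducing the prescribed metrics. *)
From Stdlib Require Import ssreflect ZArith ClassicalEpsilon Classical Factorial List Lra Lia Psatz.
Require Import Defs.

(** Two obstacles shape the proof. Comparing the formal and real processes over several steps needs
    a modulus of continuity for one step, yet the maps depend on corrugation numbers chosen
    afterwards. But a formal step depends on its number only through the value in [-1,1] of a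
    cosine, and at each stage the formal maps stay in a compact set fixed by the metrics alone. A
    modulus can thus be fixed before any map or number is known, and accuracies can be propagated
    backwards. The other obstacle is that J_0 has zero slope at 0: its inverse is not differentiable
    at 1, and smoothness of a corrugation rests on eta > 0. The coefficients of g_{k+1} - g_k have a
    positive minimum on the annulus, but one that depends on k; the error allowed on the metric is
    therefore a sequence tied to two consecutive minima. Smoothness to all orders comes from closed
    forms: the frame, defined by choice and normalisation, is rewritten in terms of the columns of
    Psi, and the integrals belong to the family [phase_int], closed under differentiation. *)

Notation R2mod := (prod_NormedModule R_AbsRing R_NormedModule R_NormedModule).
Notation E3mod := (prod_NormedModule R_AbsRing R2mod R_NormedModule).
Notation L23mod := (prod_NormedModule R_AbsRing E3mod E3mod).

(** * Differentials and regularity on a subset of the plane *)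

Lemma plus_interchange {G : AbelianMonoid} (a b c d : G) :
  plus (plus a b) (plus c d) = plus (plus a c) (plus b d).
Proof.
rewrite -!plus_assoc; f_equal.
by rewrite !plus_assoc (plus_comm b).
Qed.

Section DifferentialCalculus.

Variable D : plane -> Prop.

Lemma within_proper (p : plane) : D p -> ProperFilter (within D (locally p)).
Proof.
intros Dp. split; [|apply within_filter, locally_filter].
intros P HP. exists p. apply (locally_singleton _ _ HP Dp).
Qed.

Lemma within_is_filter_lim (p : plane) : is_filter_lim (within D (locally p)) p.
Proof. intros P HP. now apply filter_le_within. Qed.

Lemma within_filter_lim_unique (p x : plane) :
  D p -> is_filter_lim (within D (locally p)) x -> x = p.
Proof.
intros Dp Hx.
exact (is_filter_lim_unique (FF := @Proper_StrongProper _ _ (within_proper p Dp)) x p Hx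
  (within_is_filter_lim p)).
Qed.

Lemma lin_app_linear {V : NormedModule R_AbsRing} (L : V * V) :
  is_linear (lin_app L).
Proof.
assert (H1 : is_linear (fun v : plane => scal (fst v) (fst L))).
{ exact (is_linear_comp (fun v : plane => fst v) (fun k : R => scal k (fst L))
    is_linear_fst (is_linear_scal_l (K := R_AbsRing) (fst L))). }
assert (H2 : is_linear (fun v : plane => scal (snd v) (snd L))).
{ exact (is_linear_comp (fun v : plane => snd v) (fun k : R => scal k (snd L))
    is_linear_snd (is_linear_scal_l (K := R_AbsRing) (snd L))). }
exact (is_linear_comp _ _ (is_linear_prod _ _ H1 H2) is_linear_plus).
Qed.

Lemma has_differential_continuous {V : NormedModule R_AbsRing} (f : plane -> V) p L :
  has_differential D f p L -> filterlim f (within D (locally p)) (locally (f p)).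
Proof.
intros Hf. eapply filterdiff_continuous_aux.
- exists (lin_app L). exact Hf.
- apply within_is_filter_lim.
Qed.

Lemma filterlim_pair_locally {T : Type} {U V : UniformSpace} (F : (T -> Prop) -> Prop)
    {FF : Filter F} (f : T -> U) (g : T -> V) (x : U) (y : V) :
  filterlim f F (locally x) -> filterlim g F (locally y) ->
  filterlim (fun t => (f t, g t)) F (locally ((x, y) : prod_UniformSpace U V)).
Proof.
intros Hf Hg P [e He].
generalize (Hf _ (locally_ball x e)) (Hg _ (locally_ball y e)).
unfold filtermap. intros H1 H2. generalize (filter_and _ _ H1 H2).
apply filter_imp. intros t [A B]. apply He. now split.
Qed.

Context {V W : NormedModule R_AbsRing}.

Lemma has_differential_ext (f g : plane -> V) p L :
  D p -> (forall q, D q -> f q = g q) ->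
  has_differential D f p L -> has_differential D g p L.
Proof.
intros Dp E. apply filterdiff_ext_loc.
- exact (filter_forall (F := locally p) _ E).
- intros x Hx. rewrite (within_filter_lim_unique _ _ Dp Hx). now apply E.
Qed.

Lemma has_differential_eq (f : plane -> V) p L L' :
  L = L' -> has_differential D f p L -> has_differential D f p L'.
Proof. now intros ->. Qed.

Lemma has_differential_const (a : V) p : has_differential D (fun _ => a) p (zero, zero).
Proof.
eapply filterdiff_ext_lin; [apply filterdiff_const|].
intros y. unfold lin_app; simpl. by rewrite !scal_zero_r plus_zero_l.
Qed.

Lemma has_differential_plus (f g : plane -> V) p L M :
  has_differential D f p L -> has_differential D g p M ->
  has_differential D (fun q => plus (f q) (g q)) p (plus L M).
Proof.
intros Hf Hg. eapply filterdiff_ext_lin; [exact (filterdiff_plus_fct f g _ _ Hf Hg)|].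
intros y. unfold lin_app; simpl. rewrite !scal_distr_l.
apply plus_interchange.
Qed.

Lemma has_differential_linear (T : V -> W) (f : plane -> V) p L :
  is_linear T -> has_differential D f p L ->
  has_differential D (fun q => T (f q)) p (T (fst L), T (snd L)).
Proof.
intros HT Hf. eapply filterdiff_ext_lin.
- exact (filterdiff_comp f T _ T Hf (filterdiff_linear T HT)).
- intros y. unfold lin_app; simpl. by rewrite (linear_plus _ HT) !(linear_scal _ HT).
Qed.

Lemma has_differential_pair (f : plane -> V) (g : plane -> W) p L M :
  has_differential D f p L -> has_differential D g p M ->
  has_differential D (fun q => (f q, g q)) p ((fst L, fst M), (snd L, snd M)).
Proof.
intros Hf Hg.
eapply filterdiff_ext_lin.
- apply (filterdiff_comp_2 f g (fun x y => (x, y)) (lin_app L) (lin_app M)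
    (fun x y => (x, y)) Hf Hg).
  apply filterdiff_ext with (f := fun t => t). { now intros []. }
  apply filterdiff_ext_lin with (l1 := fun t => t).
  { apply filterdiff_id. } { now intros []. }
- intros y. reflexivity.
Qed.

Lemma has_differential_scal (a : plane -> R) (f : plane -> V) p (La : R * R) L :
  D p -> has_differential D a p La -> has_differential D f p L ->
  has_differential D (fun q => scal (a q) (f q)) p
    (plus (scal (a p) (fst L)) (scal (fst La) (f p)),
     plus (scal (a p) (snd L)) (scal (snd La) (f p))).
Proof.
intros Dp Ha Hf.
assert (Hl : is_filter_lim (filtermap (fun q => (a q, f q)) (within D (locally p)))
  (a p, f p)).
{ apply filterlim_pair_locally; [apply within_filter, locally_filter|..].
  - exact (has_differential_continuous a p La Ha).
  - exact (has_differential_continuous f p L Hf). }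
eapply filterdiff_ext_lin.
- apply (filterdiff_comp_2 a f (fun x y => scal x y) (lin_app La) (lin_app L)
    (fun x y => plus (scal x (f p)) (scal (a p) y)) Ha Hf).
  assert (PF := within_proper p Dp).
  refine (filterdiff_scal (F := filtermap (fun q => (a q, f q)) (within D (locally p)))
    (a p, f p) Hl _).
  exact Rmult_comm.
- intros y. unfold lin_app; simpl. rewrite !scal_distr_l !scal_distr_r !scal_assoc.
  rewrite (Rmult_comm (a p) (fst y) : mult (a p) (fst y) = mult (fst y) (a p)).
  rewrite (Rmult_comm (a p) (snd y) : mult (a p) (snd y) = mult (snd y) (a p)).
  rewrite (plus_interchange (scal _ (f p))); f_equal; apply plus_comm.
Qed.

Lemma has_differential_comp (phi : R -> R) (f : plane -> R) p (L : R * R) d :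
  D p -> is_derive phi (f p) d -> has_differential D f p L ->
  has_differential D (fun q => phi (f q)) p (d * fst L, d * snd L).
Proof.
intros Dp Hphi Hf.
assert (PF := within_proper p Dp).
assert (H := filterdiff_locally (F := filtermap f (within D (locally p))) phi (f p) _
  (has_differential_continuous f p L Hf) Hphi).
eapply filterdiff_ext_lin.
- exact (filterdiff_comp f phi _ _ Hf H).
- intros y. unfold lin_app, plus, scal; simpl; unfold mult; simpl. ring.
Qed.

Lemma has_differential_comp2 (F : R -> R -> R) (a b : plane -> R) p (La Lb : R * R) d1 d2 :
  D p ->
  filterdiff (fun u : plane => F (fst u) (snd u)) (locally (a p, b p))
    (fun u : plane => plus (scal (fst u) d1) (scal (snd u) d2)) ->
  has_differential D a p La -> has_differential D b p Lb ->
  has_differential D (fun q => F (a q) (b q)) p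
    (d1 * fst La + d2 * fst Lb, d1 * snd La + d2 * snd Lb).
Proof.
intros Dp HF Ha Hb.
assert (PF := within_proper p Dp).
assert (Hl : is_filter_lim (filtermap (fun q => (a q, b q)) (within D (locally p)))
  (a p, b p)).
{ apply filterlim_pair_locally; [apply within_filter, locally_filter|..].
  - exact (has_differential_continuous a p La Ha).
  - exact (has_differential_continuous b p Lb Hb). }
assert (H := filterdiff_locally (F := filtermap (fun q => (a q, b q))
  (within D (locally p))) _ _ _ Hl HF).
eapply filterdiff_ext_lin.
- exact (filterdiff_comp_2 a b F _ _ (fun x y => plus (scal x d1) (scal y d2)) Ha Hb H).
- intros y. unfold lin_app, plus, scal; simpl; unfold mult; simpl. ring.
Qed.

Lemma has_differential_fst p : has_differential D fst p (1, 0).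
Proof.
eapply filterdiff_ext_lin; [exact (filterdiff_linear _ is_linear_fst)|].
intros y. unfold lin_app, plus, scal; simpl; unfold mult; simpl. ring.
Qed.

Lemma has_differential_snd p : has_differential D snd p (0, 1).
Proof.
eapply filterdiff_ext_lin; [exact (filterdiff_linear _ is_linear_snd)|].
intros y. unfold lin_app, plus, scal; simpl; unfold mult; simpl. ring.
Qed.

End DifferentialCalculus.

Arguments has_differential_continuous {D V} f p L.

Section Regularity.

Variable D : plane -> Prop.

Lemma class_C_continuous {V : NormedModule R_AbsRing} n (f : plane -> V) :
  class_C D n f -> continuous_on D f.
Proof.
destruct n as [|n]; [easy|]. intros (f1 & f2 & Hf & _) p Dp.
exact (has_differential_continuous f p _ (Hf p Dp)).
Qed.

Lemma class_C_S {V : NormedModule R_AbsRing} n (f : plane -> V) :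
  class_C D (S n) f -> class_C D n f.
Proof.
revert f; induction n as [|n IH]; intros f Hf.
- exact (class_C_continuous _ _ Hf).
- destruct Hf as (f1 & f2 & Hf & H1 & H2). exists f1, f2. auto.
Qed.

Lemma continuous_on_ext_on {U W : UniformSpace} (E : U -> Prop) (f g : U -> W) :
  (forall q, E q -> f q = g q) -> continuous_on E f -> continuous_on E g.
Proof.
intros H Hf p Dp. rewrite -(H p Dp). apply (filterlim_ext_loc f); [|now apply Hf].
exact (filter_forall (F := locally p) _ H).
Qed.

Lemma class_C_ext {V : NormedModule R_AbsRing} n (f g : plane -> V) :
  (forall q, D q -> f q = g q) -> class_C D n f -> class_C D n g.
Proof.
intros E. destruct n as [|n].
- now apply continuous_on_ext_on.
- intros (f1 & f2 & Hf & H1 & H2). exists f1, f2. split; [|split; auto].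
  intros p Dp. exact (has_differential_ext _ _ _ _ _ Dp E (Hf p Dp)).
Qed.

Lemma continuous_on_const {U W : UniformSpace} (E : U -> Prop) (a : W) :
  continuous_on E (fun _ => a).
Proof. intros p _. apply filterlim_const. Qed.

Lemma class_C_const {V : NormedModule R_AbsRing} n (a : V) : class_C D n (fun _ => a).
Proof.
revert a; induction n as [|n IH]; intros a; [apply continuous_on_const|].
exists (fun _ => zero), (fun _ => zero). split; [|split; auto].
intros p _. apply has_differential_const.
Qed.

Lemma class_C_plus {V : NormedModule R_AbsRing} n (f g : plane -> V) :
  class_C D n f -> class_C D n g -> class_C D n (fun q => plus (f q) (g q)).
Proof.
revert f g; induction n as [|n IH]; intros f g Hf Hg.
- intros p Dp. eapply filterlim_comp_2; [now apply Hf|now apply Hg|apply filterlim_plus].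
- destruct Hf as (f1 & f2 & Hf & ? & ?), Hg as (g1 & g2 & Hg & ? & ?).
  exists (fun q => plus (f1 q) (g1 q)), (fun q => plus (f2 q) (g2 q)).
  split; [|split; auto].
  intros p Dp. exact (has_differential_plus _ _ _ _ _ _ (Hf p Dp) (Hg p Dp)).
Qed.

Lemma class_C_linear {V W : NormedModule R_AbsRing} n (T : V -> W) (f : plane -> V) :
  is_linear T -> class_C D n f -> class_C D n (fun q => T (f q)).
Proof.
intros HT. revert f; induction n as [|n IH]; intros f Hf.
- intros p Dp. eapply filterlim_comp; [now apply Hf|]. now apply linear_cont.
- destruct Hf as (f1 & f2 & Hf & ? & ?).
  exists (fun q => T (f1 q)), (fun q => T (f2 q)). split; [|split; auto].
  intros p Dp. exact (has_differential_linear _ T _ _ _ HT (Hf p Dp)).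
Qed.

Lemma class_C_pair {V W : NormedModule R_AbsRing} n (f : plane -> V) (g : plane -> W) :
  class_C D n f -> class_C D n g -> class_C D n (fun q => (f q, g q)).
Proof.
revert f g; induction n as [|n IH]; intros f g Hf Hg.
- intros p Dp. apply filterlim_pair_locally; [|now apply Hf|now apply Hg].
  apply within_filter, locally_filter.
- destruct Hf as (f1 & f2 & Hf & ? & ?), Hg as (g1 & g2 & Hg & ? & ?).
  exists (fun q => (f1 q, g1 q)), (fun q => (f2 q, g2 q)). split; [|split; auto].
  intros p Dp. exact (has_differential_pair _ _ _ _ _ _ (Hf p Dp) (Hg p Dp)).
Qed.

Lemma class_C_scal {V : NormedModule R_AbsRing} n (a : plane -> R) (f : plane -> V) :
  class_C D n a -> class_C D n f -> class_C D n (fun q => scal (a q) (f q)).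
Proof.
revert a f; induction n as [|n IH]; intros a f Ha Hf.
- intros p Dp. eapply filterlim_comp_2; [now apply Ha|now apply Hf|].
  exact (filterlim_scal (K := R_AbsRing) (a p) (f p)).
- assert (Ha' := class_C_S _ _ Ha). assert (Hf' := class_C_S _ _ Hf).
  destruct Ha as (a1 & a2 & Ha & ? & ?), Hf as (f1 & f2 & Hf & ? & ?).
  eexists _, _. split.
  + intros p Dp. exact (has_differential_scal _ _ _ _ _ _ Dp (Ha p Dp) (Hf p Dp)).
  + split; apply class_C_plus; auto.
Qed.

Lemma class_C_mult n (a b : plane -> R) :
  class_C D n a -> class_C D n b -> class_C D n (fun q => a q * b q).
Proof. apply (class_C_scal (V := R_NormedModule)). Qed.

Lemma class_C_Rplus n (a b : plane -> R) :
  class_C D n a -> class_C D n b -> class_C D n (fun q => a q + b q).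
Proof. apply (class_C_plus (V := R_NormedModule)). Qed.

Lemma class_C_opp {V : NormedModule R_AbsRing} n (f : plane -> V) :
  class_C D n f -> class_C D n (fun q => opp (f q)).
Proof. apply class_C_linear, is_linear_opp. Qed.

Lemma class_C_minus {V : NormedModule R_AbsRing} n (f g : plane -> V) :
  class_C D n f -> class_C D n g -> class_C D n (fun q => minus (f q) (g q)).
Proof. intros Hf Hg. apply class_C_plus; [easy|now apply class_C_opp]. Qed.

Lemma class_C_Rminus n (a b : plane -> R) :
  class_C D n a -> class_C D n b -> class_C D n (fun q => a q - b q).
Proof. apply (class_C_minus (V := R_NormedModule)). Qed.

Lemma class_C_fst n : class_C D n (fst : plane -> R).
Proof.
destruct n as [|n].
- intros p Dp. exact (has_differential_continuous _ _ _ (has_differential_fst D p)).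
- exists (fun _ => 1), (fun _ => 0). split; [|split; apply class_C_const].
  intros p _. apply has_differential_fst.
Qed.

Lemma class_C_snd n : class_C D n (snd : plane -> R).
Proof.
destruct n as [|n].
- intros p Dp. exact (has_differential_continuous _ _ _ (has_differential_snd D p)).
- exists (fun _ => 0), (fun _ => 1). split; [|split; apply class_C_const].
  intros p _. apply has_differential_snd.
Qed.

(* Serves for functions whose derivative psi is a polynomial or rational expression in
   phi itself, so that the hypothesis on psi is met by the induction. *)
Lemma class_C_comp_ind (I : R -> Prop) (phi psi : R -> R) n (f : plane -> R) :
  (forall x, I x -> is_derive phi x (psi x)) ->
  (forall m, (m < n)%nat -> class_C D m (fun q => phi (f q)) -> class_C D m f ->
     class_C D m (fun q => psi (f q))) ->
  class_C D n f -> (forall q, D q -> I (f q)) -> class_C D n (fun q => phi (f q)).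
Proof.
intros Hphi Hpsi Hf HI. induction n as [|n IH].
- intros p Dp. eapply filterlim_comp; [now apply Hf|].
  apply ex_derive_continuous. eexists; now apply Hphi, HI.
- assert (Hf' := class_C_S _ _ Hf).
  assert (H : class_C D n (fun q => psi (f q))).
  { apply Hpsi; [lia| |easy]. apply IH; [|easy]. intros m Hm. apply Hpsi. lia. }
  destruct Hf as (f1 & f2 & Hf & ? & ?).
  exists (fun q => psi (f q) * f1 q), (fun q => psi (f q) * f2 q).
  split; [|split; now apply class_C_mult].
  intros p Dp.
  exact (has_differential_comp _ _ _ _ _ _ Dp (Hphi _ (HI _ Dp)) (Hf p Dp)).
Qed.

(** Each function of the sequence has the next one as derivative. The induction on the order is
    strong because [class_C_comp_ind] asks for the derivative at every lower order. *)
Lemma class_C_family (phi : nat -> R -> R) n j (f : plane -> R) :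
  (forall j x, is_derive (phi j) x (phi (S j) x)) ->
  class_C D n f -> class_C D n (fun q => phi j (f q)).
Proof.
intros Hphi; revert j; induction n as [n IH] using (well_founded_induction Wf_nat.lt_wf).
intros j Hf. apply (class_C_comp_ind (fun _ => True) (phi j) (phi (S j))); auto.
Qed.

Lemma class_C_inv n (f : plane -> R) :
  class_C D n f -> (forall q, D q -> f q <> 0) -> class_C D n (fun q => / f q).
Proof.
intros Hf Hn.
apply (class_C_comp_ind (fun x => x <> 0) Rinv (fun x => - (/ x * / x))); auto.
- intros x Hx. auto_derive; [easy|]. now field.
- intros m _ H _. apply (class_C_opp (V := R_NormedModule)). now apply class_C_mult.
Qed.

Lemma class_C_sqrt n (f : plane -> R) :
  class_C D n f -> (forall q, D q -> 0 < f q) -> class_C D n (fun q => sqrt (f q)).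
Proof.
intros Hf Hn.
apply (class_C_comp_ind (fun x => 0 < x) sqrt (fun x => / (2 * sqrt x))); auto.
- intros x Hx. auto_derive; [easy|]. field. apply Rgt_not_eq, sqrt_lt_R0, Hx.
- intros m _ H _. apply class_C_inv.
  + apply class_C_mult; [apply class_C_const|easy].
  + intros q Dq. generalize (sqrt_lt_R0 _ (Hn q Dq)). lra.
Qed.

End Regularity.

(** * Parametric integrals of trigonometric functions *)

(** Differentiation in [a] raises [j] by one and adds PI / 2 to [b], so the family is closed under
    it. For [j] = 0, the values 0 and - PI / 2 of [b] give cos (a cos 2 pi s) and sin (a cos 2 pi
    s), the two components of a corrugation. *)
Definition phase (j : nat) (b a s : R) : R :=
  cos (2 * PI * s) ^ j * cos (a * cos (2 * PI * s) + b).

Definition phase_int (j : nat) (b a S : R) : R := RInt (phase j b a) 0 S.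

Lemma phase_continuous j b a s : continuous (phase j b a) s.
Proof.
apply (ex_derive_continuous (V := R_NormedModule)). unfold phase. auto_derive; easy.
Qed.

Lemma phase_ex_RInt j b a x y : ex_RInt (phase j b a) x y.
Proof. apply (ex_RInt_continuous (V := R_CompleteNormedModule)). intros; apply phase_continuous. Qed.

Lemma Rabs_cos_le1 x : Rabs (cos x) <= 1.
Proof. apply Rabs_le. generalize (COS_bound x). lra. Qed.

Lemma phase_le1 j b a s : Rabs (phase j b a s) <= 1.
Proof.
unfold phase. rewrite Rabs_mult -RPow_abs.
generalize (Rabs_cos_le1 (2 * PI * s)) (Rabs_cos_le1 (a * cos (2 * PI * s) + b)).
generalize (Rabs_pos (cos (2 * PI * s))) (Rabs_pos (cos (a * cos (2 * PI * s) + b))).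
intros. generalize (pow_le _ j H) (pow_incr _ 1 j (conj H H1)). rewrite pow1. intros. nra.
Qed.

Lemma phase_derive j b a s : is_derive (fun x => phase j b x s) a (phase (S j) (b + PI / 2) a s).
Proof.
unfold phase. auto_derive; [easy|].
replace (a * cos (2 * PI * s) + (b + PI / 2)) with (a * cos (2 * PI * s) + b + PI / 2) by ring.
rewrite cos_plus cos_PI2 sin_PI2. simpl. ring.
Qed.

Lemma phase_int_derive_end j b a x : is_derive (phase_int j b a) x (phase j b a x).
Proof.
apply (is_derive_RInt (V := R_NormedModule) _ _ 0).
- apply filter_forall. intros y. apply (RInt_correct (V := R_CompleteNormedModule)), phase_ex_RInt.
- apply phase_continuous.
Qed.

Lemma phase_int_0 j b a : phase_int j b a 0 = 0.
Proof. apply (RInt_point (V := R_CompleteNormedModule)). Qed.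

(** The bound comes from the derivative in the endpoint, which is at most 1 in absolute value; this
    covers negative [x] as well. *)
Lemma phase_int_le j b a x : Rabs (phase_int j b a x) <= Rabs x.
Proof.
generalize (bounded_variation (phase_int j b a) (phase j b a) 1 0 x).
rewrite phase_int_0 !Rminus_0_r Rmult_1_l. intros H; apply H. intros t _.
split; [apply phase_int_derive_end|apply phase_le1].
Qed.

Lemma phase_continuity_2d j b a s : continuity_2d_pt (phase j b) a s.
Proof.
assert (Hc : continuity_2d_pt (fun _ v => cos (2 * PI * v)) a s).
{ apply (continuity_1d_2d_pt_comp (fun y => cos (2 * PI * y)) (fun _ v => v)).
  - apply continuity_pt_filterlim.
    apply (ex_derive_continuous (V := R_NormedModule) (fun y => cos (2 * PI * y)) s).
    auto_derive; easy.
  - apply continuity_2d_pt_id2. }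
unfold phase. apply continuity_2d_pt_mult.
- apply (continuity_1d_2d_pt_comp (fun y => y ^ j) _ _ _); [|easy].
  apply derivable_continuous_pt, derivable_pt_pow.
- apply (continuity_1d_2d_pt_comp cos); [apply continuity_cos|].
  apply continuity_2d_pt_plus; [|apply continuity_2d_pt_const].
  apply continuity_2d_pt_mult; [apply continuity_2d_pt_id1|easy].
Qed.

Lemma phase_int_derive j b a x :
  is_derive (fun a => phase_int j b a x) a (phase_int (S j) (b + PI / 2) a x).
Proof.
unfold phase_int at 2.
rewrite (RInt_ext _ (fun t => Derive (fun u => phase j b u t) a)).
2:{ intros t _. symmetry. apply is_derive_unique, phase_derive. }
apply (is_derive_RInt_param (phase j b) 0 x).
- apply filter_forall. intros y t _. eexists; apply phase_derive.
- intros t _. apply continuity_2d_pt_ext with (f := phase (S j) (b + PI / 2)).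
  + intros u v. symmetry. apply is_derive_unique, phase_derive.
  + apply phase_continuity_2d.
- apply filter_forall. intros y. apply phase_ex_RInt.
Qed.

(** Lipschitz in each variable separately: the slope in [a] is at most the length of the interval,
    the slope in the endpoint at most 1. *)
Lemma phase_int_continuity_2d j b a x :
  continuous (fun u : plane => phase_int j b (fst u) (snd u)) (a, x).
Proof.
apply filterlim_locally. intros [e He].
assert (Hx : 0 <= Rabs x) by apply Rabs_pos.
(* The minimum with 1 bounds |x'| by |x| + 1, so the total variation is at most (|x| + 2) d,
   strictly less than e. *)
assert (Hd : 0 < Rmin 1 (e / (Rabs x + 3))).
{ apply Rmin_case; [lra|]. apply Rdiv_lt_0_compat; lra. }
exists (mkposreal _ Hd). intros [a' x'] [H1 H2].
change (Rabs (a' - a) < Rmin 1 (e / (Rabs x + 3))) in H1.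
change (Rabs (x' - x) < Rmin 1 (e / (Rabs x + 3))) in H2.
change (Rabs (phase_int j b a' x' - phase_int j b a x) < e).
set (d := Rmin 1 (e / (Rabs x + 3))) in *.
assert (Hd1 : d <= 1) by apply Rmin_l.
assert (Hd2 : d * (Rabs x + 3) <= e).
{ apply Rle_trans with (e / (Rabs x + 3) * (Rabs x + 3)); [|right; field; lra].
  apply Rmult_le_compat_r; [lra|apply Rmin_r]. }
assert (A : Rabs (phase_int j b a' x' - phase_int j b a x') <= Rabs x' * Rabs (a' - a)).
{ apply (bounded_variation (fun a => phase_int j b a x')
    (fun a => phase_int (S j) (b + PI / 2) a x')). intros t _.
  split; [apply phase_int_derive|apply phase_int_le]. }
assert (B : Rabs (phase_int j b a x' - phase_int j b a x) <= 1 * Rabs (x' - x)).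
{ apply (bounded_variation _ (phase j b a)). intros t _.
  split; [apply phase_int_derive_end|apply phase_le1]. }
assert (C : Rabs x' <= Rabs x + 1).
{ replace x' with (x + (x' - x)) by ring. generalize (Rabs_triang x (x' - x)). lra. }
replace (phase_int j b a' x' - phase_int j b a x) with
  ((phase_int j b a' x' - phase_int j b a x') + (phase_int j b a x' - phase_int j b a x)) by ring.
eapply Rle_lt_trans; [apply Rabs_triang|].
generalize (Rabs_pos (a' - a)) (Rabs_pos x'). intros. nra.
Qed.

Lemma phase_int_filterdiff j b a x :
  filterdiff (fun u : plane => phase_int j b (fst u) (snd u)) (locally (a, x))
    (fun u : plane => plus (scal (fst u) (phase_int (S j) (b + PI / 2) a x))
                           (scal (snd u) (phase j b a x))).
Proof.
apply (is_derive_filterdiff (phase_int j b) a x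
  (fun a x => phase_int (S j) (b + PI / 2) a x) (phase j b a x)).
- apply filter_forall. intros [u v]. apply phase_int_derive.
- apply phase_int_derive_end.
- apply phase_int_continuity_2d.
Qed.

Lemma class_C_phase D n j b (a s : plane -> R) :
  class_C D n a -> class_C D n s -> class_C D n (fun q => phase j b (a q) (s q)).
Proof.
intros Ha Hs. unfold phase.
assert (Hcos : forall c f, class_C D n f -> class_C D n (fun q => cos (f q + c))).
{ intros c f Hf. apply (class_C_ext D n (fun q => (fun m x => cos (x + INR m * (PI / 2))) O (f q + c))).
  - intros q _; simpl. f_equal; ring.
  - apply (class_C_family D (fun m x => cos (x + INR m * (PI / 2)))).
    + intros m x. rewrite S_INR. auto_derive; [easy|].
      replace (x + (INR m + 1) * (PI / 2)) with (x + INR m * (PI / 2) + PI / 2) by ring.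
      rewrite cos_plus cos_PI2 sin_PI2. ring.
    + apply class_C_Rplus; [easy|apply class_C_const]. }
assert (Hc : class_C D n (fun q => cos (2 * PI * s q))).
{ apply (class_C_ext D n (fun q => cos (2 * PI * s q + 0))).
  - intros q _. now rewrite Rplus_0_r.
  - apply Hcos, class_C_mult; [apply class_C_const|easy]. }
apply class_C_mult.
- induction j as [|j IH]; simpl; [apply class_C_const|now apply class_C_mult].
- now apply Hcos, class_C_mult.
Qed.

Lemma class_C_phase_int D n j b (a s : plane -> R) :
  class_C D n a -> class_C D n s -> class_C D n (fun q => phase_int j b (a q) (s q)).
Proof.
revert j b; induction n as [|n IH]; intros j b Ha Hs.
- intros p Dp.
  refine (filterlim_comp _ _ _ (fun q => (a q, s q))
    (fun u : plane => phase_int j b (fst u) (snd u)) _ (locally (a p, s p)) _ _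
    (phase_int_continuity_2d j b (a p) (s p))).
  apply filterlim_pair_locally; [apply within_filter, locally_filter|now apply Ha|now apply Hs].
- assert (Ha' := class_C_S _ _ _ Ha). assert (Hs' := class_C_S _ _ _ Hs).
  destruct Ha as (a1 & a2 & Ha & ? & ?), Hs as (s1 & s2 & Hs & ? & ?).
  eexists (fun q => phase_int (S j) (b + PI / 2) (a q) (s q) * a1 q + phase j b (a q) (s q) * s1 q),
    (fun q => phase_int (S j) (b + PI / 2) (a q) (s q) * a2 q + phase j b (a q) (s q) * s2 q).
  split.
  + intros p Dp. exact (has_differential_comp2 _ _ _ _ _ _ _ _ _ Dp
      (phase_int_filterdiff j b (a p) (s p)) (Ha p Dp) (Hs p Dp)).
  + split; apply class_C_Rplus; apply class_C_mult; auto; now apply class_C_phase.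
Qed.

(** * The Bessel function J_0 and its inverse *)

Lemma Derive_n_cos m t : is_derive_n cos m t (cos (t + INR m * (PI / 2))).
Proof.
revert t; induction m as [|m IH]; intros t.
- simpl. f_equal; ring.
- simpl. apply (is_derive_ext (fun t => cos (t + INR m * (PI / 2)))).
  + intros u. symmetry. apply is_derive_n_unique, IH.
  + change (match m with O => 1 | S _ => INR m + 1 end) with (INR (S m)). rewrite S_INR.
    auto_derive; [easy|].
    replace (t + (INR m + 1) * (PI / 2)) with (t + INR m * (PI / 2) + PI / 2) by ring.
    rewrite cos_plus cos_PI2 sin_PI2. ring.
Qed.

Lemma cos_half_turns k : cos (INR (2 * k) * (PI / 2)) = (-1) ^ k.
Proof.
rewrite mult_INR; change (INR 2) with 2.
replace (2 * INR k * (PI / 2)) with (INR k * PI) by field.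
induction k as [|k IH]; [simpl; rewrite Rmult_0_l; apply cos_0|].
rewrite S_INR Rmult_plus_distr_r Rmult_1_l neg_cos IH. simpl; ring.
Qed.

Lemma cos_odd_quarter_turns k : cos (INR (S (2 * k)) * (PI / 2)) = 0.
Proof.
rewrite S_INR mult_INR; change (INR 2) with 2.
replace ((2 * INR k + 1) * (PI / 2)) with (INR k * PI + PI / 2) by field.
induction k as [|k IH]; [simpl; rewrite Rmult_0_l Rplus_0_l; apply cos_PI2|].
rewrite S_INR Rmult_plus_distr_r Rmult_1_l.
replace (INR k * PI + PI + PI / 2) with (INR k * PI + PI / 2 + PI) by ring.
rewrite neg_cos IH. ring.
Qed.

Lemma cos_taylor_pos n y : 0 < y -> exists z,
  cos y = sum_f_R0 (fun m => y ^ m / INR (fact m) * cos (INR m * (PI / 2))) n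
    + y ^ S n / INR (fact (S n)) * cos z.
Proof.
intros Hy. destruct (Taylor_Lagrange cos n 0 y Hy) as (z & _ & E).
- intros t _ k _. destruct k; [easy|]. eexists. apply (Derive_n_cos (S k)).
- exists (z + INR (S n) * (PI / 2)). rewrite E Rminus_0_r. f_equal.
  + apply sum_eq. intros i _. f_equal.
    rewrite (is_derive_n_unique _ _ _ _ (Derive_n_cos i 0)). f_equal; ring.
  + f_equal. apply is_derive_n_unique, Derive_n_cos.
Qed.

Definition cos_poly (n : nat) (y : R) : R :=
  sum_f_R0 (fun k => (-1) ^ k * y ^ (2 * k) / INR (fact (2 * k))) n.

(** Taylor-Lagrange at the even order 2 (n + 1): odd terms vanish at 0, so the remainder has order 2
    (n + 1) + 1. Negative [y] follows by parity. *)
Lemma cos_poly_approx n y :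
  Rabs (cos y - cos_poly (S n) y) <= Rabs y ^ S (2 * S n) / INR (fact (S (2 * S n))).
Proof.
assert (Hpos : forall y, 0 < y ->
  Rabs (cos y - cos_poly (S n) y) <= Rabs y ^ S (2 * S n) / INR (fact (S (2 * S n)))).
{ clear y; intros y Hy. destruct (cos_taylor_pos (2 * S n) y Hy) as (z & ->).
  rewrite -sum_decomposition.
  rewrite (sum_eq (fun l => y ^ (2 * l) / INR (fact (2 * l)) * cos (INR (2 * l) * (PI / 2)))
    (fun k => (-1) ^ k * y ^ (2 * k) / INR (fact (2 * k)))).
  2:{ intros i _. rewrite cos_half_turns. field. apply INR_fact_neq_0. }
  rewrite (sum_eq (fun l => y ^ S (2 * l) / INR (fact (S (2 * l))) * cos (INR (S (2 * l)) * (PI / 2)))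
    (fun k => 0)).
  2:{ intros i _. rewrite cos_odd_quarter_turns. ring. }
  rewrite sum_cte Rmult_0_l Rplus_0_r. unfold cos_poly at 1.
  replace (_ + _ - _) with (y ^ S (2 * S n) / INR (fact (S (2 * S n))) * cos z) by (unfold cos_poly; ring).
  rewrite Rabs_mult. rewrite -(Rmult_1_r (Rabs y ^ _ / _)).
  apply Rmult_le_compat; try apply Rabs_pos; [|apply Rabs_cos_le1].
  unfold Rdiv. rewrite Rabs_mult -RPow_abs (Rabs_pos_eq (/ _)); [lra|].
  apply Rlt_le, Rinv_0_lt_compat, INR_fact_lt_0. }
destruct (Rtotal_order y 0) as [Hy|[->|Hy]]; [| |now apply Hpos].
- generalize (Hpos (- y) ltac:(lra)). rewrite Rabs_Ropp cos_neg.
  replace (cos_poly (S n) (- y)) with (cos_poly (S n) y); [now intros|].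
  apply sum_eq. intros i _.
  replace ((- y) ^ (2 * i)) with (y ^ (2 * i)) by (rewrite !pow_mult; f_equal; ring).
  reflexivity.
- replace (cos_poly (S n) 0) with 1.
  + rewrite cos_0 Rminus_diag_eq // Rabs_R0 (pow_ne_zero (S _)) //.
    unfold Rdiv; lra.
  + unfold cos_poly. symmetry. clear Hpos; generalize (S n); clear n. induction n as [|n IH].
    * simpl. field.
    * simpl sum_f_R0 in IH |- *. rewrite IH (pow_ne_zero (_ + _)); [unfold Rdiv; lra|lia].
Qed.

(** Taylor expansion of order 3, with remainder y^4 / 24 cos z. *)
Lemma one_minus_cos_ge y : y ^ 2 / 2 - y ^ 4 / 24 <= 1 - cos y.
Proof.
assert (Hpos : forall y, 0 < y -> y ^ 2 / 2 - y ^ 4 / 24 <= 1 - cos y).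
{ clear y; intros y Hy. destruct (cos_taylor_pos 3 y Hy) as (z & ->).
  assert (E := cos_odd_quarter_turns 1). assert (E' := cos_odd_quarter_turns 0).
  assert (E2 := cos_half_turns 1). assert (E3 := cos_half_turns 0).
  simpl mult in *. unfold sum_f_R0. rewrite E E' E2 E3.
  generalize (COS_bound z) (pow_lt y 4 Hy). simpl. intros. nra. }
destruct (Rtotal_order y 0) as [Hy|[->|Hy]]; [| |now apply Hpos].
- generalize (Hpos (- y) ltac:(lra)). rewrite cos_neg.
  replace ((- y) ^ 2) with (y ^ 2) by ring. now replace ((- y) ^ 4) with (y ^ 4) by ring.
- rewrite cos_0. lra.
Qed.

(** Moments of the cosine over a period; the even ones yield the coefficients of the power series of
    [J0]. *)
Definition wallis (m : nat) : R := RInt (fun s => cos (2 * PI * s) ^ m) 0 1.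

Lemma cos_pow_ex_RInt m x y : ex_RInt (fun s => cos (2 * PI * s) ^ m) x y.
Proof.
apply (ex_RInt_continuous (V := R_CompleteNormedModule)). intros z _.
apply (ex_derive_continuous (V := R_NormedModule)). auto_derive; easy.
Qed.

(** Integrates the derivative of sin cos^(m+1), a function that vanishes at both ends of the
    period. *)
Lemma wallis_rec m : (INR m + 2) * wallis (S (S m)) = (INR m + 1) * wallis m.
Proof.
set (G := fun s => sin (2 * PI * s) * cos (2 * PI * s) ^ S m).
set (G' := fun s => 2 * PI * ((INR m + 2) * cos (2 * PI * s) ^ S (S m)
   - (INR m + 1) * cos (2 * PI * s) ^ m)).
assert (HG : is_RInt G' 0 1 (G 1 - G 0)).
{ apply (is_RInt_derive (V := R_CompleteNormedModule)).
  - intros x _. unfold G, G'. auto_derive; [easy|].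
    change (match m with O => 1 | S _ => INR m + 1 end) with (INR (S m)). rewrite S_INR.
    set (c := cos (2 * PI * x)). set (t := sin (2 * PI * x)).
    assert (E : t * t + c * c = 1) by apply sin2_cos2.
    apply Rminus_diag_uniq.
    transitivity (- 2 * PI * (INR m + 1) * c ^ m * (t * t + c * c - 1)).
    + simpl. ring.
    + rewrite E. ring.
  - intros x _. unfold G'. apply (ex_derive_continuous (V := R_NormedModule)). auto_derive; easy. }
assert (E : G 1 - G 0 = 0).
{ unfold G. rewrite Rmult_1_r Rmult_0_r sin_2PI sin_0. ring. }
rewrite E in HG. apply (is_RInt_unique (V := R_CompleteNormedModule)) in HG.
unfold G' in HG.
assert (HG2 : 2 * PI * ((INR m + 2) * wallis (S (S m)) - (INR m + 1) * wallis m) = 0).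
{ rewrite -HG. unfold wallis. rewrite (RInt_scal (V := R_CompleteNormedModule)).
  - change scal with Rmult. f_equal.
    rewrite (RInt_minus (V := R_CompleteNormedModule));
    try apply (ex_RInt_scal (V := R_NormedModule)), cos_pow_ex_RInt.
    rewrite !(RInt_scal (V := R_CompleteNormedModule)); try apply cos_pow_ex_RInt. easy.
  - apply (ex_RInt_minus (V := R_NormedModule)); apply (ex_RInt_scal (V := R_NormedModule)), cos_pow_ex_RInt. }
generalize PI_RGT_0. intros HP. nra.
Qed.

Lemma wallis_0 : wallis 0 = 1.
Proof.
unfold wallis; simpl. rewrite (RInt_const (V := R_CompleteNormedModule)).
unfold scal; simpl; unfold mult; simpl. ring.
Qed.

Lemma wallis_even k : wallis (2 * k) / INR (fact (2 * k)) = / (4 ^ k * INR (fact k) ^ 2).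
Proof.
induction k as [|k IH].
- simpl. rewrite wallis_0. field.
- replace (2 * S k)%nat with (S (S (2 * k))) by lia.
  assert (E := wallis_rec (2 * k)).
  assert (H2 : INR (2 * k) = 2 * INR k) by (rewrite mult_INR; easy).
  assert (Hk := pos_INR k).
  replace (wallis (S (S (2 * k)))) with ((INR (2 * k) + 1) * wallis (2 * k) / (INR (2 * k) + 2)).
  2:{ rewrite -E. field. rewrite H2. lra. }
  rewrite (fact_simpl (S (2 * k))) (fact_simpl (2 * k)) (fact_simpl k).
  rewrite (mult_INR (S (S (2 * k)))) (mult_INR (S (2 * k))) (mult_INR (S k)) !S_INR H2.
  replace ((2 * INR k + 1) * wallis (2 * k) / (2 * INR k + 2) /
    ((2 * INR k + 1 + 1) * ((2 * INR k + 1) * INR (fact (2 * k))))) with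
    (wallis (2 * k) / INR (fact (2 * k)) / ((2 * INR k + 2) ^ 2)).
  2:{ field. generalize (INR_fact_neq_0 (2 * k)). repeat split; try lra; easy. }
  rewrite IH. simpl. field. generalize (INR_fact_neq_0 k).
  generalize (pow_nonzero 4 k ltac:(lra)). repeat split; try lra; easy.
Qed.

(** Bessel's integral, the mean of cos (x cos 2 pi s). The analytic properties of [J0] are proved in
    this form. *)
Definition bessel (x : R) : R := phase_int 0 0 x 1.

Lemma bessel_E x : bessel x = RInt (fun s => cos (x * cos (2 * PI * s))) 0 1.
Proof.
apply (RInt_ext (V := R_CompleteNormedModule)). intros s _. unfold phase. simpl. rewrite Rmult_1_l. f_equal; ring.
Qed.

Lemma cos_poly_ex_RInt n x y z : ex_RInt (fun s => cos_poly n (x * cos (2 * PI * s))) y z.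
Proof.
apply (ex_RInt_continuous (V := R_CompleteNormedModule)). intros u _.
unfold cos_poly. induction n as [|n IH]; simpl sum_f_R0.
- apply continuous_const.
- apply (continuous_plus (V := R_NormedModule)); [easy|].
  apply (ex_derive_continuous (V := R_NormedModule)). auto_derive; easy.
Qed.

Lemma RInt_cos_poly n x : RInt (fun s => cos_poly n (x * cos (2 * PI * s))) 0 1
  = sum_f_R0 (fun m => (-1) ^ m / INR (fact m) ^ 2 * (x / 2) ^ (2 * m)) n.
Proof.
assert (T : forall k, RInt (fun s => (-1) ^ k * (x * cos (2 * PI * s)) ^ (2 * k) / INR (fact (2 * k))) 0 1
  = (-1) ^ k / INR (fact k) ^ 2 * (x / 2) ^ (2 * k)).
{ intros k. rewrite (RInt_ext (V := R_CompleteNormedModule) _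
    (fun s => scal ((-1) ^ k * x ^ (2 * k) / INR (fact (2 * k))) (cos (2 * PI * s) ^ (2 * k)))).
  - rewrite (RInt_scal (V := R_CompleteNormedModule)); [|apply cos_pow_ex_RInt].
    change ((-1) ^ k * x ^ (2 * k) / INR (fact (2 * k)) * wallis (2 * k) =
      (-1) ^ k / INR (fact k) ^ 2 * (x / 2) ^ (2 * k)).
    transitivity ((-1) ^ k * x ^ (2 * k) * (wallis (2 * k) / INR (fact (2 * k)))).
    { field. apply INR_fact_neq_0. }
    rewrite wallis_even. unfold Rdiv. rewrite Rpow_mult_distr pow_inv (pow_mult 2).
    replace (2 ^ 2) with 4 by ring. field.
    split; [apply pow_nonzero; lra|apply INR_fact_neq_0].
  - intros s _. rewrite Rpow_mult_distr. unfold scal; simpl; unfold mult; simpl. field.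
    apply INR_fact_neq_0. }
unfold cos_poly. induction n as [|n IH].
- simpl sum_f_R0. apply (T 0%nat).
- simpl sum_f_R0. rewrite (RInt_plus (V := R_CompleteNormedModule)).
  + change plus with Rplus. rewrite IH. f_equal. apply (T (S n)).
  + apply (cos_poly_ex_RInt n x 0 1).
  + apply (ex_RInt_continuous (V := R_CompleteNormedModule)). intros u _.
    apply (ex_derive_continuous (V := R_NormedModule)). auto_derive; easy.
Qed.

(** The partial sums of the series are the integrals of the Taylor polynomials of cos (x cos 2 pi
    s), and the Taylor remainder is at most |x|^k / k! uniformly in s. The shift of the index
    matches [cos_poly_approx], stated for [S n]. *)
Lemma J0_bessel x : J0 x = bessel x.
Proof.
unfold J0. apply is_series_unique.
change (is_lim_seq (sum_n (fun m => (-1) ^ m / INR (fact m) ^ 2 * (x / 2) ^ (2 * m))) (bessel x)).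
apply (is_lim_seq_incr_1 (sum_n (fun m => (-1) ^ m / INR (fact m) ^ 2 * (x / 2) ^ (2 * m)))).
set (e := fun n => Rabs x ^ S (2 * S n) / INR (fact (S (2 * S n)))).
assert (He : is_lim_seq e 0).
{ assert (H := cv_speed_pow_fact (Rabs x)). apply is_lim_seq_Reals in H.
  apply (is_lim_seq_subseq _ 0 (fun n => S (2 * S n))) in H; [exact H|].
  apply eventually_subseq. intros n. lia. }
apply (is_lim_seq_le_le (fun n => bessel x - e n) _ (fun n => bessel x + e n)).
- intros n.
  assert (B : Rabs (bessel x - sum_n (fun m => (-1) ^ m / INR (fact m) ^ 2 * (x / 2) ^ (2 * m)) (S n)) <= e n).
  { rewrite sum_n_Reals -RInt_cos_poly bessel_E.
    assert (Hc : ex_RInt (fun s => cos (x * cos (2 * PI * s))) 0 1).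
    { apply (ex_RInt_continuous (V := R_CompleteNormedModule)). intros z _.
      apply (ex_derive_continuous (V := R_NormedModule)). auto_derive; easy. }
    assert (Hp := cos_poly_ex_RInt (S n) x 0 1).
    generalize (RInt_minus (V := R_CompleteNormedModule) _ _ _ _ Hc Hp).
    unfold minus, plus, opp; simpl. intros E. unfold Rminus at 1. rewrite -E. clear E.
    replace (e n) with ((1 - 0) * e n) by ring. apply abs_RInt_le_const; [lra| |].
    - apply (ex_RInt_minus (V := R_NormedModule)); easy.
    - intros t _. eapply Rle_trans; [apply cos_poly_approx|]. unfold e.
      apply Rmult_le_compat_r; [apply Rlt_le, Rinv_0_lt_compat, INR_fact_lt_0|].
      apply pow_incr. split; [apply Rabs_pos|]. rewrite Rabs_mult.
      generalize (Rabs_pos x) (Rabs_cos_le1 (2 * PI * t)). intros. nra. }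
  apply Rabs_le_between in B. lra.
- replace (Finite (bessel x)) with (Finite (bessel x - 0)) by (f_equal; ring).
  apply (is_lim_seq_minus' _ _ _ _ (is_lim_seq_const _) He).
- replace (Finite (bessel x)) with (Finite (bessel x + 0)) by (f_equal; ring).
  apply (is_lim_seq_plus' _ _ _ _ (is_lim_seq_const _) He).
Qed.

Lemma one_minus_cos_le y : 1 - cos y <= y ^ 2 / 2.
Proof.
assert (Hpos : forall y, 0 < y -> 1 - cos y <= y ^ 2 / 2).
{ clear y; intros y Hy. destruct (cos_taylor_pos 1 y Hy) as (z & ->).
  assert (E := cos_odd_quarter_turns 0). assert (E3 := cos_half_turns 0).
  simpl mult in *. unfold sum_f_R0. rewrite E E3.
  generalize (COS_bound z) (pow_lt y 2 Hy). simpl. intros. nra. }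
destruct (Rtotal_order y 0) as [Hy|[->|Hy]]; [| |now apply Hpos].
- generalize (Hpos (- y) ltac:(lra)). rewrite cos_neg.
  now replace ((- y) ^ 2) with (y ^ 2) by ring.
- rewrite cos_0. lra.
Qed.

Definition bessel' (x : R) : R := phase_int 1 (0 + PI / 2) x 1.

Lemma bessel_derive x : is_derive bessel x (bessel' x).
Proof. apply phase_int_derive. Qed.

Lemma bessel_continuity x : continuity_pt bessel x.
Proof.
apply continuity_pt_filterlim, (ex_derive_continuous (V := R_NormedModule)).
eexists; apply bessel_derive.
Qed.

Lemma bessel'_continuous x : continuous bessel' x.
Proof.
apply (ex_derive_continuous (V := R_NormedModule)). eexists; apply phase_int_derive.
Qed.

Lemma bessel_0 : bessel 0 = 1.
Proof.
rewrite bessel_E (RInt_ext (V := R_CompleteNormedModule) _ (fun _ => 1)).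
- rewrite (RInt_const (V := R_CompleteNormedModule)).
  unfold scal; simpl; unfold mult; simpl. ring.
- intros s _. rewrite Rmult_0_l. apply cos_0.
Qed.

(** The integrand is - c sin (x c) with c = cos 2 pi s; since |x c| < pi, both factors c and sin (x
    c) have the same sign. On ]0, 1/8[ one has c > 0, whence strictness. *)
Lemma bessel'_neg x : 0 < x < PI -> bessel' x < 0.
Proof.
intros Hx. unfold bessel', phase_int. rewrite Rplus_0_l.
assert (Hle : forall s, phase 1 (PI / 2) x s <= 0 /\
  (0 < cos (2 * PI * s) -> phase 1 (PI / 2) x s < 0)).
{ intros s. unfold phase. set (c := cos (2 * PI * s)).
  rewrite cos_plus cos_PI2 sin_PI2 pow_1 Rmult_0_r Rmult_1_r Rminus_0_l.
  assert (Hc : -1 <= c <= 1) by apply COS_bound.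
  assert (Hp : forall d, 0 < d <= 1 -> 0 < sin (x * d)).
  { intros d Hd. apply sin_gt_0; nra. }
  destruct (Rtotal_order c 0) as [H|[->|H]].
  - generalize (Hp (- c) ltac:(lra)). rewrite Ropp_mult_distr_r_reverse sin_neg.
    intros. split; nra.
  - lra.
  - generalize (Hp c ltac:(lra)). intros. split; nra. }
rewrite -(RInt_Chasles (V := R_CompleteNormedModule) _ 0 (1 / 8) 1);
  try apply phase_ex_RInt.
change plus with Rplus.
assert (H1 : RInt (phase 1 (PI / 2) x) 0 (1 / 8) < 0).
{ apply Ropp_lt_cancel. rewrite Ropp_0. change (0 < opp (RInt (phase 1 (PI / 2) x) 0 (1 / 8))).
  rewrite -(RInt_opp (V := R_CompleteNormedModule)); [|apply phase_ex_RInt].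
  apply RInt_gt_0; [lra| |].
  - intros s Hs. change opp with Ropp.
    enough (phase 1 (PI / 2) x s < 0) by lra.
    apply Hle, cos_gt_0; generalize PI_RGT_0; nra.
  - intros s _. apply (continuous_opp (V := R_NormedModule)), phase_continuous. }
assert (H2 : RInt (phase 1 (PI / 2) x) (1 / 8) 1 <= 0).
{ apply Rle_trans with (RInt (fun _ => 0) (1 / 8) 1).
  - apply RInt_le; [lra|apply phase_ex_RInt|apply ex_RInt_const|]. intros s _. apply Hle.
  - rewrite (RInt_const (V := R_CompleteNormedModule)). right; apply Rmult_0_r. }
lra.
Qed.

Lemma bessel_decr x y : 0 <= x -> x < y -> y <= 3 -> bessel y < bessel x.
Proof.
intros Hx Hxy Hy.
destruct (MVT_cor2 bessel bessel' x y Hxy) as (c & E & Hc).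
- intros c _. apply is_derive_Reals, bessel_derive.
- assert (HPI := PI2_3_2). assert (bessel' c < 0) by (apply bessel'_neg; lra). nra.
Qed.

(** Integrates [one_minus_cos_ge]; the means of cos^2 and cos^4 are 1/2 and 3/8. *)
Lemma one_minus_bessel_ge x : x ^ 2 / 4 - x ^ 4 / 64 <= 1 - bessel x.
Proof.
assert (H2 := wallis_rec 0). assert (H4 := wallis_rec 2).
rewrite wallis_0 in H2. simpl INR in H2, H4.
assert (Hc : ex_RInt (fun s => cos (x * cos (2 * PI * s))) 0 1).
{ apply (ex_RInt_continuous (V := R_CompleteNormedModule)). intros z _.
  apply (ex_derive_continuous (V := R_NormedModule)). auto_derive; easy. }
assert (HR : is_RInt (fun s => 1 - cos (x * cos (2 * PI * s))) 0 1 (1 - bessel x)).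
{ apply (is_RInt_minus (V := R_NormedModule)).
  - replace 1 with (scal (1 - 0) 1) at 2 by (unfold scal; simpl; unfold mult; simpl; ring).
    apply (is_RInt_const (V := R_NormedModule)).
  - rewrite bessel_E. now apply (RInt_correct (V := R_CompleteNormedModule)). }
assert (HL : is_RInt (fun s => x ^ 2 / 2 * cos (2 * PI * s) ^ 2 - x ^ 4 / 24 * cos (2 * PI * s) ^ 4)
  0 1 (x ^ 2 / 2 * wallis 2 - x ^ 4 / 24 * wallis 4)).
{ apply (is_RInt_minus (V := R_NormedModule)); apply (is_RInt_scal (V := R_NormedModule));
  apply (RInt_correct (V := R_CompleteNormedModule)), cos_pow_ex_RInt. }
replace (x ^ 2 / 4 - x ^ 4 / 64) with (x ^ 2 / 2 * wallis 2 - x ^ 4 / 24 * wallis 4).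
- apply (is_RInt_le _ _ 0 1 _ _ ltac:(lra) HL HR). intros s _.
  generalize (one_minus_cos_ge (x * cos (2 * PI * s))). rewrite !Rpow_mult_distr. lra.
- replace (wallis 4) with (3 / 8) by lra. replace (wallis 2) with (1 / 2) by lra. field.
Qed.

Lemma sqrt8_bounds : 0 < sqrt 8 < 3 /\ sqrt 8 * sqrt 8 = 8.
Proof.
assert (H : sqrt 8 * sqrt 8 = 8) by (apply sqrt_sqrt; lra).
assert (0 < sqrt 8) by (apply sqrt_lt_R0; lra). split; [split|]; nra.
Qed.

(** At x = sqrt 8 the bound [one_minus_bessel_ge] reads 2 - 1 <= 1 - bessel x, so there is a zero in
    ]0, sqrt 8]. As [bessel] decreases strictly up to 3, that zero is the first one, and the choice
    that defines [kappa0] has a witness. *)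
Lemma kappa0_spec : 0 < kappa0 <= sqrt 8 /\ bessel kappa0 = 0.
Proof.
assert (H8 := sqrt8_bounds).
assert (Hb : bessel (sqrt 8) <= 0).
{ generalize (one_minus_bessel_ge (sqrt 8)).
  replace (sqrt 8 ^ 4) with ((sqrt 8 * sqrt 8) * (sqrt 8 * sqrt 8)) by ring.
  replace (sqrt 8 ^ 2) with (sqrt 8 * sqrt 8) by ring.
  destruct H8 as [_ ->]. lra. }
destruct (IVT_cor (fun x => bessel x) 0 (sqrt 8)) as (z & Hz & Ez).
{ intros x. apply bessel_continuity. }
{ lra. }
{ rewrite bessel_0. lra. }
assert (Hz0 : 0 < z).
{ destruct Hz as [[Hz|Hz] _]; [easy|]. rewrite -Hz bessel_0 in Ez. lra. }
assert (Hex : exists x, 0 < x /\ J0 x = 0 /\ forall y, 0 < y < x -> J0 y <> 0).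
{ exists z. rewrite J0_bessel. repeat split; auto. intros y Hy. rewrite J0_bessel.
  generalize (bessel_decr y z). lra. }
generalize (epsilon_spec (inhabits 0) _ Hex).
fold (the 0 (fun x => 0 < x /\ J0 x = 0 /\ forall y, 0 < y < x -> J0 y <> 0)).
fold kappa0. intros (H1 & H2 & H3). rewrite J0_bessel in H2. repeat split; auto.
destruct (Rle_dec kappa0 (sqrt 8)) as [|Hn]; [easy|].
exfalso. apply (H3 z); [lra|]. now rewrite J0_bessel.
Qed.

Lemma bessel_lt_inv x y : 0 <= x <= 3 -> 0 <= y <= 3 -> bessel y < bessel x -> x < y.
Proof.
intros Hx Hy H. destruct (Rtotal_order x y) as [|[->|H']]; [easy|lra|].
generalize (bessel_decr y x). lra.
Qed.

Lemma J0_inv_spec y : 0 < y <= 1 -> 0 <= J0_inv y < kappa0 /\ bessel (J0_inv y) = y.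
Proof.
intros Hy. destruct kappa0_spec as [Hk Ek].
destruct (IVT_cor (fun x => bessel x - y) 0 kappa0) as (z & Hz & Ez).
{ intros x. apply continuity_pt_minus; [apply bessel_continuity|now apply continuity_pt_const]. }
{ lra. }
{ rewrite bessel_0 Ek. nra. }
assert (Hex : exists a, 0 <= a < kappa0 /\ J0 a = y).
{ exists z. rewrite J0_bessel. repeat split; try lra.
  destruct Hz as [_ [Hz|Hz]]; [easy|]. rewrite Hz Ek in Ez. lra. }
generalize (epsilon_spec (inhabits 0) _ Hex).
fold (the 0 (fun a => 0 <= a < kappa0 /\ J0 a = y)). fold (J0_inv y).
now rewrite J0_bessel.
Qed.

(** For a^2 <= 8 one has a^2 / 4 - a^4 / 64 = (a^2 / 4) (1 - a^2 / 16) >= a^2 / 8. *)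
Lemma J0_inv_sqr_le y : 0 < y <= 1 -> J0_inv y ^ 2 <= 8 * (1 - y).
Proof.
intros Hy. destruct (J0_inv_spec y Hy) as [H E]. destruct kappa0_spec as [Hk _].
generalize (one_minus_bessel_ge (J0_inv y)) sqrt8_bounds. rewrite E.
set (a := J0_inv y) in *. intros Ha H8.
assert (a ^ 2 <= 8) by (simpl; nra).
replace (a ^ 4) with (a ^ 2 * a ^ 2) in Ha by ring.
assert (0 <= a ^ 2) by apply pow2_ge_0. nra.
Qed.

Lemma J0_inv_pos y : 0 < y < 1 -> 0 < J0_inv y.
Proof.
intros Hy. destruct (J0_inv_spec y) as [[[H|H] _] E]; [lra|easy|].
rewrite -H bessel_0 in E. lra.
Qed.

Lemma J0_inv_lt_3 y : 0 < y <= 1 -> 0 <= J0_inv y < 3.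
Proof.
intros Hy. generalize (J0_inv_spec y Hy) kappa0_spec sqrt8_bounds. lra.
Qed.

(** Monotonicity of [bessel] makes the inverse continuous, and the mean value theorem turns its
    difference quotient into 1 / bessel' at an intermediate point. The value y = 1 is excluded
    because bessel' vanishes at 0. *)
Lemma J0_inv_derive y : 0 < y < 1 -> is_derive J0_inv y (/ bessel' (J0_inv y)).
Proof.
intros Hy. assert (Hy' : 0 < y <= 1) by lra.
assert (HPI := PI2_3_2).
destruct (J0_inv_spec y Hy') as [Ha Ea]. assert (Hp := J0_inv_pos y Hy).
assert (H3 := J0_inv_lt_3 y Hy').
set (a := J0_inv y) in *. assert (Hd : bessel' a < 0) by (apply bessel'_neg; lra).
assert (Hcont : forall e, 0 < e -> exists d, 0 < d /\
  forall z, Rabs (z - y) < d -> 0 < z < 1 /\ Rabs (J0_inv z - a) < e).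
(* Keeps [a - e', a + e'] inside ]0, 3[, where [bessel] is strictly decreasing. *)
{ intros e He. set (e' := Rmin e (Rmin a (3 - a)) / 2).
  assert (He' : 0 < e' < e /\ e' < a /\ a + e' < 3).
  { unfold e'. generalize (Rmin_l e (Rmin a (3 - a))) (Rmin_r e (Rmin a (3 - a)))
      (Rmin_l a (3 - a)) (Rmin_r a (3 - a)).
    assert (0 < Rmin e (Rmin a (3 - a))) by (repeat apply Rmin_case; lra). lra. }
  assert (D1 : bessel (a + e') < y) by (rewrite -Ea; apply bessel_decr; lra).
  assert (D2 : y < bessel (a - e')) by (rewrite -Ea; apply bessel_decr; lra).
  exists (Rmin (Rmin y (1 - y)) (Rmin (y - bessel (a + e')) (bessel (a - e') - y))).
  split; [repeat apply Rmin_case; lra|]. intros z Hz.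
  assert (Z1 := Rlt_le_trans _ _ _ Hz (Rmin_l _ _)).
  assert (Z2 := Rlt_le_trans _ _ _ Hz (Rmin_r _ _)).
  assert (Z3 := Rlt_le_trans _ _ _ Z1 (Rmin_l _ _)).
  assert (Z4 := Rlt_le_trans _ _ _ Z1 (Rmin_r _ _)).
  assert (Z5 := Rlt_le_trans _ _ _ Z2 (Rmin_l _ _)).
  assert (Z6 := Rlt_le_trans _ _ _ Z2 (Rmin_r _ _)).
  apply Rabs_lt_between in Z3, Z4, Z5, Z6.
  assert (Hz01 : 0 < z < 1) by lra. split; [easy|].
  destruct (J0_inv_spec z ltac:(lra)) as [_ Ez]. assert (Hz3 := J0_inv_lt_3 z ltac:(lra)).
  apply Rabs_lt_between. split.
  - enough (a - e' < J0_inv z) by lra. apply bessel_lt_inv; lra.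
  - enough (J0_inv z < a + e') by lra. apply bessel_lt_inv; lra. }
apply is_derive_Reals. intros e He.
assert (Hb := bessel'_continuous a).
assert (Hb' : continuous (fun x => / bessel' x) a).
{ apply continuous_comp with (g := Rinv); [easy|].
  apply (ex_derive_continuous (V := R_NormedModule)). auto_derive; lra. }
destruct (proj1 (filterlim_locally _ _) Hb' (mkposreal e He)) as [d1 Hd1].
destruct (Hcont d1 (cond_pos d1)) as (d & Hdp & Hdd).
exists (mkposreal d Hdp). intros h Hh Hhd. simpl in Hhd.
destruct (Hdd (y + h)) as [Hz Hza]. { now replace (y + h - y) with h by ring. }
destruct (J0_inv_spec (y + h) ltac:(lra)) as [_ Ez].
assert (Hz3 := J0_inv_lt_3 (y + h) ltac:(lra)).
assert (Hzp := J0_inv_pos (y + h) Hz).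
fold a. set (a' := J0_inv (y + h)) in *.
destruct (MVT_gen bessel a a' bessel') as (c & Hc & Ec).
{ intros x _. apply bessel_derive. }
{ intros x _. apply bessel_continuity. }
rewrite Ea Ez in Ec.
assert (Hca : Rabs (c - a) <= Rabs (a' - a)).
{ revert Hc. unfold Rmin, Rmax, Rabs. destruct (Rle_dec a a'), (Rcase_abs (c - a)), (Rcase_abs (a' - a)); lra. }
assert (Hc3 : 0 < c < 3).
{ revert Hc. unfold Rmin, Rmax. destruct (Rle_dec a a'); lra. }
assert (Hcn : bessel' c < 0) by (apply bessel'_neg; lra).
assert (Hball := Hd1 c (Rle_lt_trans _ _ _ Hca Hza)).
change (Rabs (/ bessel' c - / bessel' a) < e) in Hball.
replace ((a' - a) / h) with (/ bessel' c); [easy|].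
replace (a' - a) with (h / bessel' c); [field; lra|].
replace h with (bessel' c * (a' - a)) by lra. field; lra.
Qed.

Lemma class_C_J0_inv D n (f : plane -> R) :
  class_C D n f -> (forall q, D q -> 0 < f q < 1) -> class_C D n (fun q => J0_inv (f q)).
Proof.
intros Hf Hn.
apply (class_C_comp_ind D (fun x => 0 < x < 1) J0_inv (fun x => / bessel' (J0_inv x))); auto.
- apply J0_inv_derive.
- intros m _ H _. apply class_C_inv.
  + apply class_C_phase_int; [easy|apply class_C_const].
  + intros q Dq. assert (Hq := Hn q Dq). apply Rlt_not_eq, bessel'_neg.
    generalize (J0_inv_pos _ Hq) (J0_inv_lt_3 (f q)) PI2_3_2. lra.
Qed.

(** * The frame and the formal corrugation *)

Ltac e3_unfold :=
  unfold dot, cross, det, form_app, lin_app, basis_v, basis_w, bil, square, pullback,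
    tensor;
  repeat (progress (unfold minus, opp, plus, scal, mult, zero, prod_plus, prod_scal, prod_opp,
    prod_zero; simpl)).

Ltac e3_ring := e3_unfold; try ring.

Ltac e3_ext := e3_unfold; repeat apply (f_equal2 pair);
  match goal with |- @eq _ ?a ?b => change (@eq R a b) end; ring.

Lemma dot_scal_l a x z : dot (scal a x) z = a * dot x z.
Proof. e3_ring. Qed.

Lemma dot_minus_l x y z : dot (minus x y) z = dot x z - dot y z.
Proof. e3_ring. Qed.

Lemma dot_scal_r a x z : dot z (scal a x) = a * dot z x.
Proof. e3_ring. Qed.

Lemma dot_minus_r x y z : dot z (minus x y) = dot z x - dot z y.
Proof. e3_ring. Qed.

Lemma dot_ge_0 x : 0 <= dot x x.
Proof. destruct x as [[a b] c]. unfold dot; simpl. nra. Qed.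

Lemma norm_sqr (x : E3) : norm x ^ 2 = dot x x.
Proof. rewrite norm_dot. apply pow2_sqrt, dot_ge_0. Qed.

Lemma dot_eq_0 x : dot x x = 0 -> x = zero.
Proof.
destruct x as [[a b] c]. unfold dot; simpl. intros H.
assert (a = 0 /\ b = 0 /\ c = 0) as (-> & -> & ->); [|easy].
repeat split; nra.
Qed.

Lemma norm_pos (x : E3) : 0 < dot x x -> 0 < norm x.
Proof. intros H. rewrite norm_dot. now apply sqrt_lt_R0. Qed.

Lemma norm_pair_sqr {U V : NormedModule R_AbsRing} (x : U) (y : V) :
  norm ((x, y) : prod_NormedModule R_AbsRing U V) ^ 2 = norm x ^ 2 + norm y ^ 2.
Proof.
change (sqrt (norm x ^ 2 + norm y ^ 2) ^ 2 = norm x ^ 2 + norm y ^ 2).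
apply pow2_sqrt. generalize (pow2_ge_0 (norm x)) (pow2_ge_0 (norm y)). lra.
Qed.

Lemma norm_R (x : R) : norm x = Rabs x.
Proof. reflexivity. Qed.

Lemma norm_plane_sqr (v : plane) : norm v ^ 2 = fst v ^ 2 + snd v ^ 2.
Proof. destruct v as [a b]. by rewrite norm_pair_sqr !norm_R !pow2_abs. Qed.

Lemma norm_nonneg {V : NormedModule R_AbsRing} (x : V) : 0 <= norm x.
Proof. apply norm_ge_0. Qed.

Lemma pow2_le_inv x y : 0 <= y -> x ^ 2 <= y ^ 2 -> x <= y.
Proof. intros Hy H. nra. Qed.

Lemma pow2_eq_inv x y : 0 <= x -> 0 <= y -> x ^ 2 = y ^ 2 -> x = y.
Proof. intros Hx Hy H. nra. Qed.

Lemma norm_scal_E3 a (x : E3) : norm (scal a x) = Rabs a * norm x.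
Proof.
apply pow2_eq_inv; [apply norm_nonneg|apply Rmult_le_pos; [apply Rabs_pos|apply norm_nonneg]|].
rewrite Rpow_mult_distr !norm_sqr dot_scal_l dot_scal_r pow2_abs. ring.
Qed.

Lemma norm_tensor x l : norm (tensor x l) = norm x * norm l.
Proof.
apply pow2_eq_inv; [apply norm_nonneg|apply Rmult_le_pos; apply norm_nonneg|].
unfold tensor. rewrite norm_pair_sqr Rpow_mult_distr norm_plane_sqr !norm_sqr.
rewrite !dot_scal_l !dot_scal_r. ring.
Qed.

Definition col_cross (Psi : E3 * E3) : E3 := cross (fst Psi) (snd Psi).

(** With columns x and y, the vector (<x,y>, - <x,x>) is sent to x ^ (x ^ y). If x ^ y = 0,
    injectivity forces <x,x> = 0, and then Psi kills (1, 0). *)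
Lemma injective_col_cross Psi : injective_lin Psi -> 0 < dot (col_cross Psi) (col_cross Psi).
Proof.
intros HI. destruct (dot_ge_0 (col_cross Psi)) as [|E]; [easy|exfalso].
symmetry in E. apply dot_eq_0 in E.
assert (H1 := HI (1, 0)).
assert (H2 := HI (dot (fst Psi) (snd Psi), - dot (fst Psi) (fst Psi))).
assert (E1 : lin_app Psi (dot (fst Psi) (snd Psi), - dot (fst Psi) (fst Psi))
  = cross (fst Psi) (col_cross Psi)).
{ destruct Psi as [[[x1 x2] x3] [[y1 y2] y3]]. unfold col_cross. e3_ext. }
rewrite E1 E in H2.
assert (E2 : cross (fst Psi) zero = zero).
{ unfold cross. change (snd (zero : E3)) with 0. change (fst (fst (zero : E3))) with 0.
  change (snd (fst (zero : E3))) with 0. rewrite !Rmult_0_r !Rminus_0_r. reflexivity. }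
assert (E4 : - dot (fst Psi) (fst Psi) = 0) by exact (f_equal snd (H2 E2)).
assert (E5 : fst Psi = zero) by (apply dot_eq_0; lra).
assert (E6 : lin_app Psi (1, 0) = zero).
{ unfold lin_app; simpl. rewrite E5 scal_zero_r (scal_zero_l (snd Psi)). apply plus_zero_l. }
assert (E7 : 1 = 0) by exact (f_equal fst (H1 E6)). lra.
Qed.

Lemma injective_of_pullback Psi :
  (forall v : plane, v <> zero -> 0 < bil (pullback Psi) v v) -> injective_lin Psi.
Proof.
intros H v Hv. destruct (excluded_middle_informative (v = zero)) as [|Hn]; [easy|].
generalize (H v Hn). rewrite bil_pullback Hv. e3_unfold. unfold dot; simpl. lra.
Qed.

Definition area (Psi : E3 * E3) : R := norm (col_cross Psi).

Definition ker_image (Psi : E3 * E3) (l : plane) : E3 := lin_app Psi (basis_w l).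

(** Height of the image parallelogram over its base Psi(w). It equals the norm of Psi(u), by
    [norm_frame_u], but unlike the chosen vector [frame_u] it is explicit in the columns of Psi. *)
Definition stretch (Psi : E3 * E3) (l : plane) : R := area Psi / norm (ker_image Psi l).

(** [vec_n] and [vec_t] are closed forms of [frame_n] and [frame_t]; the normal depends on the image
    plane and its orientation only, not on [l]. *)
Definition vec_n (Psi : E3 * E3) : E3 := scal (/ area Psi) (col_cross Psi).

Definition vec_t (Psi : E3 * E3) (l : plane) : E3 :=
  scal (/ (norm (ker_image Psi l) * area Psi)) (cross (ker_image Psi l) (col_cross Psi)).

Lemma dot_cross_cross (x y : E3) : dot (cross x y) (cross x y) = dot x x * dot y y - dot x y ^ 2.
Proof. e3_ring. Qed.

Lemma form_app_basis_w (l u : plane) c : form_app l (minus u (scal c (basis_w l))) = form_app l u.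
Proof. destruct l, u. e3_ring. Qed.

Lemma form_app_scal_self (l : plane) c : form_app l (scal c l) = c * (fst l ^ 2 + snd l ^ 2).
Proof. destruct l. e3_ring. Qed.

Lemma lin_app_minus_scal (Psi : E3 * E3) (u v : plane) c :
  lin_app Psi (minus u (scal c v)) = minus (lin_app Psi u) (scal c (lin_app Psi v)).
Proof. destruct Psi as [[[x1 x2] x3] [[y1 y2] y3]], u, v. e3_ext. Qed.

Lemma dot_combination a b (t n : E3) :
  dot (plus (scal a t) (scal b n)) (plus (scal a t) (scal b n)) =
  a ^ 2 * dot t t + 2 * a * b * dot t n + b ^ 2 * dot n n.
Proof. e3_ring. Qed.

Lemma dot_combination_r a b (x t n : E3) :
  dot x (plus (scal a t) (scal b n)) = a * dot x t + b * dot x n.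
Proof. e3_ring. Qed.

Lemma dot_plus_scal a b (x y z : E3) :
  dot (plus x (scal a z)) (plus y (scal b z)) =
  dot x y + b * dot x z + a * dot y z + a * b * dot z z.
Proof. e3_ring. Qed.

Section Frame.

Variables (Psi : E3 * E3) (l : plane).
Hypotheses (HPsi : 0 < dot (col_cross Psi) (col_cross Psi)) (Hl : l <> zero).

Lemma form_norm_pos : 0 < norm l.
Proof.
destruct (norm_nonneg l) as [|E]; [easy|]. exfalso. apply Hl.
exact (norm_eq_zero (l : R2mod) (eq_sym E)).
Qed.

Lemma area_pos : 0 < area Psi.
Proof. now apply norm_pos. Qed.

Lemma area_sqr : area Psi ^ 2 = dot (col_cross Psi) (col_cross Psi).
Proof. apply norm_sqr. Qed.

(** The basis formed by [l] and its rotation by a quarter turn has determinant norm l ^ 2. *)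
Lemma cross_basis : cross (lin_app Psi (basis_v l)) (lin_app Psi (basis_w l))
  = scal (norm l ^ 2) (col_cross Psi).
Proof.
rewrite norm_plane_sqr.
destruct Psi as [[[x1 x2] x3] [[y1 y2] y3]], l as [a b]. unfold col_cross. e3_ext.
Qed.

Lemma ker_image_pos : 0 < norm (ker_image Psi l).
Proof.
assert (E := cross_basis). destruct (norm_nonneg (ker_image Psi l)) as [|E0]; [easy|exfalso].
symmetry in E0. apply (norm_eq_zero (ker_image Psi l : E3mod)) in E0. unfold ker_image in E0. rewrite E0 in E.
assert (E1 : dot (cross (lin_app Psi (basis_v l)) zero) (cross (lin_app Psi (basis_v l)) zero) = 0).
{ rewrite dot_cross_cross. unfold dot, zero; simpl. unfold zero; simpl. ring. }
rewrite E dot_scal_l dot_scal_r in E1.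
assert (Hn := pow_lt _ 2 form_norm_pos). assert (H := Rmult_lt_0_compat _ _ Hn (Rmult_lt_0_compat _ _ Hn HPsi)).
clear - E1 H. rewrite E1 in H. exact (Rlt_irrefl _ H).
Qed.

Lemma stretch_pos : 0 < stretch Psi l.
Proof. apply Rdiv_lt_0_compat; [apply area_pos|apply ker_image_pos]. Qed.

Lemma frame_n_E : frame_n Psi l = vec_n Psi.
Proof.
unfold frame_n, normalize, vec_n. rewrite cross_basis norm_scal_E3 scal_assoc.
f_equal. rewrite Rabs_pos_eq; [|apply pow2_ge_0].
fold (area Psi). generalize form_norm_pos area_pos. intros.
unfold mult; simpl. field. split; lra.
Qed.

Lemma cross_scal_l a x y : cross (scal a x) y = scal a (cross x y).
Proof. e3_ext. Qed.

Lemma cross_scal_r a x y : cross x (scal a y) = scal a (cross x y).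
Proof. e3_ext. Qed.

Lemma frame_t_E : frame_t Psi l = vec_t Psi l.
Proof.
unfold frame_t. rewrite frame_n_E. unfold frame_w, normalize, vec_n, vec_t.
rewrite cross_scal_l cross_scal_r scal_assoc. f_equal.
fold (ker_image Psi l). generalize ker_image_pos area_pos. intros.
unfold mult; simpl. field. split; lra.
Qed.

Lemma ker_image_dot_cross : dot (ker_image Psi l) (col_cross Psi) = 0.
Proof. unfold ker_image, col_cross. destruct Psi, l. e3_ring. Qed.

Lemma vec_t_sqr : dot (vec_t Psi l) (vec_t Psi l) = 1.
Proof.
unfold vec_t. rewrite dot_scal_l dot_scal_r dot_cross_cross ker_image_dot_cross.
rewrite -area_sqr -norm_sqr. generalize ker_image_pos area_pos. intros. field. split; lra.
Qed.

Lemma vec_n_sqr : dot (vec_n Psi) (vec_n Psi) = 1.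
Proof.
unfold vec_n. rewrite dot_scal_l dot_scal_r -area_sqr. generalize area_pos. intros. field. lra.
Qed.

Lemma vec_tn : dot (vec_t Psi l) (vec_n Psi) = 0.
Proof.
unfold vec_t, vec_n. rewrite dot_scal_l dot_scal_r.
replace (dot (cross _ _) _) with 0; [ring|]. destruct (ker_image Psi l), (col_cross Psi). e3_ring.
Qed.

Lemma lin_app_vec_n v : dot (lin_app Psi v) (vec_n Psi) = 0.
Proof.
unfold vec_n. rewrite dot_scal_r. replace (dot _ _) with 0; [ring|].
unfold col_cross. e3_ring.
Qed.

(** Since det (v, w) = l(v) for w = [basis_w l], the parallelogram on Psi(v) and Psi(w) has area
    |l(v)| times [area Psi]; its height over Psi(w) is the component along t, up to sign. *)
Lemma lin_app_vec_t v : dot (lin_app Psi v) (vec_t Psi l) = form_app l v * stretch Psi l.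
Proof.
unfold vec_t, stretch. rewrite dot_scal_r.
replace (dot _ _) with (form_app l v * area Psi ^ 2).
- generalize ker_image_pos area_pos. intros. field. split; lra.
- rewrite area_sqr. unfold ker_image, col_cross. destruct Psi, l, v. e3_ring.
Qed.

(** Existence: from a vector on which [l] is 1, a multiple of w in ker l is removed so that the
    image becomes orthogonal to Psi(w). For the chosen vector, pairing with t identifies the
    factor. *)
Lemma frame_u_E : form_app l (frame_u Psi l) = 1 /\
  lin_app Psi (frame_u Psi l) = scal (stretch Psi l) (vec_t Psi l).
Proof.
assert (Hex : exists u, form_app l u = 1 /\ exists c, lin_app Psi u = scal c (frame_t Psi l)).
{ set (W := ker_image Psi l). set (C := col_cross Psi).
  assert (HW : 0 < dot W W) by (rewrite -norm_sqr; apply pow_lt, ker_image_pos).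
  assert (Hn := pow_lt _ 2 form_norm_pos). assert (En := norm_plane_sqr l).
  set (u0 := scal (/ norm l ^ 2) l : plane).
  set (u := minus u0 (scal (dot (lin_app Psi u0) W / dot W W) (basis_w l)) : plane).
  assert (Hu : form_app l u = 1).
  { unfold u, u0. rewrite form_app_basis_w form_app_scal_self -En.
    exact (Rinv_l _ (Rgt_not_eq _ _ Hn)). }
  exists u. split; [easy|]. exists (stretch Psi l). rewrite frame_t_E.
  assert (HuW : dot (lin_app Psi u) W = 0).
  { unfold u. rewrite lin_app_minus_scal dot_minus_l dot_scal_l. fold (ker_image Psi l) W.
    field. lra. }
  assert (HuC : dot (lin_app Psi u) C = 0).
  { unfold C, col_cross. e3_ring. }
  assert (HWC : dot W C = 0) by apply ker_image_dot_cross.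
  assert (Hut := lin_app_vec_t u). rewrite Hu Rmult_1_l in Hut. rewrite -Hut.
  unfold vec_t. fold W C. rewrite dot_scal_r scal_assoc.
  (* Expansion of Psi(u) in the basis W ^ C, W, C, multiplied by the Gram determinant of W and C. As
     Psi(u) is orthogonal to W and C, only the first term survives. *)
  assert (G : scal (dot W W * dot C C - dot W C ^ 2) (lin_app Psi u) =
    plus (scal (dot (lin_app Psi u) (cross W C)) (cross W C))
      (plus (scal (dot (lin_app Psi u) W * dot C C - dot (lin_app Psi u) C * dot W C) W)
        (scal (dot (lin_app Psi u) C * dot W W - dot (lin_app Psi u) W * dot W C) C))).
  { generalize (lin_app Psi u). intros [[z1 z2] z3]. destruct W as [[w1 w2] w3], C as [[c1 c2] c3].
    e3_ext. }
  rewrite HuW HuC HWC in G.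
  assert (G' : scal (dot W W * dot C C) (lin_app Psi u) = scal (dot (lin_app Psi u) (cross W C)) (cross W C)).
  { etransitivity; [|etransitivity; [exact G|]].
    - f_equal. ring.
    - rewrite !Rmult_0_l Rminus_0_r !(scal_zero_l (_ : E3)) !plus_zero_r. reflexivity. }
  apply (f_equal (scal (/ (dot W W * dot C C)))) in G'. rewrite !scal_assoc in G'.
  assert (HC : 0 < dot C C) by easy.
  replace (mult (/ (dot W W * dot C C)) (dot W W * dot C C)) with 1 in G'.
  2:{ unfold mult; simpl. field. split; lra. }
  transitivity (scal 1 (lin_app Psi u)); [symmetry; exact (scal_one (lin_app Psi u))|].
  rewrite G'. f_equal. unfold mult; simpl. fold W C. unfold area. fold C.
  rewrite -(norm_sqr W) -(norm_sqr C). generalize ker_image_pos area_pos. unfold area. fold W C.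
  intros. field. split; lra. }
generalize (epsilon_spec (inhabits (0, 0)) _ Hex).
fold (the (0, 0) (fun u => form_app l u = 1 /\ exists c, lin_app Psi u = scal c (frame_t Psi l))).
fold (frame_u Psi l). intros [H1 [c Hc]]. split; [easy|]. rewrite Hc frame_t_E. f_equal.
assert (E := lin_app_vec_t (frame_u Psi l)). rewrite H1 Hc frame_t_E dot_scal_l vec_t_sqr in E. lra.
Qed.

Lemma norm_frame_u : norm (lin_app Psi (frame_u Psi l)) = stretch Psi l.
Proof.
rewrite (proj2 frame_u_E) norm_scal_E3 norm_dot vec_t_sqr sqrt_1 Rmult_1_r.
apply Rabs_pos_eq, Rlt_le, stretch_pos.
Qed.

Definition radius (eta : R) : R := sqrt (eta + stretch Psi l ^ 2).

Lemma frame_r_E eta : frame_r Psi l eta = radius eta.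
Proof. unfold frame_r. now rewrite norm_frame_u. Qed.

Definition aperture (eta : R) : R := J0_inv (stretch Psi l / radius eta).

Lemma frame_alpha_E eta : frame_alpha Psi l eta = aperture eta.
Proof. unfold frame_alpha. now rewrite norm_frame_u frame_r_E. Qed.

Lemma radius_sqr eta : 0 <= eta -> radius eta ^ 2 = eta + stretch Psi l ^ 2.
Proof.
intros H. unfold radius. apply pow2_sqrt.
generalize (pow2_ge_0 (stretch Psi l)). lra.
Qed.

Lemma radius_pos eta : 0 <= eta -> 0 < radius eta.
Proof.
intros H. apply sqrt_lt_R0. generalize (pow_lt _ 2 stretch_pos). lra.
Qed.

Lemma stretch_ratio eta : 0 <= eta -> 0 < stretch Psi l / radius eta <= 1.
Proof.
intros H. assert (Hr := radius_pos eta H). assert (Hs := stretch_pos).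
split; [now apply Rdiv_lt_0_compat|]. apply Rle_div_l; [easy|]. rewrite Rmult_1_l.
generalize (radius_sqr eta H). intros. apply pow2_le_inv; lra.
Qed.

Lemma stretch_ratio_lt eta : 0 < eta -> 0 < stretch Psi l / radius eta < 1.
Proof.
intros H. assert (H' : 0 <= eta) by lra. assert (Hr := radius_pos eta H').
split; [apply (stretch_ratio eta H')|]. apply Rlt_div_l; [easy|]. rewrite Rmult_1_l.
generalize (radius_sqr eta H') stretch_pos. intros. nra.
Qed.

(* FCP(Phi) = Phi + increment (x) l. *)
Definition increment (eta theta : R) : E3 :=
  plus (scal (radius eta * cos theta - stretch Psi l) (vec_t Psi l))
    (scal (radius eta * sin theta) (vec_n Psi)).

Lemma increment_E eta theta :
  minus (circle Psi l eta theta) (lin_app Psi (frame_u Psi l)) = increment eta theta.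
Proof.
unfold circle, increment. rewrite frame_r_E frame_t_E frame_n_E (proj2 frame_u_E).
generalize (vec_t Psi l) (vec_n Psi). intros t n. e3_ext.
Qed.

Lemma increment_sqr eta theta : 0 <= eta ->
  dot (increment eta theta) (increment eta theta) =
  eta + 2 * stretch Psi l ^ 2 - 2 * radius eta * stretch Psi l * cos theta.
Proof.
intros H. unfold increment.
rewrite dot_combination vec_t_sqr vec_n_sqr vec_tn.
transitivity (radius eta ^ 2 * (Rsqr (sin theta) + Rsqr (cos theta)) + stretch Psi l ^ 2
  - 2 * radius eta * stretch Psi l * cos theta).
- unfold Rsqr. ring.
- rewrite sin2_cos2 radius_sqr; [ring|easy].
Qed.

(** With increment Z, stretch s and radius r, the cross term 2 l(v) <Psi v, Z> is 2 s (r cos theta -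
    s) l(v)^2, while |Z|^2 = eta + 2 s^2 - 2 r s cos theta. Their sum is eta l(v)^2, free of
    theta. *)
Lemma pullback_increment eta theta : 0 <= eta ->
  pullback (plus Psi (tensor (increment eta theta) l)) =
  plus (pullback Psi) (scal eta (square l)).
Proof.
intros H. set (Z := increment eta theta).
assert (HZ : forall v, dot (lin_app Psi v) Z =
  form_app l v * stretch Psi l * (radius eta * cos theta - stretch Psi l)).
{ intros v. unfold Z, increment. rewrite dot_combination_r lin_app_vec_t lin_app_vec_n. ring. }
assert (H1 := HZ (1, 0)). assert (H2 := HZ (0, 1)).
replace (lin_app Psi (1, 0)) with (fst Psi) in H1.
2:{ destruct Psi as [[[x1 x2] x3] [[y1 y2] y3]]. e3_ext. }
replace (lin_app Psi (0, 1)) with (snd Psi) in H2.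
2:{ destruct Psi as [[[x1 x2] x3] [[y1 y2] y3]]. e3_ext. }
assert (H3 := increment_sqr eta theta H). fold Z in H3. unfold form_app in H1, H2. simpl in H1, H2.
clearbody Z.
unfold pullback, tensor, square. simpl.
change (fst (plus Psi (scal (fst l) Z, scal (snd l) Z))) with (plus (fst Psi) (scal (fst l) Z)).
change (snd (plus Psi (scal (fst l) Z, scal (snd l) Z))) with (plus (snd Psi) (scal (snd l) Z)).
rewrite !dot_plus_scal H1 H2 H3.
repeat (progress (unfold plus, scal, mult, prod_plus, prod_scal; simpl)).
apply (f_equal2 pair); [apply (f_equal2 pair)|]; match goal with |- @eq _ ?a ?b => change (@eq R a b) end; ring.
Qed.

(* 7 comes from alpha^2 <= 8 (1 - J0 alpha) for alpha < kappa0 <= sqrt 8: writing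
   y = J0 alpha, one has (1 - y)^2 + y alpha^2 <= (1 - y) (1 + 7 y) <= 7 (1 - y^2). *)
Lemma increment_le eta c : 0 <= eta -> -1 <= c <= 1 ->
  dot (increment eta (aperture eta * c)) (increment eta (aperture eta * c)) <= 7 * eta.
Proof.
intros H Hc. rewrite increment_sqr; [|easy].
assert (Hr := radius_pos eta H). assert (Hs := stretch_pos).
assert (Hy := stretch_ratio eta H). assert (Er := radius_sqr eta H).
assert (Ha := J0_inv_sqr_le _ Hy).
fold (aperture eta) in Ha.
set (y := stretch Psi l / radius eta) in *. set (a := aperture eta) in *.
assert (Es : stretch Psi l = radius eta * y) by (unfold y; field; lra).
assert (Hcos : 1 - a ^ 2 / 2 <= cos (a * c)).
{ generalize (one_minus_cos_le (a * c)) (pow2_ge_0 a). rewrite Rpow_mult_distr.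
  assert (c ^ 2 <= 1) by nra. intros. nra. }
assert (Hr2 := pow_lt _ 2 Hr).
assert (E1 : eta = radius eta ^ 2 * (1 - y ^ 2)) by (rewrite Es in Er; lra).
assert (E2 : radius eta ^ 2 * y * cos (a * c) >= radius eta ^ 2 * y * (1 - a ^ 2 / 2)).
{ apply Rle_ge, Rmult_le_compat_l; [nra|easy]. }
assert (E3 : radius eta ^ 2 * (y * a ^ 2) <= radius eta ^ 2 * (y * (8 * (1 - y)))).
{ apply Rmult_le_compat_l; [lra|]. apply Rmult_le_compat_l; lra. }
assert (E4 : 0 <= radius eta ^ 2 * ((1 - y) * (1 - y))) by (apply Rmult_le_pos; [lra|nra]).
assert (E5 : 0 <= radius eta ^ 2 * (1 - y)) by (apply Rmult_le_pos; lra).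
rewrite Es.
replace (2 * radius eta * (radius eta * y) * cos (a * c)) with
  (2 * (radius eta ^ 2 * y * cos (a * c))) by ring.
rewrite Rpow_mult_distr. nra.
Qed.

End Frame.

(** * Compactness and periodicity *)

Lemma choice_on {A B : Type} (P : A -> Prop) (Q : A -> B -> Prop) (b0 : B) :
  (forall a, P a -> exists b, Q a b) -> exists f : A -> B, forall a, P a -> Q a (f a).
Proof.
intros H. exists (fun a => epsilon (inhabits b0) (Q a)). intros a Pa.
apply epsilon_spec, H, Pa.
Qed.

(** Compactness by gauges, with the centres of the balls taken in K. In this form products, closed
    subsets and uniform continuity reduce to a choice of gauge, and the cover property [compact_set]
    follows. *)
Definition gcompact {T : UniformSpace} (K : T -> Prop) : Prop :=
  forall delta : T -> posreal, exists s : list T,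
    (forall t, In t s -> K t) /\ forall x, K x -> exists t, In t s /\ ball t (delta t) x.

Lemma list_min {A : Type} (delta : A -> posreal) (s : list A) :
  exists d : posreal, forall t, In t s -> d <= delta t.
Proof.
induction s as [|a s [d IH]]; [now exists (mkposreal 1 Rlt_0_1)|].
exists (mkposreal _ (Rmin_stable_in_posreal d (delta a))). simpl.
intros t [->|Ht]; [apply Rmin_r|]. eapply Rle_trans; [apply Rmin_l|auto].
Qed.

(** Each [a] receives a finite list of second coordinates covering B and, as gauge on the first
    factor, the least radius along that list. *)
Lemma gcompact_prod {T U : UniformSpace} (A : T -> Prop) (B : U -> Prop) :
  gcompact A -> gcompact B ->
  gcompact (fun p : prod_UniformSpace T U => A (fst p) /\ B (snd p)).
Proof.
intros HA HB delta.
destruct (choice_on (fun _ : T => True) (fun a (s : list U) =>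
  (forall t, In t s -> B t) /\ forall y, B y -> exists t, In t s /\ ball t (delta (a, t)) y) nil)
  as [sB HsB].
{ intros a _. apply HB. }
destruct (choice_on (fun _ : T => True) (fun a (d : posreal) =>
  forall t, In t (sB a) -> d <= delta (a, t)) (mkposreal 1 Rlt_0_1)) as [d Hd].
{ intros a _. apply (list_min (fun t => delta (a, t))). }
destruct (HA d) as (sA & HsA & HA').
exists (flat_map (fun a => map (fun b => (a, b)) (sB a)) sA). split.
- intros [a b] Hin. apply in_flat_map in Hin. destruct Hin as (a' & Ha' & Hin).
  apply in_map_iff in Hin. destruct Hin as (b' & E & Hb'). injection E as -> ->.
  split; simpl; [now apply HsA|]. now apply (HsB a I).
- intros [x y] [Hx Hy]. simpl in Hx, Hy. destruct (HA' x Hx) as (a & Ha & Hax).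
  destruct (proj2 (HsB a I) y Hy) as (b & Hb & Hby). exists (a, b). split.
  + apply in_flat_map. exists a. split; [easy|]. now apply in_map.
  + split; simpl; [|easy]. apply ball_le with (d a); [|easy]. now apply Hd.
Qed.

(** At points outside C the gauge is a radius whose ball misses C; centres outside C then cover
    nothing of C and are dropped. *)
Lemma gcompact_closed {T : UniformSpace} (K C : T -> Prop) :
  gcompact K -> (forall x, ~ C x -> locally x (fun y => ~ C y)) ->
  gcompact (fun x => K x /\ C x).
Proof.
intros HK HC delta.
destruct (choice_on (fun x => ~ C x) (fun x (d : posreal) => forall y, ball x d y -> ~ C y)
  (mkposreal 1 Rlt_0_1)) as [d Hd].
{ intros x Hx. apply (HC x Hx). }
set (dec := fun x => excluded_middle_informative (C x)).
destruct (HK (fun x => match dec x with left _ => delta x | right _ => d x end)) as (s & Hs & Hcov).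
exists (filter (fun x => match dec x with left _ => true | right _ => false end) s). split.
- intros t Ht. apply filter_In in Ht. destruct Ht as [Ht E]. destruct (dec t); [auto|easy].
- intros x [Kx Cx]. destruct (Hcov x Kx) as (t & Ht & Hb). exists t.
  destruct (dec t) as [Ct|Ct] eqn:E.
  + split; [|easy]. apply filter_In. split; [easy|]. now rewrite E.
  + now destruct (Hd t Ct x Hb).
Qed.

Lemma gcompact_interval (a b : R) : gcompact (fun x : R => a <= x <= b).
Proof.
intros delta.
(* [compactness_list] is stated under a double negation, for vectors; here they have length 1, hence
   the pairs with [tt]. *)
apply NNPP. intros Hn.
apply (compactness_list 1 (a, tt) (b, tt) (fun t => delta (fst t))). intros [s Hs].
apply Hn. exists (filter (fun x => match excluded_middle_informative (a <= x <= b) with left _ => true | right _ => false end)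
  (map fst s)). split.
- intros t Ht. apply filter_In in Ht. destruct Ht as [_ Ht].
  now destruct (excluded_middle_informative (a <= t <= b)).
- intros x Hx. destruct (Hs (x, tt)) as ([t []] & Ht & Hb & Hc).
  { simpl. tauto. }
  exists t. simpl in Hb, Hc. split.
  + apply filter_In. split; [now apply (in_map fst) in Ht|].
    destruct (excluded_middle_informative (a <= t <= b)); tauto.
  + apply Hc.
Qed.

Lemma compact_of_gcompact {T : UniformSpace} (K : T -> Prop) : gcompact K -> compact_set K.
Proof.
intros HK I O HO Hcov.
destruct (classic (exists x, K x)) as [[x0 Kx0]|Hn].
2:{ exists nil. intros x Kx. destruct Hn. now exists x. }
destruct (Hcov x0 Kx0) as [i0 _].
destruct (choice_on K (fun x (u : I * posreal) => forall y, ball x (snd u) y -> O (fst u) y)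
  (i0, mkposreal 1 Rlt_0_1)) as [u Hu].
{ intros x Kx. destruct (Hcov x Kx) as [i Hi]. destruct (HO i x Hi) as [d Hd].
  now exists (i, d). }
destruct (HK (fun x => snd (u x))) as (s & Hs & Hc).
exists (map (fun x => fst (u x)) s). intros x Kx. destruct (Hc x Kx) as (t & Ht & Hb).
exists (fst (u t)). split; [now apply (in_map (fun x => fst (u x)))|].
now apply (Hu t (Hs t Ht)).
Qed.

(** Continuity is in the ambient space, so [y] may lie outside K. This is what permits the
    comparison of a formal map in the compact set with a real one that is only close to it. *)
Lemma heine {T U : UniformSpace} (K : T -> Prop) (F : T -> U) :
  gcompact K -> (forall x, K x -> continuous F x) ->
  forall e : posreal, exists d : posreal, forall x y, K x -> ball x d y -> ball (F x) e (F y).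
Proof.
intros HK HF e.
(* The gauge is half a radius of continuity: a point within [d] of a covered point is still
   controlled by the centre. *)
destruct (choice_on K (fun x (d : posreal) => forall y, ball x (d + d) y -> ball (F x) (e / 2) (F y))
  (mkposreal 1 Rlt_0_1)) as [d Hd].
{ intros x Kx. destruct (proj1 (filterlim_locally _ _) (HF x Kx) (pos_div_2 e)) as [d Hd].
  exists (pos_div_2 d). simpl. intros y Hy. apply Hd. now replace (pos d) with (d / 2 + d / 2) by field. }
destruct (HK d) as (s & Hs & Hc). destruct (list_min d s) as [d0 Hd0].
exists d0. intros x y Kx Hxy. destruct (Hc x Kx) as (t & Ht & Hb).
replace (pos e) with (e / 2 + e / 2) by field. apply ball_triangle with (F t).
- apply ball_sym, (Hd t (Hs t Ht)). apply ball_le with (d t); [|easy].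
  generalize (cond_pos (d t)); lra.
- apply (Hd t (Hs t Ht)). apply ball_triangle with x; [easy|].
  apply ball_le with d0; [now apply Hd0|easy].
Qed.

Lemma continuous_on_bounded {T : UniformSpace} (K : T -> Prop) (h : T -> R) :
  gcompact K -> continuous_on K h -> exists M, 0 < M /\ forall x, K x -> Rabs (h x) <= M.
Proof.
intros HK Hh.
destruct (choice_on K (fun x (d : posreal) => forall y, K y -> ball x d y -> Rabs (h y - h x) < 1)
  (mkposreal 1 Rlt_0_1)) as [d Hd].
{ intros x Kx. destruct (proj1 (filterlim_locally _ _) (Hh x Kx) (mkposreal 1 Rlt_0_1)) as [d Hd].
  exists d. intros y Ky Hy. now apply Hd. }
destruct (HK d) as (s & Hs & Hc).
assert (HM : exists M, 0 < M /\ forall t, In t s -> Rabs (h t) <= M).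
{ clear -s. induction s as [|a s [M [M0 IH]]]; [exists 1; split; [lra|easy]|].
  exists (Rmax M (Rabs (h a))). split; [apply Rlt_le_trans with M; [easy|apply Rmax_l]|].
  intros t [->|Ht]; [apply Rmax_r|].
  eapply Rle_trans; [apply IH, Ht|apply Rmax_l]. }
destruct HM as (M & M0 & HM). exists (M + 1). split; [lra|]. intros x Kx.
destruct (Hc x Kx) as (t & Ht & Hb). generalize (Hd t (Hs t Ht) x Kx Hb) (HM t Ht).
intros. replace (h x) with (h t + (h x - h t)) by ring.
generalize (Rabs_triang (h t) (h x - h t)). lra.
Qed.

Lemma continuous_on_subset {T U : UniformSpace} (D E : T -> Prop) (f : T -> U) :
  (forall x, E x -> D x) -> continuous_on D f -> continuous_on E f.
Proof.
intros H Hf x Ex P HP. generalize (Hf x (H x Ex) P HP). unfold filtermap, within.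
apply filter_imp. auto.
Qed.

Section Strip.

Variable rho0 : R.

Definition fundamental_domain (p : plane) : Prop :=
  (rho0 <= fst p <= 1) /\ (0 <= snd p <= 2 * PI).

Lemma fundamental_domain_gcompact : gcompact fundamental_domain.
Proof.
exact (gcompact_prod _ _ (gcompact_interval rho0 1) (gcompact_interval 0 (2 * PI))).
Qed.

Lemma periodic_IZR {A : Type} (f : plane -> A) (z : Z) p :
  periodic rho0 f -> strip rho0 p -> f (fst p, snd p + IZR z * (2 * PI)) = f p.
Proof.
intros Hf Hp.
assert (Hn : forall n p, strip rho0 p -> f (fst p, snd p + INR n * (2 * PI)) = f p).
{ clear p Hp. induction n as [|n IH]; intros p Hp.
  - destruct p; simpl. now rewrite Rmult_0_l Rplus_0_r.
  - rewrite S_INR -(IH p Hp).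
    rewrite -(Hf (fst p, snd p + INR n * (2 * PI)) Hp). simpl. do 2 f_equal. ring. }
destruct (Z_le_gt_dec 0 z) as [Hz|Hz].
- rewrite -(Z2Nat.id z Hz) -INR_IZR_INZ. now apply Hn.
- rewrite -(Hn (Z.to_nat (- z)) (fst p, snd p + IZR z * (2 * PI)) Hp). simpl.
  rewrite INR_IZR_INZ Z2Nat.id; [|lia]. rewrite opp_IZR. destruct p; simpl. do 2 f_equal. ring.
Qed.

Lemma strip_reduce p : strip rho0 p -> exists p', fundamental_domain p' /\ strip rho0 p' /\
  forall (A : Type) (f : plane -> A), periodic rho0 f -> f p = f p'.
Proof.
intros Hp. assert (HPI := PI_RGT_0).
set (z := Int_part (snd p / (2 * PI))).
exists (fst p, snd p + IZR (- z) * (2 * PI)). split; [|split; [exact Hp|]].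
- split; [exact Hp|]. simpl. rewrite opp_IZR.
  destruct (base_Int_part (snd p / (2 * PI))) as [H1 H2]. fold z in H1, H2.
  replace (snd p) with (snd p / (2 * PI) * (2 * PI)) by (field; lra). nra.
- intros A f Hf. symmetry. now apply periodic_IZR.
Qed.

Lemma strip_bounded (h : plane -> R) :
  continuous_on (strip rho0) h -> periodic rho0 h ->
  exists M, 0 < M /\ forall p, strip rho0 p -> Rabs (h p) <= M.
Proof.
intros Hc Hp.
destruct (continuous_on_bounded fundamental_domain h fundamental_domain_gcompact) as (M & M0 & HM).
{ revert Hc. apply continuous_on_subset. now intros x [Hx _]. }
exists M. split; [easy|]. intros p Hs. destruct (strip_reduce p Hs) as (p' & H1 & _ & H2).
rewrite (H2 _ _ Hp). now apply HM.
Qed.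

(** An upper bound for 1 / h is inverted. *)
Lemma strip_lower_bound (h : plane -> R) :
  continuous_on (strip rho0) h -> periodic rho0 h ->
  (forall p, strip rho0 p -> 0 < h p) ->
  exists m, 0 < m /\ forall p, strip rho0 p -> m <= h p.
Proof.
intros Hc Hp Hpos.
destruct (strip_bounded (fun p => / h p)) as (M & M0 & HM).
- apply (class_C_inv (strip rho0) 0 h Hc). intros q Hq. now apply Rgt_not_eq, Hpos.
- intros p Hs. now rewrite Hp.
- exists (/ M). split; [now apply Rinv_0_lt_compat|]. intros p Hs.
  generalize (HM p Hs) (Hpos p Hs). intros H1 H2.
  rewrite Rabs_pos_eq in H1; [|now apply Rlt_le, Rinv_0_lt_compat].
  rewrite -(Rinv_inv (h p)). apply Rinv_le_contravar; [now apply Rinv_0_lt_compat|easy].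
Qed.

End Strip.

(** * Differentials on the strip *)

Lemma norm_scal_R {V : NormedModule R_AbsRing} (a : R) (x : V) :
  norm (scal a x) = Rabs a * norm x.
Proof.
apply Rle_antisym; [exact (norm_scal a x)|].
destruct (Req_dec a 0) as [->|Ha].
{ rewrite Rabs_R0 Rmult_0_l. apply norm_nonneg. }
assert (H := norm_scal (/ a) (scal a x)). rewrite scal_assoc in H.
change (mult (/ a) a) with (/ a * a) in H. rewrite Rinv_l in H; [|easy].
rewrite (scal_one x : scal 1 x = x) in H. change (abs (/ a)) with (Rabs (/ a)) in H.
rewrite Rabs_inv in H. assert (Hp := Rabs_pos_lt a Ha).
apply (Rmult_le_compat_l (Rabs a)) in H; [|lra].
rewrite -Rmult_assoc Rinv_r in H; lra.
Qed.

Section Uniqueness.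

Context {V : NormedModule R_AbsRing}.

Lemma has_differential_iff (D : plane -> Prop) (f : plane -> V) p L : D p ->
  has_differential D f p L <-> forall eps : posreal, within D (locally p) (fun q =>
    norm (minus (minus (f q) (f p)) (lin_app L (minus q p))) <= eps * norm (minus q p)).
Proof.
intros Dp. split.
- intros [_ H] eps. exact (H p (within_is_filter_lim D p) eps).
- intros H. split; [apply lin_app_linear|]. intros x Hx.
  rewrite (within_filter_lim_unique _ _ _ Dp Hx). exact H.
Qed.

Definition ray (p v : plane) (t : R) : plane := (fst p + t * fst v, snd p + t * snd v).

Lemma minus_ray p v t : minus (ray p v t) p = scal t v.
Proof. destruct p, v. unfold ray. e3_ext. Qed.

Lemma ray_locally (P : plane -> Prop) p v : locally p P ->
  exists t0, 0 < t0 /\ forall t, 0 < t < t0 -> P (ray p v t).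
Proof.
intros [d Hd]. set (M := 1 + Rabs (fst v) + Rabs (snd v)).
assert (HM : 0 < M) by (unfold M; generalize (Rabs_pos (fst v)) (Rabs_pos (snd v)); lra).
exists (d / M). split; [apply Rdiv_lt_0_compat; [apply cond_pos|easy]|].
intros t Ht. apply Hd.
assert (Htm : t * M < d) by (apply Rlt_div_r; [easy|apply Ht]).
unfold M in Htm. generalize (Rabs_pos (fst v)) (Rabs_pos (snd v)). intros.
split.
- change (Rabs (fst p + t * fst v - fst p) < d).
  replace (fst p + t * fst v - fst p) with (t * fst v) by ring.
  rewrite Rabs_mult (Rabs_pos_eq t); nra.
- change (Rabs (snd p + t * snd v - snd p) < d).
  replace (snd p + t * snd v - snd p) with (t * snd v) by ring.
  rewrite Rabs_mult (Rabs_pos_eq t); nra.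
Qed.

Lemma norm_minus_triangle (a b c : V) : norm (minus b c) <= norm (minus a b) + norm (minus a c).
Proof.
replace (minus b c) with (plus (minus b a) (minus a c)).
- eapply Rle_trans; [apply norm_triangle|]. rewrite -(norm_opp (minus b a)) opp_minus. lra.
- unfold minus. by rewrite plus_assoc -(plus_assoc b) plus_opp_l plus_zero_r.
Qed.

(** Both remainders are o(t) along the ray, so the two differentials agree in any direction in which
    D contains a short segment. Boundary points of the strip are covered by inward directions. *)
Lemma has_differential_ray (D : plane -> Prop) (f : plane -> V) p L L' v t0 :
  D p -> 0 < t0 -> (forall t, 0 < t < t0 -> D (ray p v t)) ->
  has_differential D f p L -> has_differential D f p L' -> lin_app L v = lin_app L' v.
Proof.
intros Dp Ht0 HD HL HL'.
rewrite (has_differential_iff _ _ _ _ Dp) in HL. rewrite (has_differential_iff _ _ _ _ Dp) in HL'.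
set (x := norm (minus (lin_app L v) (lin_app L' v))).
assert (Hx : forall eps : posreal, x <= 2 * eps * norm v).
{ intros eps. generalize (filter_and _ _ (HL eps) (HL' eps)). intros H.
  destruct (ray_locally _ p v H) as (t1 & Ht1 & H1).
  set (t := Rmin t0 t1 / 2).
  assert (Ht : 0 < t < t0 /\ t < t1).
  { unfold t. generalize (Rmin_l t0 t1) (Rmin_r t0 t1). assert (0 < Rmin t0 t1) by now apply Rmin_case.
    lra. }
  destruct (H1 t (conj (proj1 (proj1 Ht)) (proj2 Ht)) (HD t (proj1 Ht))) as [A B].
  rewrite minus_ray in A, B. revert A B.
  rewrite !(linear_scal _ (lin_app_linear _)). intros A B.
  assert (C := norm_minus_triangle (minus (f (ray p v t)) (f p)) (scal t (lin_app L v)) (scal t (lin_app L' v))).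
  assert (E1 : norm (minus (scal t (lin_app L v)) (scal t (lin_app L' v))) = t * x).
  { etransitivity; [exact (f_equal norm (eq_sym (scal_minus_distr_l t (lin_app L v) (lin_app L' v))))|].
    rewrite norm_scal_R Rabs_pos_eq; [easy|lra]. }
  assert (E2 : norm (scal t v) = t * norm v).
  { etransitivity; [exact (norm_scal_R (V := R2mod) t v)|].
    rewrite (Rabs_pos_eq t); [easy|]. apply Rlt_le, Ht. }
  rewrite E1 in C. rewrite E2 in A, B.
  destruct Ht as [[Ht _] _]. apply Rmult_le_reg_l with t; [exact Ht|]. apply (Rle_trans _ _ _ C).
  apply (Rle_trans _ _ _ (Rplus_le_compat _ _ _ _ A B)). right; ring. }
assert (Hx0 : x <= 0).
{ apply le_epsilon. intros e He. rewrite Rplus_0_l.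
  assert (Hn := norm_nonneg v).
  assert (Hp : 0 < e / (2 * (norm v + 1))) by (apply Rdiv_lt_0_compat; lra).
  eapply Rle_trans; [apply (Hx (mkposreal _ Hp))|]. simpl.
  replace (2 * (e / (2 * (norm v + 1))) * norm v) with (e * (norm v / (norm v + 1))) by (field; lra).
  rewrite -{2}(Rmult_1_r e). apply Rmult_le_compat_l; [lra|].
  apply Rle_div_l; lra. }
apply (plus_reg_r (opp (lin_app L' v))). rewrite plus_opp_r.
apply norm_eq_zero. apply Rle_antisym; [exact Hx0|apply norm_nonneg].
Qed.

End Uniqueness.

Lemma lin_app_fst {V : NormedModule R_AbsRing} (L : V * V) : lin_app L (1, 0) = fst L.
Proof. unfold lin_app; simpl. rewrite (scal_zero_l (snd L)) plus_zero_r. exact (scal_one (fst L)). Qed.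

Lemma lin_app_snd {V : NormedModule R_AbsRing} (L : V * V) : lin_app L (0, 1) = snd L.
Proof. unfold lin_app; simpl. rewrite (scal_zero_l (fst L)) plus_zero_l. exact (scal_one (snd L)). Qed.

Lemma lin_app_opp_fst {V : NormedModule R_AbsRing} (L : V * V) : lin_app L (-1, 0) = opp (fst L).
Proof. unfold lin_app; simpl. rewrite (scal_zero_l (snd L)) plus_zero_r. exact (scal_opp_one (fst L)). Qed.

(* Makes differentials relative to D unique. *)
Definition thick (D : plane -> Prop) : Prop := forall p, D p ->
  exists t0, 0 < t0 /\ (forall t, 0 < t < t0 -> D (ray p (0, 1) t)) /\
    ((forall t, 0 < t < t0 -> D (ray p (1, 0) t)) \/ (forall t, 0 < t < t0 -> D (ray p (-1, 0) t))).

Lemma has_differential_unique {V : NormedModule R_AbsRing} D (f : plane -> V) p L L' :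
  thick D -> D p -> has_differential D f p L -> has_differential D f p L' -> L = L'.
Proof.
intros HD Dp HL HL'. destruct (HD p Dp) as (t0 & Ht0 & H2 & H1).
assert (E2 := has_differential_ray _ _ _ _ _ _ _ Dp Ht0 H2 HL HL').
rewrite !lin_app_snd in E2.
assert (E1 : fst L = fst L').
{ destruct H1 as [H1|H1]; generalize (has_differential_ray _ _ _ _ _ _ _ Dp Ht0 H1 HL HL').
  - now rewrite !lin_app_fst.
  - rewrite !lin_app_opp_fst. intros E. now rewrite -(opp_opp (fst L)) E opp_opp. }
destruct L, L'. simpl in *. congruence.
Qed.

Lemma differential_unique {V : NormedModule R_AbsRing} D (f : plane -> V) p L :
  thick D -> D p -> has_differential D f p L -> differential D f p = L.
Proof.
intros HD Dp HL. apply (has_differential_unique D f p); try easy.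
exact (epsilon_spec (inhabits (zero, zero)) (has_differential D f p) (ex_intro _ L HL)).
Qed.

Lemma strip_thick rho0 : rho0 < 1 -> thick (strip rho0).
Proof.
intros Hr p [H1 H2]. unfold strip, ray; simpl.
destruct (Rle_lt_or_eq_dec _ _ H2) as [H|H].
- exists (1 - fst p). split; [lra|]. split; [intros; lra|left; intros; lra].
(* On the edge rho = 1 only the inward radial direction is available. *)
- exists (1 - rho0). split; [lra|]. split; [intros; lra|right; intros; lra].
Qed.

Lemma strip_star_thick rho0 : thick (strip_star rho0).
Proof.
intros p [H1 H2]. unfold strip_star, ray; simpl.
exists (1 - fst p). split; [lra|]. split; [intros; lra|left; intros; lra].
Qed.

Section StripDifferential.

Variable rho0 : R.
Hypothesis Hrho : 0 < rho0 < 1.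

Let D := strip rho0.

Lemma strip_differential {V : NormedModule R_AbsRing} (f : plane -> V) p L :
  D p -> has_differential D f p L -> differential D f p = L.
Proof. apply differential_unique, strip_thick, Hrho. Qed.

Context {V : NormedModule R_AbsRing}.

Lemma smooth_has_differential (f : plane -> V) p :
  smooth_on_C rho0 f -> D p -> has_differential D f p (differential D f p).
Proof.
intros [_ Hf] Dp. destruct (Hf 1%nat) as (f1 & f2 & H & _).
rewrite (strip_differential _ _ _ Dp (H p Dp)). exact (H p Dp).
Qed.

Lemma class_C_differential n (f : plane -> V) :
  class_C D (S n) f -> class_C D n (fun p => differential D f p).
Proof.
intros (f1 & f2 & H & H1 & H2). apply (class_C_ext D n (fun p => (f1 p, f2 p))).
- intros p Dp. symmetry. now apply strip_differential, H.
- now apply class_C_pair.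
Qed.

(** Combined with uniqueness, this makes the differential of a periodic map periodic. *)
Lemma has_differential_translate (f : plane -> V) p L :
  periodic rho0 f -> D p -> has_differential D f p L ->
  has_differential D f (fst p, snd p + 2 * PI) L.
Proof.
intros Hf Dp HL.
rewrite (has_differential_iff _ _ _ _ Dp) in HL. rewrite has_differential_iff; [|exact Dp].
intros eps. destruct (HL eps) as [d Hd]. exists d. intros q [Hq1 Hq2] Dq.
set (q' := (fst q, snd q - 2 * PI)).
assert (Eq : f q = f q').
{ rewrite -(Hf q' Dq). f_equal. unfold q'. destruct q as [a b]; simpl.
  apply (f_equal (pair a)). assert (E : forall x : R, x = x - 2 * PI + 2 * PI) by (intros; ring). exact (E b). }
assert (Em : minus q (fst p, snd p + 2 * PI) = minus q' p).
{ unfold q'. destruct q, p. e3_ext. }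
rewrite Eq (Hf p Dp) Em. apply Hd; [|exact Dq]. split; [exact Hq1|].
change (Rabs (snd q - (snd p + 2 * PI)) < d) in Hq2.
change (Rabs (snd q - 2 * PI - snd p) < d).
now replace (snd q - 2 * PI - snd p) with (snd q - (snd p + 2 * PI)) by ring.
Qed.

Lemma smooth_differential (f : plane -> V) :
  smooth_on_C rho0 f -> smooth_on_C rho0 (fun p => differential D f p).
Proof.
intros Hf. split.
- intros p Dp. apply strip_differential; [exact Dp|].
  apply has_differential_translate; [apply Hf|easy|]. now apply smooth_has_differential.
- intros n. apply class_C_differential, Hf.
Qed.

Lemma smooth_norm_bounded (f : plane -> V) : smooth_on_C rho0 f ->
  exists M, 0 < M /\ forall p, D p -> norm (f p) <= M.
Proof.
intros Hf. destruct (strip_bounded rho0 (fun p => norm (f p))) as (M & M0 & HM).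
- intros p Dp. eapply filterlim_comp; [exact (class_C_continuous _ 0 _ (proj2 Hf 0%nat) p Dp)|].
  apply filterlim_norm.
- intros p Dp. now rewrite (proj1 Hf p Dp).
- exists M. split; [easy|]. intros p Dp. exact (Rle_trans _ _ _ (Rle_abs _) (HM p Dp)).
Qed.

End StripDifferential.

(** * One corrugation *)

(** Primitive of [phase] minus its mean over a period. It is 1-periodic, hence bounded independently
    of [S]; evaluated at S = N varpi and divided by N it produces the O(1/N) errors. *)
Definition osc (j : nat) (b a S : R) : R := phase_int j b a S - S * phase_int j b a 1.

Lemma osc_derive j b a x :
  is_derive (fun a => osc j b a x) a (osc (S j) (b + PI / 2) a x).
Proof.
apply (is_derive_minus (V := R_NormedModule)); [apply phase_int_derive|].
apply (is_derive_scal (fun a => phase_int j b a 1)), phase_int_derive.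
Qed.

Lemma osc_derive_end j b a x :
  is_derive (osc j b a) x (phase j b a x - phase_int j b a 1).
Proof.
apply (is_derive_minus (V := R_NormedModule)); [apply phase_int_derive_end|].
auto_derive; [easy|ring].
Qed.

Lemma osc_continuous_2d j b a x :
  continuous (fun u : plane => osc j b (fst u) (snd u)) (a, x).
Proof.
apply (continuous_minus (V := R_NormedModule)); [apply phase_int_continuity_2d|].
apply (continuous_mult (K := R_AbsRing)); [apply continuous_snd|].
apply (continuous_comp fst (fun a => phase_int j b a 1)); [apply continuous_fst|].
apply (ex_derive_continuous (V := R_NormedModule)). eexists; apply phase_int_derive.
Qed.

Lemma osc_filterdiff j b a x :
  filterdiff (fun u : plane => osc j b (fst u) (snd u)) (locally (a, x))
    (fun u : plane => plus (scal (fst u) (osc (S j) (b + PI / 2) a x))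
                           (scal (snd u) (phase j b a x - phase_int j b a 1))).
Proof.
apply (is_derive_filterdiff (osc j b) a x
  (fun a x => osc (S j) (b + PI / 2) a x) (phase j b a x - phase_int j b a 1)).
- apply filter_forall. intros [u v]. apply osc_derive.
- apply osc_derive_end.
- apply osc_continuous_2d.
Qed.

Lemma class_C_osc D n j b (a s : plane -> R) :
  class_C D n a -> class_C D n s -> class_C D n (fun q => osc j b (a q) (s q)).
Proof.
intros Ha Hs. apply class_C_Rminus; [now apply class_C_phase_int|].
apply class_C_mult; [easy|]. apply class_C_phase_int; [easy|apply class_C_const].
Qed.

Lemma constant_of_derive_0 (f : R -> R) x : (forall t, is_derive f t 0) -> f x = f 0.
Proof.
intros H. generalize (bounded_variation f (fun _ => 0) 0 0 x). intros B.
assert (B' : Rabs (f x - f 0) <= 0 * Rabs (x - 0)).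
{ apply B. intros t _. split; [apply H|]. rewrite Rabs_R0. lra. }
rewrite Rmult_0_l in B'. generalize (Rabs_pos (f x - f 0)). intros.
assert (E : Rabs (f x - f 0) = 0) by lra. apply Rminus_diag_uniq.
destruct (Req_dec (f x - f 0) 0) as [|Hn]; [easy|]. now apply Rabs_no_R0 in Hn.
Qed.

Lemma phase_periodic j b a s : phase j b a (s + 1) = phase j b a s.
Proof.
unfold phase. replace (2 * PI * (s + 1)) with (2 * PI * s + 2 * PI) by ring.
now rewrite cos_plus cos_2PI sin_2PI Rmult_0_r Rmult_1_r Rminus_0_r.
Qed.

(** The difference has zero derivative in [x], and its value at 0 is osc (1) - osc (0) = 0. *)
Lemma osc_periodic j b a x : osc j b a (x + 1) = osc j b a x.
Proof.
enough (E : osc j b a (x + 1) - osc j b a x = osc j b a (0 + 1) - osc j b a 0).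
{ revert E. unfold osc at 3 4. rewrite phase_int_0 Rplus_0_l. lra. }
apply (constant_of_derive_0 (fun x => osc j b a (x + 1) - osc j b a x)). intros t.
replace 0 with (minus (scal 1 (phase j b a (t + 1) - phase_int j b a 1)) (phase j b a t - phase_int j b a 1)).
- apply (is_derive_minus (V := R_NormedModule)); [|apply osc_derive_end].
  apply (is_derive_comp (osc j b a) (fun t => t + 1)); [apply osc_derive_end|].
  auto_derive; [easy|ring].
- rewrite phase_periodic. unfold minus, plus, opp, scal; simpl. unfold mult; simpl. ring.
Qed.

Lemma osc_periodic_IZR j b a x (z : Z) : osc j b a (x + IZR z) = osc j b a x.
Proof.
assert (Hn : forall n x, osc j b a (x + INR n) = osc j b a x).
{ induction n as [|n IH]; intros y; [now rewrite Rplus_0_r|].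
  rewrite S_INR -Rplus_assoc osc_periodic. apply IH. }
destruct (Z_le_gt_dec 0 z) as [Hz|Hz].
- rewrite -(Z2Nat.id z Hz) -INR_IZR_INZ. apply Hn.
- rewrite -(Hn (Z.to_nat (- z)) (x + IZR z)) INR_IZR_INZ Z2Nat.id; [|lia].
  rewrite opp_IZR. f_equal. ring.
Qed.

(** Periodicity brings the endpoint into [0,1], where the integral and the subtracted mean part are
    each at most 1. *)
Lemma osc_le j b a x : Rabs (osc j b a x) <= 2.
Proof.
destruct (base_Int_part x) as [H1 H2].
rewrite -(osc_periodic_IZR j b a x (- Int_part x)) opp_IZR.
set (y := x + - IZR (Int_part x)). assert (Hy : 0 <= y <= 1) by (unfold y; lra).
unfold osc. eapply Rle_trans; [apply Rabs_triang|]. rewrite Rabs_Ropp Rabs_mult.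
generalize (phase_int_le j b a y) (phase_int_le j b a 1) (Rabs_pos (phase_int j b a 1)).
rewrite Rabs_R1 (Rabs_pos_eq y); [|lra]. intros. nra.
Qed.

(** sin (a cos 2 pi s) changes sign under s -> s + 1/2. Hence I(x + 1/2) + I(x) is constant in x for
    the primitive I, and comparing x = 1/2 with x = 0 gives I(1) = 0. The mean of [gamma] thus has
    no normal component. *)
Lemma phase_int_sin_0 a : phase_int 0 (- (PI / 2)) a 1 = 0.
Proof.
set (P := fun x => phase_int 0 (- (PI / 2)) a (x + 1 / 2) + phase_int 0 (- (PI / 2)) a x).
assert (E : P (1 / 2) = P 0).
{ apply constant_of_derive_0. intros t.
  replace 0 with (plus (scal 1 (phase 0 (- (PI / 2)) a (t + 1 / 2))) (phase 0 (- (PI / 2)) a t)).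
  - apply (is_derive_plus (V := R_NormedModule)); [|apply phase_int_derive_end].
    apply (is_derive_comp (phase_int 0 (- (PI / 2)) a) (fun t => t + 1 / 2)); [apply phase_int_derive_end|].
    auto_derive; [easy|ring].
  - unfold phase. replace (2 * PI * (t + 1 / 2)) with (2 * PI * t + PI) by field.
    rewrite neg_cos. unfold plus, scal; simpl. unfold mult; simpl.
    rewrite !cos_plus cos_neg sin_neg cos_PI2 sin_PI2 Ropp_mult_distr_r_reverse sin_neg. ring. }
unfold P in E. rewrite phase_int_0 Rplus_0_l in E.
replace (1 / 2 + 1 / 2) with 1 in E by field. lra.
Qed.

(** * Regularity of the frame, the radius and the aperture *)

Section Components.

Variables (D : plane -> Prop) (n : nat).

Lemma class_C_fst_of {V W : NormedModule R_AbsRing} (f : plane -> V * W) :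
  class_C (V := prod_NormedModule R_AbsRing V W) D n f -> class_C D n (fun p => fst (f p)).
Proof. apply (class_C_linear (V := prod_NormedModule R_AbsRing V W) D n fst), is_linear_fst. Qed.

Lemma class_C_snd_of {V W : NormedModule R_AbsRing} (f : plane -> V * W) :
  class_C (V := prod_NormedModule R_AbsRing V W) D n f -> class_C D n (fun p => snd (f p)).
Proof. apply (class_C_linear (V := prod_NormedModule R_AbsRing V W) D n snd), is_linear_snd. Qed.

Lemma class_C_coordinates (x : plane -> E3) : class_C D n x ->
  class_C D n (fun p => fst (fst (x p))) /\ class_C D n (fun p => snd (fst (x p))) /\
  class_C D n (fun p => snd (x p)).
Proof.
intros Hx. assert (H := class_C_fst_of (V := R2mod) (W := R_NormedModule) x Hx). split; [|split].
- exact (class_C_fst_of (V := R_NormedModule) (W := R_NormedModule) (fun p => fst (x p)) H).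
- exact (class_C_snd_of (V := R_NormedModule) (W := R_NormedModule) (fun p => fst (x p)) H).
- exact (class_C_snd_of (V := R2mod) (W := R_NormedModule) x Hx).
Qed.

Lemma class_C_dot (x y : plane -> E3) :
  class_C D n x -> class_C D n y -> class_C D n (fun p => dot (x p) (y p)).
Proof.
intros (H1 & H2 & H3)%class_C_coordinates (H4 & H5 & H6)%class_C_coordinates.
unfold dot. repeat apply class_C_Rplus; now apply class_C_mult.
Qed.

Lemma class_C_cross (x y : plane -> E3) :
  class_C D n x -> class_C D n y -> class_C D n (fun p => cross (x p) (y p)).
Proof.
intros (H1 & H2 & H3)%class_C_coordinates (H4 & H5 & H6)%class_C_coordinates.
unfold cross. apply class_C_pair; [apply class_C_pair|];
  apply class_C_Rminus; now apply class_C_mult.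
Qed.

Lemma class_C_norm (x : plane -> E3) :
  class_C D n x -> (forall p, D p -> 0 < dot (x p) (x p)) -> class_C D n (fun p => norm (x p)).
Proof.
intros Hx H. apply (class_C_ext D n (fun p => sqrt (dot (x p) (x p)))).
- intros p _. symmetry. apply norm_dot.
- apply class_C_sqrt; [now apply class_C_dot|easy].
Qed.

Variables (Psi : plane -> E3 * E3) (l : plane) (eta : plane -> R).
Hypotheses (HPsi : class_C D n Psi) (Hl : l <> zero) (Heta : class_C D n eta)
  (Hinj : forall p, D p -> 0 < dot (col_cross (Psi p)) (col_cross (Psi p)))
  (Hpos : forall p, D p -> 0 < eta p).

Lemma class_C_lin_app (v : plane) : class_C D n (fun p => lin_app (Psi p) v).
Proof.
unfold lin_app. apply class_C_plus; (apply class_C_scal; [apply class_C_const|]).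
- now apply class_C_fst_of.
- now apply class_C_snd_of.
Qed.

Lemma class_C_col_cross : class_C D n (fun p => col_cross (Psi p)).
Proof. apply class_C_cross; [now apply class_C_fst_of|now apply class_C_snd_of]. Qed.

Lemma class_C_area : class_C D n (fun p => area (Psi p)).
Proof. apply class_C_norm; [apply class_C_col_cross|easy]. Qed.

Lemma class_C_ker_norm : class_C D n (fun p => norm (ker_image (Psi p) l)).
Proof.
apply class_C_norm; [apply class_C_lin_app|]. intros p Dp. rewrite -norm_sqr.
apply pow_lt. apply (ker_image_pos _ _ (Hinj p Dp) Hl).
Qed.

Lemma class_C_stretch : class_C D n (fun p => stretch (Psi p) l).
Proof.
apply class_C_mult; [apply class_C_area|]. apply class_C_inv; [apply class_C_ker_norm|].
intros p Dp. apply Rgt_not_eq, (ker_image_pos _ _ (Hinj p Dp) Hl).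
Qed.

Lemma class_C_vec_n : class_C D n (fun p => vec_n (Psi p)).
Proof.
apply class_C_scal; [|apply class_C_col_cross]. apply class_C_inv; [apply class_C_area|].
intros p Dp. apply Rgt_not_eq, (area_pos _ (Hinj p Dp)).
Qed.

Lemma class_C_vec_t : class_C D n (fun p => vec_t (Psi p) l).
Proof.
apply class_C_scal; [|apply class_C_cross; [apply class_C_lin_app|apply class_C_col_cross]].
apply class_C_inv; [apply class_C_mult; [apply class_C_ker_norm|apply class_C_area]|].
intros p Dp. apply Rgt_not_eq, Rmult_lt_0_compat.
- apply (ker_image_pos _ _ (Hinj p Dp) Hl).
- apply (area_pos _ (Hinj p Dp)).
Qed.

Lemma class_C_radius : class_C D n (fun p => radius (Psi p) l (eta p)).
Proof.
apply class_C_sqrt.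
- apply class_C_Rplus; [easy|]. simpl. apply class_C_mult; [apply class_C_stretch|].
  apply class_C_mult; [apply class_C_stretch|apply class_C_const].
- intros p Dp. generalize (Hpos p Dp) (pow2_ge_0 (stretch (Psi p) l)). lra.
Qed.

(** Strict positivity of eta keeps the ratio inside ]0, 1[, where [J0_inv] is differentiable. *)
Lemma class_C_aperture : class_C D n (fun p => aperture (Psi p) l (eta p)).
Proof.
apply class_C_J0_inv.
- apply class_C_mult; [apply class_C_stretch|]. apply class_C_inv; [apply class_C_radius|].
  intros p Dp. apply Rgt_not_eq, (radius_pos _ _ (Hinj p Dp) Hl). apply Rlt_le, (Hpos p Dp).
- intros p Dp. apply (stretch_ratio_lt _ _ (Hinj p Dp) Hl _ (Hpos p Dp)).
Qed.

End Components.

Lemma is_RInt_phase j b a x y : is_RInt (phase j b a) x y (RInt (phase j b a) x y).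
Proof. apply (RInt_correct (V := R_CompleteNormedModule)), phase_ex_RInt. Qed.

Lemma RInt_phase_combination (A B C b b' a x : R) (h : R -> R) :
  (forall s, h s = A * phase 0 b a s + B * phase 0 b' a s - C) ->
  RInt h 0 x = A * phase_int 0 b a x + B * phase_int 0 b' a x - x * C.
Proof.
intros Hh. rewrite (RInt_ext (V := R_CompleteNormedModule) _ _ _ _ (fun s _ => Hh s)).
apply (is_RInt_unique (V := R_CompleteNormedModule)).
replace (x * C) with (scal (x - 0) C) by (unfold scal; simpl; unfold mult; simpl; ring).
apply (is_RInt_minus (V := R_NormedModule)); [|apply (is_RInt_const (V := R_NormedModule))].
apply (is_RInt_plus (V := R_NormedModule)); apply (is_RInt_scal (V := R_NormedModule)); apply is_RInt_phase.
Qed.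

Lemma RInt_E3_phase (t n c : E3) b b' a x (F : R -> E3) :
  (forall s, F s = minus (plus (scal (phase 0 b a s) t) (scal (phase 0 b' a s) n)) c) ->
  RInt_E3 F 0 x = minus (plus (scal (phase_int 0 b a x) t) (scal (phase_int 0 b' a x) n)) (scal x c).
Proof.
intros HF. destruct t as [[t1 t2] t3], n as [[n1 n2] n3], c as [[c1 c2] c3].
unfold RInt_E3. etransitivity.
- apply (f_equal2 pair); [apply (f_equal2 pair)|].
  + apply (RInt_phase_combination t1 n1 c1 b b' a). intros s. rewrite HF. e3_ring.
  + apply (RInt_phase_combination t2 n2 c2 b b' a). intros s. rewrite HF. e3_ring.
  + apply (RInt_phase_combination t3 n3 c3 b b' a). intros s. rewrite HF. e3_ring.
- e3_ext.
Qed.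

Lemma phase_00 a s : phase 0 0 a s = cos (a * cos (2 * PI * s)).
Proof. unfold phase. rewrite Rplus_0_r. simpl. ring. Qed.

Lemma phase_0_sin a s : phase 0 (- (PI / 2)) a s = sin (a * cos (2 * PI * s)).
Proof.
unfold phase. simpl. rewrite cos_plus cos_neg sin_neg cos_PI2 sin_PI2. ring.
Qed.

Section Corrugation.

Variables (Psi : E3 * E3) (l : plane).
Hypotheses (HPsi : 0 < dot (col_cross Psi) (col_cross Psi)) (Hl : l <> zero).

Definition vec_rt (Psi : E3 * E3) (l : plane) (eta : R) : E3 :=
  scal (radius Psi l eta) (vec_t Psi l).
Definition vec_rn (Psi : E3 * E3) (l : plane) (eta : R) : E3 :=
  scal (radius Psi l eta) (vec_n Psi).

Lemma gamma_E eta s : gamma Psi l eta s =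
  plus (scal (phase 0 0 (aperture Psi l eta) s) (vec_rt Psi l eta))
    (scal (phase 0 (- (PI / 2)) (aperture Psi l eta) s) (vec_rn Psi l eta)).
Proof.
unfold gamma, circle. rewrite frame_r_E // frame_alpha_E // frame_t_E // frame_n_E //.
rewrite phase_00 phase_0_sin. unfold vec_rt, vec_rn.
generalize (vec_t Psi l) (vec_n Psi). intros t n. e3_ext.
Qed.

Lemma gamma_bar_E eta : gamma_bar Psi l eta =
  plus (scal (phase_int 0 0 (aperture Psi l eta) 1) (vec_rt Psi l eta))
    (scal (phase_int 0 (- (PI / 2)) (aperture Psi l eta) 1) (vec_rn Psi l eta)).
Proof.
unfold gamma_bar.
rewrite (RInt_E3_phase (vec_rt Psi l eta) (vec_rn Psi l eta) zero 0 (- (PI / 2)) (aperture Psi l eta)).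
- generalize (vec_rt Psi l eta) (vec_rn Psi l eta). intros t n. e3_ext.
- intros s. rewrite gamma_E. generalize (vec_rt Psi l eta) (vec_rn Psi l eta). intros t n. e3_ext.
Qed.

Lemma RInt_gamma eta x : RInt_E3 (fun s => minus (gamma Psi l eta s) (gamma_bar Psi l eta)) 0 x =
  plus (scal (osc 0 0 (aperture Psi l eta) x) (vec_rt Psi l eta))
    (scal (osc 0 (- (PI / 2)) (aperture Psi l eta) x) (vec_rn Psi l eta)).
Proof.
rewrite gamma_bar_E. unfold osc.
rewrite (RInt_E3_phase _ _ _ _ _ _ _ _ (fun s => f_equal2 minus (gamma_E eta s) eq_refl)).
generalize (vec_rt Psi l eta) (vec_rn Psi l eta). intros t n. e3_ext.
Qed.

(** The aperture is chosen for this identity: averaging cos (alpha cos 2 pi s) shrinks the radius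
    back to the norm of Psi(u). *)
Lemma radius_bessel eta : 0 <= eta ->
  radius Psi l eta * bessel (aperture Psi l eta) = stretch Psi l.
Proof.
intros H. unfold aperture.
rewrite (proj2 (J0_inv_spec _ (stretch_ratio _ _ HPsi Hl eta H))). field.
apply Rgt_not_eq, (radius_pos _ _ HPsi Hl eta H).
Qed.

(* gamma - gamma_bar is the increment of the formal process because the average of
   gamma is r J_0(alpha) t = Psi(u). *)
Lemma increment_phase eta x : 0 <= eta ->
  plus (scal (phase 0 0 (aperture Psi l eta) x - phase_int 0 0 (aperture Psi l eta) 1) (vec_rt Psi l eta))
    (scal (phase 0 (- (PI / 2)) (aperture Psi l eta) x
       - phase_int 0 (- (PI / 2)) (aperture Psi l eta) 1) (vec_rn Psi l eta)) =
  increment Psi l eta (aperture Psi l eta * cos (2 * PI * x)).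
Proof.
intros H. rewrite phase_int_sin_0 phase_00 phase_0_sin. unfold increment.
rewrite -(radius_bessel eta H). fold (bessel (aperture Psi l eta)). unfold vec_rt, vec_rn.
generalize (vec_t Psi l) (vec_n Psi). intros t n. e3_ext.
Qed.

End Corrugation.

Lemma norm_pair_le {U V : NormedModule R_AbsRing} (x : U) (y : V) :
  norm ((x, y) : prod_NormedModule R_AbsRing U V) <= norm x + norm y.
Proof.
generalize (norm_nonneg x) (norm_nonneg y). intros.
apply pow2_le_inv; [lra|]. rewrite norm_pair_sqr. nra.
Qed.

Lemma norm_fst_le {U V : NormedModule R_AbsRing} (x : prod_NormedModule R_AbsRing U V) :
  norm (fst x) <= norm x.
Proof.
destruct x as [x y]. apply pow2_le_inv; [apply norm_nonneg|]. rewrite norm_pair_sqr.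
generalize (pow2_ge_0 (norm y)). simpl fst. lra.
Qed.

Lemma norm_snd_le {U V : NormedModule R_AbsRing} (x : prod_NormedModule R_AbsRing U V) :
  norm (snd x) <= norm x.
Proof.
destruct x as [x y]. apply pow2_le_inv; [apply norm_nonneg|]. rewrite norm_pair_sqr.
generalize (pow2_ge_0 (norm x)). simpl snd. lra.
Qed.

Lemma norm_plus_scal_le (a b : R) (x y : E3) :
  norm (plus (scal a x) (scal b y)) <= Rabs a * norm x + Rabs b * norm y.
Proof.
rewrite -!norm_scal_E3. exact (norm_triangle (scal a x) (scal b y)).
Qed.

Section Step.

Variables (rho0 : R) (f : plane -> E3) (eta : plane -> R) (w : affine_form).
Hypotheses (Hrho : 0 < rho0 < 1) (Hf : smooth_immersion rho0 f)
  (Heta : smooth_on_C rho0 eta) (Hpos : forall p, strip rho0 p -> 0 < eta p)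
  (Hl : aff_lin w <> zero)
  (Hw : forall p, strip rho0 p -> exists z : Z, aff_app w (fst p, snd p + 2 * PI) - aff_app w p = IZR z).

Let D := strip rho0.
Let l := aff_lin w.
Let Psi p := differential D f p.
Let alpha p := aperture (Psi p) l (eta p).
Let vt p := vec_rt (Psi p) l (eta p).
Let vn p := vec_rn (Psi p) l (eta p).

Lemma step_injective p : D p -> 0 < dot (col_cross (Psi p)) (col_cross (Psi p)).
Proof. intros Dp. now apply injective_col_cross, Hf. Qed.

Lemma step_smooth_Psi : smooth_on_C rho0 Psi.
Proof. apply smooth_differential; [exact Hrho|apply Hf]. Qed.

(** The auxiliary fields are pointwise functions of the differential and of eta, which are periodic;
    only their regularity remains to be shown. *)
Lemma smooth_of_data {V : NormedModule R_AbsRing} (F : E3 * E3 -> R -> V) (h : plane -> V) :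
  (forall p, h p = F (Psi p) (eta p)) -> (forall n, class_C D n h) -> smooth_on_C rho0 h.
Proof.
intros Hh H. split; [|easy]. intros p Dp. rewrite !Hh. f_equal.
- exact (proj1 step_smooth_Psi p Dp).
- exact (proj1 Heta p Dp).
Qed.

Lemma step_smooth_alpha : smooth_on_C rho0 alpha.
Proof.
apply (smooth_of_data (fun P e => aperture P l e)); [easy|]. intros n.
exact (class_C_aperture D n Psi l eta (proj2 step_smooth_Psi n) Hl (proj2 Heta n) step_injective Hpos).
Qed.

Lemma step_smooth_vt : smooth_on_C rho0 vt.
Proof.
apply (smooth_of_data (fun P e => vec_rt P l e)); [easy|]. intros n.
apply class_C_scal; [apply class_C_radius|apply class_C_vec_t];
  first [apply step_smooth_Psi|exact Hl|apply Heta|exact step_injective|exact Hpos].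
Qed.

Lemma step_smooth_vn : smooth_on_C rho0 vn.
Proof.
apply (smooth_of_data (fun P e => vec_rn P l e)); [easy|]. intros n.
apply class_C_scal; [apply (class_C_radius D n Psi l)|apply class_C_vec_n];
  first [apply step_smooth_Psi|exact Hl|apply Heta|exact step_injective|exact Hpos].
Qed.

Definition corrugated (N : nat) (p : plane) : E3 :=
  plus (f p) (scal (/ INR N)
    (plus (scal (osc 0 0 (alpha p) (INR N * aff_app w p)) (vt p))
          (scal (osc 0 (- (PI / 2)) (alpha p) (INR N * aff_app w p)) (vn p)))).

Lemma CP_E N p : D p -> CP rho0 f eta w N p = corrugated N p.
Proof.
intros Dp. unfold CP, corrugated. fold D l. fold (Psi p).
rewrite (RInt_gamma _ _ (step_injective p Dp) Hl). reflexivity.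
Qed.

Lemma has_differential_aff_app N p :
  has_differential D (fun q => INR N * aff_app w q) p (INR N * fst l, INR N * snd l).
Proof.
apply (has_differential_linear D (fun x : R => INR N * x) (aff_app w) p l).
- apply (is_linear_scal_r (K := R_AbsRing) (V := R_NormedModule)), Rmult_comm.
- unfold aff_app. apply (has_differential_eq D _ p (plus l (zero, zero))).
  + apply (plus_zero_r l).
  + apply (has_differential_plus D (form_app (aff_lin w)) (fun _ => aff_cst w)).
    * eapply filterdiff_ext_lin.
      -- apply (filterdiff_linear (form_app (aff_lin w))).
         apply (is_linear_ext (lin_app (V := R_NormedModule) l)); [|apply lin_app_linear].
         intros v. unfold lin_app, form_app, l. e3_ring.
      -- intros v. unfold lin_app, form_app, l. e3_ring.
    * apply has_differential_const.
Qed.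

Lemma class_C_aff_app N n : class_C D n (fun q => INR N * aff_app w q).
Proof.
unfold aff_app, form_app. apply class_C_mult; [apply class_C_const|].
apply class_C_Rplus; [|apply class_C_const].
apply class_C_Rplus; (apply class_C_mult; [apply class_C_const|]); [apply class_C_fst|apply class_C_snd].
Qed.

Lemma class_C_corrugated N n : class_C D n (corrugated N).
Proof.
apply class_C_plus; [apply Hf|]. apply class_C_scal; [apply class_C_const|].
apply class_C_plus; apply class_C_scal.
- apply class_C_osc; [apply step_smooth_alpha|apply class_C_aff_app].
- apply step_smooth_vt.
- apply class_C_osc; [apply step_smooth_alpha|apply class_C_aff_app].
- apply step_smooth_vn.
Qed.

(** One turn changes the affine form by an integer z, hence the endpoint of the integral by N z,
    which is a period of [osc]. *)
Lemma CP_smooth N : smooth_on_C rho0 (CP rho0 f eta w N).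
Proof.
split.
- intros p Dp. rewrite !CP_E; [|easy..]. unfold corrugated.
  destruct (Hw p Dp) as [z Hz].
  replace (aff_app w (fst p, snd p + 2 * PI)) with (aff_app w p + IZR z) by lra.
  assert (Eo : forall b a, osc 0 b a (INR N * (aff_app w p + IZR z)) = osc 0 b a (INR N * aff_app w p)).
  { intros b a. rewrite Rmult_plus_distr_l INR_IZR_INZ -mult_IZR. apply osc_periodic_IZR. }
  rewrite !Eo (proj1 (proj1 Hf) p Dp) (proj1 step_smooth_alpha p Dp)
    (proj1 step_smooth_vt p Dp) (proj1 step_smooth_vn p Dp). reflexivity.
- intros n. apply (class_C_ext D n (corrugated N)).
  + intros p Dp. symmetry. now apply CP_E.
  + apply class_C_corrugated.
Qed.

Lemma has_differential_osc N b p : D p ->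
  has_differential D (fun q => osc 0 b (alpha q) (INR N * aff_app w q)) p
    (let a := alpha p in let x := INR N * aff_app w p in
     let da := differential D alpha p in
     let d1 := osc 1 (b + PI / 2) a x in
     let d2 := phase 0 b a x - phase_int 0 b a 1 in
     (d1 * fst da + d2 * (INR N * fst l), d1 * snd da + d2 * (INR N * snd l))).
Proof.
intros Dp. apply (has_differential_comp2 D (osc 0 b) alpha _ p (differential D alpha p)
  (INR N * fst l, INR N * snd l)).
- exact Dp.
- apply osc_filterdiff.
- apply smooth_has_differential; [exact Hrho|exact step_smooth_alpha|exact Dp].
- apply has_differential_aff_app.
Qed.

(** The terms of the product and chain rules that carry no factor N: derivatives of the frame
    vectors and of the aperture. [sel] is a projection and selects one of the two partial
    derivatives. *)
Definition corrugation_error (N : nat) (p : plane) (sel : forall A : Type, A * A -> A) : E3 :=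
  let a := alpha p in let x := INR N * aff_app w p in
  plus
    (plus (scal (osc 0 0 a x) (sel _ (differential D vt p)))
      (scal (osc 1 (0 + PI / 2) a x * sel _ (differential D alpha p)) (vt p)))
    (plus (scal (osc 0 (- (PI / 2)) a x) (sel _ (differential D vn p)))
      (scal (osc 1 (- (PI / 2) + PI / 2) a x * sel _ (differential D alpha p)) (vn p))).

(** Differentiating [osc] through its endpoint N varpi gives N (phase - mean) l, whose N cancels the
    prefactor 1 / N: by [increment_phase] this is the formal increment. All other terms keep 1 /
    N. *)
Lemma differential_CP N p : (1 <= N)%nat -> D p ->
  minus (differential D (CP rho0 f eta w N) p) (FCP Psi eta w N p) =
  (scal (/ INR N) (corrugation_error N p (fun A => @fst A A)), scal (/ INR N) (corrugation_error N p (fun A => @snd A A))).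
Proof.
intros HN Dp.
assert (HN0 : INR N <> 0) by (apply not_0_INR; lia).
assert (Hvt : has_differential D vt p (differential D vt p)).
{ apply smooth_has_differential; [exact Hrho|exact step_smooth_vt|exact Dp]. }
assert (Hvn : has_differential D vn p (differential D vn p)).
{ apply smooth_has_differential; [exact Hrho|exact step_smooth_vn|exact Dp]. }
assert (Hd := has_differential_plus D f _ p _ _
  (smooth_has_differential rho0 Hrho f p (proj1 Hf) Dp)
  (has_differential_linear D (scal (/ INR N)) _ p _
    (is_linear_scal_r (K := R_AbsRing) (/ INR N) Rmult_comm)
    (has_differential_plus D _ _ p _ _
      (has_differential_scal D _ vt p _ _ Dp (has_differential_osc N 0 p Dp) Hvt)
      (has_differential_scal D _ vn p _ _ Dp (has_differential_osc N (- (PI / 2)) p Dp) Hvn)))).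
rewrite (strip_differential rho0 Hrho _ p _ Dp
  (has_differential_ext D (corrugated N) _ p _ Dp (fun q Dq => eq_sym (CP_E N q Dq)) Hd)).
unfold FCP. fold l. rewrite frame_alpha_E; [|now apply step_injective|exact Hl].
rewrite increment_E; [|now apply step_injective|exact Hl].
fold (alpha p). rewrite Rmult_assoc.
unfold alpha at 8. rewrite -increment_phase; [|now apply step_injective|exact Hl|now apply Rlt_le, Hpos].
fold (alpha p) (vt p) (vn p) (Psi p). unfold corrugation_error, tensor.
set (x := INR N * aff_app w p).
fold D. fold (Psi p).
generalize (Psi p) (vt p) (vn p) (differential D vt p) (differential D vn p) (differential D alpha p).
intros P t n dt dn da.
set (o1 := osc 0 0 _ _). set (o2 := osc 0 (- (PI / 2)) _ _). set (o3 := osc 1 (0 + _) _ _).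
set (o4 := osc 1 (- _ + _) _ _). set (d1 := _ - phase_int 0 0 _ _). set (d2 := _ - phase_int 0 (- _) _ _).
clearbody o1 o2 o3 o4 d1 d2 l.
destruct P as [[[P1 P2] P3] [[P4 P5] P6]], t as [[t1 t2] t3], n as [[n1 n2] n3],
  dt as [[[dt1 dt2] dt3] [[dt4 dt5] dt6]], dn as [[[dn1 dn2] dn3] [[dn4 dn5] dn6]], da as [da1 da2], l as [l1 l2].
e3_unfold. repeat apply (f_equal2 pair); match goal with |- @eq _ ?a ?b => change (@eq R a b) end; field; exact HN0.
Qed.

(** In the error the number N enters only through [osc], at most 2 in absolute value; the smooth
    periodic fields and their differentials are bounded on the strip. *)
Lemma step_estimate : exists C, 0 < C /\ forall N p, (1 <= N)%nat -> D p ->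
  norm (minus (differential D (CP rho0 f eta w N) p) (FCP Psi eta w N p)) <= C / INR N /\
  norm (minus (CP rho0 f eta w N p) (f p)) <= C / INR N.
Proof.
destruct (smooth_norm_bounded rho0 vt step_smooth_vt) as (Mt & Mt0 & HMt).
destruct (smooth_norm_bounded rho0 vn step_smooth_vn) as (Mn & Mn0 & HMn).
destruct (smooth_norm_bounded rho0 _ (smooth_differential rho0 Hrho _ step_smooth_vt)) as (Mdt & Mdt0 & HMdt).
destruct (smooth_norm_bounded rho0 _ (smooth_differential rho0 Hrho _ step_smooth_vn)) as (Mdn & Mdn0 & HMdn).
destruct (smooth_norm_bounded rho0 _ (smooth_differential rho0 Hrho _ step_smooth_alpha)) as (Ma & Ma0 & HMa).
set (B := (2 * Mdt + 2 * Ma * Mt) + (2 * Mdn + 2 * Ma * Mn)).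
assert (HMaMt : 0 < Ma * Mt) by now apply Rmult_lt_0_compat.
assert (HMaMn : 0 < Ma * Mn) by now apply Rmult_lt_0_compat.
(* 2 * B serves the two columns of the differential, 2 * (Mt + Mn) the displacement of the map. *)
exists (2 * B + 2 * (Mt + Mn)). split; [unfold B; lra|]. intros N p HN Dp.
assert (HN0 : 0 < / INR N) by (apply Rinv_0_lt_compat, lt_0_INR; lia).
assert (Hsel : forall sel : forall A : Type, A * A -> A,
  norm (sel _ (differential D vt p)) <= Mdt -> norm (sel _ (differential D vn p)) <= Mdn ->
  Rabs (sel _ (differential D alpha p)) <= Ma -> norm (corrugation_error N p sel) <= B).
{ intros sel H1 H2 H3. unfold corrugation_error.
  eapply Rle_trans; [exact (norm_triangle (plus _ _) (plus _ _))|]. unfold B.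
  apply Rplus_le_compat; (eapply Rle_trans; [apply norm_plus_scal_le|]; apply Rplus_le_compat).
  - apply Rmult_le_compat; [apply Rabs_pos|apply norm_nonneg|apply osc_le|exact H1].
  - rewrite Rabs_mult. apply Rmult_le_compat; [|apply norm_nonneg| |now apply HMt].
    + apply Rmult_le_pos; apply Rabs_pos.
    + apply Rmult_le_compat; [apply Rabs_pos..|apply osc_le|exact H3].
  - apply Rmult_le_compat; [apply Rabs_pos|apply norm_nonneg|apply osc_le|exact H2].
  - rewrite Rabs_mult. apply Rmult_le_compat; [|apply norm_nonneg| |now apply HMn].
    + apply Rmult_le_pos; apply Rabs_pos.
    + apply Rmult_le_compat; [apply Rabs_pos..|apply osc_le|exact H3]. }
assert (HB : forall x : E3, norm x <= B -> norm (scal (/ INR N) x) <= B * / INR N).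
{ intros x Hx. rewrite norm_scal_E3 Rabs_pos_eq; [|lra]. rewrite Rmult_comm.
  apply Rmult_le_compat_r; lra. }
split.
- rewrite differential_CP; [|exact HN|exact Dp].
  eapply Rle_trans; [apply norm_pair_le|].
  assert (H1 := HB _ (Hsel (fun A => @fst A A) (Rle_trans _ _ _ (norm_fst_le _) (HMdt p Dp))
    (Rle_trans _ _ _ (norm_fst_le _) (HMdn p Dp)) (Rle_trans _ _ _
      (norm_fst_le (V := R_NormedModule) (U := R_NormedModule) _) (HMa p Dp)))).
  assert (H2 := HB _ (Hsel (fun A => @snd A A) (Rle_trans _ _ _ (norm_snd_le _) (HMdt p Dp))
    (Rle_trans _ _ _ (norm_snd_le _) (HMdn p Dp)) (Rle_trans _ _ _
      (norm_snd_le (V := R_NormedModule) (U := R_NormedModule) _) (HMa p Dp)))).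
  apply (Rle_trans _ _ _ (Rplus_le_compat _ _ _ _ H1 H2)).
  assert (0 <= (Mt + Mn) * / INR N) by (apply Rmult_le_pos; lra).
  unfold Rdiv. lra.
- rewrite CP_E; [|exact Dp]. unfold corrugated.
  set (Z := plus (scal (osc 0 0 (alpha p) (INR N * aff_app w p)) (vt p))
    (scal (osc 0 (- (PI / 2)) (alpha p) (INR N * aff_app w p)) (vn p)) : E3).
  assert (HZ : norm Z <= 2 * (Mt + Mn)).
  { unfold Z. eapply Rle_trans; [apply norm_plus_scal_le|].
    assert (H1 := osc_le 0 0 (alpha p) (INR N * aff_app w p)).
    assert (H2 := osc_le 0 (- (PI / 2)) (alpha p) (INR N * aff_app w p)).
    rewrite Rmult_plus_distr_l. apply Rplus_le_compat; apply Rmult_le_compat;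
      try apply Rabs_pos; try apply norm_nonneg; try assumption; [now apply HMt|now apply HMn]. }
  replace (minus (plus (f p) (scal (/ INR N) Z)) (f p)) with (scal (/ INR N) Z).
  2:{ clearbody Z. generalize (f p). intros y. e3_ext. }
  rewrite norm_scal_E3 Rabs_pos_eq; [|lra]. rewrite Rmult_comm. unfold Rdiv.
  apply Rmult_le_compat_r; [lra|]. assert (0 < B) by (unfold B; lra). lra.
Qed.

Lemma step_exists (delta : R) : 0 < delta -> exists N, (1 <= N)%nat /\ forall p, D p ->
  norm (minus (differential D (CP rho0 f eta w N) p) (FCP Psi eta w N p)) <= delta /\
  norm (minus (CP rho0 f eta w N p) (f p)) <= delta.
Proof.
intros Hd. destruct step_estimate as (C & C0 & HC).
destruct (INR_unbounded (C / delta)) as [n Hn]. exists (S n). split; [lia|].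
intros p Dp. destruct (HC (S n) p ltac:(lia) Dp) as [H1 H2].
assert (H : C / INR (S n) <= delta).
{ apply Rle_div_l; [apply lt_0_INR; lia|]. apply Rlt_div_l in Hn; [|exact Hd].
  rewrite S_INR. nra. }
split; eapply Rle_trans; eassumption.
Qed.

End Step.

(** * Uniform continuity of the formal corrugation *)

Section Continuity.

Context {T : UniformSpace} (x : T).

Lemma continuous_fst_of {U V : UniformSpace} (f : T -> prod_UniformSpace U V) :
  continuous f x -> continuous (fun t => fst (f t)) x.
Proof. intros Hf. apply (continuous_comp f fst); [easy|apply continuous_fst]. Qed.

Lemma continuous_snd_of {U V : UniformSpace} (f : T -> prod_UniformSpace U V) :
  continuous f x -> continuous (fun t => snd (f t)) x.
Proof. intros Hf. apply (continuous_comp f snd); [easy|apply continuous_snd]. Qed.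

Lemma continuous_pair_of {U V : UniformSpace} (f : T -> U) (g : T -> V) :
  continuous f x -> continuous g x -> continuous (fun t => (f t, g t) : prod_UniformSpace U V) x.
Proof. intros Hf Hg. now apply filterlim_pair_locally; [apply locally_filter|..]. Qed.

Lemma continuous_Rmult (f g : T -> R) :
  continuous f x -> continuous g x -> continuous (fun t => f t * g t) x.
Proof. apply (continuous_mult (K := R_AbsRing)). Qed.

Lemma continuous_Rplus (f g : T -> R) :
  continuous f x -> continuous g x -> continuous (fun t => f t + g t) x.
Proof. apply (continuous_plus (V := R_NormedModule)). Qed.

Lemma continuous_Rminus (f g : T -> R) :
  continuous f x -> continuous g x -> continuous (fun t => f t - g t) x.
Proof. apply (continuous_minus (V := R_NormedModule)). Qed.

Lemma continuous_derivable_comp (phi : R -> R) (f : T -> R) :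
  ex_derive phi (f x) -> continuous f x -> continuous (fun t => phi (f t)) x.
Proof.
intros Hp Hf. apply (continuous_comp f phi); [easy|].
now apply (ex_derive_continuous (V := R_NormedModule)).
Qed.

Lemma continuous_Rinv (f : T -> R) : f x <> 0 -> continuous f x -> continuous (fun t => / f t) x.
Proof. intros Hf. apply continuous_derivable_comp. auto_derive. easy. Qed.

Lemma continuous_Rscal (a : T -> R) (f : T -> E3) :
  continuous a x -> continuous f x -> continuous (fun t => scal (a t) (f t)) x.
Proof. apply (continuous_scal (K := R_AbsRing) (V := E3mod)). Qed.

Lemma continuous_dot (f g : T -> E3) :
  continuous f x -> continuous g x -> continuous (fun t => dot (f t) (g t)) x.
Proof.
intros Hf Hg. unfold dot.
repeat apply continuous_Rplus; apply continuous_Rmult;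
  repeat first [assumption | apply continuous_fst_of | apply continuous_snd_of].
Qed.

Lemma continuous_cross (f g : T -> E3) :
  continuous f x -> continuous g x -> continuous (fun t => cross (f t) (g t)) x.
Proof.
intros Hf Hg. unfold cross.
repeat apply continuous_pair_of; apply continuous_Rminus; apply continuous_Rmult;
  repeat first [assumption | apply continuous_fst_of | apply continuous_snd_of].
Qed.

Lemma continuous_norm_of (f : T -> E3) :
  continuous f x -> continuous (fun t => norm (f t)) x.
Proof. intros Hf. apply (continuous_comp f (norm (V := E3mod))); [easy|apply (filterlim_norm (V := E3mod))]. Qed.

Variables (Psi : T -> E3 * E3) (l : plane) (eta c : T -> R).
Hypotheses (HPsi : continuous Psi x) (Heta : continuous eta x) (Hc : continuous c x)
  (Hl : l <> zero) (Hnd : 0 < dot (col_cross (Psi x)) (col_cross (Psi x))) (Hpos : 0 < eta x).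

Lemma continuous_lin_app v : continuous (fun t => lin_app (Psi t) v) x.
Proof.
unfold lin_app. apply (continuous_plus (V := E3mod));
 (apply continuous_Rscal; [apply continuous_const|]).
- now apply (continuous_fst_of Psi).
- now apply (continuous_snd_of Psi).
Qed.

Lemma continuous_col_cross : continuous (fun t => col_cross (Psi t)) x.
Proof. apply continuous_cross; [now apply (continuous_fst_of Psi)|now apply (continuous_snd_of Psi)]. Qed.

Lemma continuous_area : continuous (fun t => area (Psi t)) x.
Proof. apply continuous_norm_of, continuous_col_cross. Qed.

Lemma continuous_ker_norm : continuous (fun t => norm (ker_image (Psi t) l)) x.
Proof. apply continuous_norm_of, continuous_lin_app. Qed.

Lemma continuous_stretch : continuous (fun t => stretch (Psi t) l) x.
Proof.
apply continuous_Rmult; [apply continuous_area|]. apply continuous_Rinv; [|apply continuous_ker_norm].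
apply Rgt_not_eq, (ker_image_pos _ _ Hnd Hl).
Qed.

Lemma continuous_vec_n : continuous (fun t => vec_n (Psi t)) x.
Proof.
apply continuous_Rscal; [|apply continuous_col_cross]. apply continuous_Rinv; [|apply continuous_area].
apply Rgt_not_eq, (area_pos _ Hnd).
Qed.

Lemma continuous_vec_t : continuous (fun t => vec_t (Psi t) l) x.
Proof.
apply continuous_Rscal; [|apply continuous_cross; [apply continuous_lin_app|apply continuous_col_cross]].
apply continuous_Rinv; [|apply continuous_Rmult; [apply continuous_ker_norm|apply continuous_area]].
apply Rgt_not_eq, Rmult_lt_0_compat; [apply (ker_image_pos _ _ Hnd Hl)|apply (area_pos _ Hnd)].
Qed.

Lemma continuous_radius : continuous (fun t => radius (Psi t) l (eta t)) x.
Proof.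
apply (continuous_derivable_comp sqrt).
- auto_derive. generalize (pow2_ge_0 (stretch (Psi x) l)). lra.
- apply continuous_Rplus; [easy|]. simpl. apply continuous_Rmult; [apply continuous_stretch|].
  apply continuous_Rmult; [apply continuous_stretch|apply continuous_const].
Qed.

Lemma continuous_aperture : continuous (fun t => aperture (Psi t) l (eta t)) x.
Proof.
apply (continuous_derivable_comp J0_inv).
- eexists. apply J0_inv_derive. apply (stretch_ratio_lt _ _ Hnd Hl _ Hpos).
- apply continuous_Rmult; [apply continuous_stretch|]. apply continuous_Rinv; [|apply continuous_radius].
  apply Rgt_not_eq, (radius_pos _ _ Hnd Hl). lra.
Qed.

(** The formal step at a point, with cos (2 pi N varpi) replaced by a free parameter [c]. Uniformity
    over [c] in [-1,1] then means uniformity over all N and all points. *)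
Definition fcp_map (l : plane) (Psi : E3 * E3) (eta c : R) : E3 * E3 :=
  plus Psi (tensor (increment Psi l eta (aperture Psi l eta * c)) l).

Lemma continuous_fcp_map : continuous (fun t => fcp_map l (Psi t) (eta t) (c t)) x.
Proof.
assert (Hth : continuous (fun t => aperture (Psi t) l (eta t) * c t) x).
{ apply continuous_Rmult; [apply continuous_aperture|easy]. }
assert (Hinc : continuous (fun t => increment (Psi t) l (eta t) (aperture (Psi t) l (eta t) * c t)) x).
{ apply (continuous_plus (V := E3mod)).
  - apply continuous_Rscal; [|apply continuous_vec_t].
    apply continuous_Rminus; [|apply continuous_stretch].
    apply continuous_Rmult; [apply continuous_radius|].
    apply (continuous_derivable_comp cos); [auto_derive; easy|easy].
  - apply continuous_Rscal; [|apply continuous_vec_n].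
    apply continuous_Rmult; [apply continuous_radius|].
    apply (continuous_derivable_comp sin); [auto_derive; easy|easy]. }
unfold fcp_map, tensor.
apply (continuous_plus (V := L23mod)); [easy|].
apply (continuous_pair_of (U := E3mod) (V := E3mod)); (apply continuous_Rscal; [apply continuous_const|easy]).
Qed.

End Continuity.

Definition fcp_map_uncurried (l : plane)
    (u : prod_UniformSpace (prod_UniformSpace E3mod E3mod) (R2mod)) :
    prod_UniformSpace E3mod E3mod :=
  fcp_map l (fst u) (fst (snd u)) (snd (snd u)).

Lemma continuous_fcp_map_uncurried l u : l <> zero ->
  0 < dot (col_cross (fst u)) (col_cross (fst u)) -> 0 < fst (snd u) ->
  continuous (fcp_map_uncurried l) u.
Proof.
intros Hl H1 H2. apply (continuous_fcp_map u (fun u => fst u) l (fun u => fst (snd u)) (fun u => snd (snd u)));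
  [apply continuous_fst|apply continuous_fst_of, continuous_snd|
   apply continuous_snd_of, continuous_snd|easy|easy|easy].
Qed.

Lemma FCP_E Phi eta w N p :
  0 < dot (col_cross (Phi p)) (col_cross (Phi p)) -> aff_lin w <> zero ->
  FCP Phi eta w N p = fcp_map (aff_lin w) (Phi p) (eta p) (cos (2 * PI * INR N * aff_app w p)).
Proof.
intros H Hl. unfold FCP, fcp_map. rewrite frame_alpha_E //. now rewrite increment_E.
Qed.

(** * Compact sets of nondegenerate linear maps *)

Definition E3box (M : R) (x : E3) : Prop :=
  ((- M <= fst (fst x) <= M) /\ (- M <= snd (fst x) <= M)) /\ (- M <= snd x <= M).

Lemma E3box_gcompact M : gcompact (E3box M).
Proof.
exact (gcompact_prod _ _ (gcompact_prod _ _ (gcompact_interval (- M) M) (gcompact_interval (- M) M))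
  (gcompact_interval (- M) M)).
Qed.

Lemma E3box_norm M (x : E3) : norm x <= M -> E3box M x.
Proof.
intros H. assert (H0 := norm_nonneg x). assert (E := norm_sqr x).
assert (H2 : norm x ^ 2 <= M ^ 2) by (apply pow_incr; lra).
destruct x as [[a b] c]. unfold E3box, dot in *. simpl in *.
assert (D : forall y, y * y <= M * M -> - M <= y <= M) by (intros y Hy; split; nra).
repeat split; apply D; nra.
Qed.

Definition nondegenerate_box (M m : R) (Psi : E3 * E3) : Prop :=
  (E3box M (fst Psi) /\ E3box M (snd Psi)) /\ m <= dot (col_cross Psi) (col_cross Psi).

Lemma nondegenerate_box_gcompact M m : gcompact (nondegenerate_box M m).
Proof.
refine (gcompact_closed _ (fun Psi => m <= dot (col_cross Psi) (col_cross Psi))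
  (gcompact_prod _ _ (E3box_gcompact M) (E3box_gcompact M)) _).
intros Psi Hn.
assert (Hc : continuous (fun P : E3 * E3 => dot (col_cross P) (col_cross P)) Psi).
{ apply continuous_dot; apply (continuous_col_cross Psi (fun P => P)), continuous_id. }
assert (Hlt : locally (dot (col_cross Psi) (col_cross Psi)) (fun y => y < m)).
{ apply (open_lt m). lra. }
generalize (Hc _ Hlt). unfold filtermap. apply filter_imp. intros P HP. lra.
Qed.

(** Uniform continuity on a compact set: the lower bound [m] on the Gram determinant keeps the frame
    defined, and [e0] keeps eta away from 0, where the aperture ceases to be differentiable. The
    perturbed pair (Psi', eta') need not satisfy these bounds. *)
Lemma fcp_map_stable (l : plane) (M m e0 : R) : l <> zero -> 0 < m -> 0 < e0 ->
  forall e, 0 < e -> exists d, 0 < d /\ forall Psi Psi' eta eta' c,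
    norm Psi <= M -> m <= dot (col_cross Psi) (col_cross Psi) -> e0 <= eta <= M -> -1 <= c <= 1 ->
    norm (minus Psi' Psi) <= d -> Rabs (eta' - eta) <= d ->
    norm (minus (fcp_map l Psi' eta' c) (fcp_map l Psi eta c)) <= e.
Proof.
intros Hl Hm He0 e He.
set (K := fun u : prod_UniformSpace (prod_UniformSpace E3mod E3mod) (R2mod) =>
  nondegenerate_box M m (fst u) /\ ((e0 <= fst (snd u) <= M) /\ (-1 <= snd (snd u) <= 1))).
set (F := fcp_map_uncurried l).
set (W := L23mod).
assert (HK : gcompact K).
{ exact (gcompact_prod _ _ (nondegenerate_box_gcompact M m)
    (gcompact_prod _ _ (gcompact_interval e0 M) (gcompact_interval (-1) 1))). }
(* [norm_factor] converts balls of the product into balls for the Euclidean norm. *)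
assert (Hnf : 0 < e / @norm_factor R_AbsRing W).
{ apply Rdiv_lt_0_compat; [easy|]. apply (@norm_factor_gt_0 R_AbsRing W). }
destruct (heine (U := W) K F HK) with (e := mkposreal _ Hnf) as [d Hd].
{ intros u ([_ Hu1] & [Hu2 _] & _).
  apply continuous_fcp_map_uncurried; [easy|exact (Rlt_le_trans _ _ _ Hm Hu1)|exact (Rlt_le_trans _ _ _ He0 Hu2)]. }
exists (d / 2). assert (Hd0 := cond_pos d). split; [lra|].
intros Psi Psi' eta eta' c H1 H2 H3 H4 H5 H6.
assert (HB : ball (F (Psi, (eta, c)) : W) (mkposreal _ Hnf) (F (Psi', (eta', c)))).
{ apply Hd.
  - split; [|split; [exact H3|exact H4]]. split; [|exact H2]. split; apply E3box_norm.
    + exact (Rle_trans _ _ _ (norm_fst_le _) H1).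
    + exact (Rle_trans _ _ _ (norm_snd_le _) H1).
  - split; [|split].
    + apply (norm_compat1 (V := W) Psi Psi' d). apply Rle_lt_trans with (d / 2); [exact H5|lra].
    + change (Rabs (eta' - eta) < d). lra.
    + apply ball_center. }
apply (norm_compat2 (V := W)) in HB. apply Rlt_le. simpl in HB.
replace e with (@norm_factor R_AbsRing W * (e / @norm_factor R_AbsRing W)); [exact HB|].
field. apply Rgt_not_eq, (@norm_factor_gt_0 R_AbsRing W).
Qed.

Lemma dot_cauchy_schwarz (x y : E3) : Rabs (dot x y) <= norm x * norm y.
Proof.
apply pow2_le_inv; [apply Rmult_le_pos; apply norm_nonneg|].
rewrite pow2_abs Rpow_mult_distr !norm_sqr.
generalize (dot_ge_0 (cross x y)). rewrite dot_cross_cross. lra.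
Qed.

(** Bilinearity and Cauchy-Schwarz, once for each of the three coefficients. *)
Lemma pullback_lipschitz (A B : E3 * E3) :
  norm (minus (pullback A) (pullback B)) <= 3 * (norm A + norm B) * norm (minus A B).
Proof.
assert (Hdot : forall a1 a2 b1 b2 : E3, norm a2 <= norm A -> norm b1 <= norm B ->
  norm (minus a1 b1) <= norm (minus A B) -> norm (minus a2 b2) <= norm (minus A B) ->
  Rabs (dot a1 a2 - dot b1 b2) <= (norm A + norm B) * norm (minus A B)).
{ intros a1 a2 b1 b2 H1 H2 H3 H4.
  replace (dot a1 a2 - dot b1 b2) with (dot (minus a1 b1) a2 + dot b1 (minus a2 b2)).
  2:{ rewrite dot_minus_l dot_minus_r. ring. }
  eapply Rle_trans; [apply Rabs_triang|].
  generalize (dot_cauchy_schwarz (minus a1 b1) a2) (dot_cauchy_schwarz b1 (minus a2 b2)).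
  assert (norm (minus a1 b1) * norm a2 <= norm (minus A B) * norm A) by (apply Rmult_le_compat; auto; apply norm_nonneg).
  assert (norm b1 * norm (minus a2 b2) <= norm B * norm (minus A B)) by (apply Rmult_le_compat; auto; apply norm_nonneg).
  lra. }
assert (A1 := norm_fst_le A). assert (A2 := norm_snd_le A).
assert (B1 := norm_fst_le B). assert (B2 := norm_snd_le B).
assert (D1 : norm (minus (fst A) (fst B)) <= norm (minus A B)) by apply (norm_fst_le (minus A B)).
assert (D2 : norm (minus (snd A) (snd B)) <= norm (minus A B)) by apply (norm_snd_le (minus A B)).
unfold pullback.
eapply Rle_trans; [apply (norm_pair_le (U := R2mod) (V := R_NormedModule))|].
eapply Rle_trans; [apply Rplus_le_compat_r, (norm_pair_le (U := R_NormedModule) (V := R_NormedModule))|].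
refine (Rle_trans _ _ _ (Rplus_le_compat _ _ _ _ (Rplus_le_compat _ _ _ _
  (Hdot _ _ _ _ A1 B1 D1 D1) (Hdot _ _ _ _ A2 B1 D1 D2)) (Hdot _ _ _ _ A2 B2 D2 D2)) _).
right; ring.
Qed.

(** * Symmetric forms, Gram determinants and elementary estimates *)

Lemma sum_n_m_1_3 {G : AbelianMonoid} (u : nat -> G) :
  sum_n_m u 1 3 = plus (plus (u 1%nat) (u 2%nat)) (u 3%nat).
Proof. rewrite sum_n_Sm; [|lia]. rewrite sum_n_Sm; [|lia]. by rewrite sum_n_n. Qed.

Lemma index_cases (i : nat) : (1 <= i <= 3)%nat -> i = 1%nat \/ i = 2%nat \/ i = 3%nat.
Proof. lia. Qed.

Lemma form_app_le (l v : plane) : form_app l v ^ 2 <= norm l ^ 2 * norm v ^ 2.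
Proof.
rewrite !norm_plane_sqr. unfold form_app. destruct l as [a b], v as [x y]. simpl.
generalize (pow2_ge_0 (a * y - b * x)). nra.
Qed.

Lemma bil_plus b c v w : bil (plus b c) v w = bil b v w + bil c v w.
Proof. destruct b as [[b1 b2] b3], c as [[c1 c2] c3]. e3_ring. Qed.

Lemma bil_scal a b v w : bil (scal a b) v w = a * bil b v w.
Proof. destruct b as [[b1 b2] b3]. e3_ring. Qed.

Definition sym_det (b : sym2) : R := fst (fst b) * snd b - snd (fst b) ^ 2.
Definition sym_trace (b : sym2) : R := fst (fst b) + snd b.

(** By Cayley-Hamilton the difference of the two sides is the squared norm of b v. *)
Lemma bil_det_trace (b : sym2) v :
  sym_det b * norm v ^ 2 <= sym_trace b * bil b v v.
Proof.
rewrite norm_plane_sqr. destruct b as [[a b] c], v as [x y].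
unfold sym_det, sym_trace, bil. simpl.
generalize (pow2_ge_0 (a * x + b * y)) (pow2_ge_0 (b * x + c * y)). nra.
Qed.

Lemma class_C_sym_det D n (h : plane -> sym2) : class_C D n h -> class_C D n (fun p => sym_det (h p)).
Proof.
intros (H1 & H2 & H3)%class_C_coordinates. unfold sym_det. simpl.
apply class_C_Rminus; apply class_C_mult; auto. apply class_C_mult; [easy|apply class_C_const].
Qed.

(** For b with coefficients a, b, c, the test vector (-b, a) gives the value a (a c - b^2). *)
Lemma pos_def_det (b : sym2) : (forall v : plane, v <> zero -> 0 < bil b v v) ->
  0 < sym_det b /\ 0 < sym_trace b.
Proof.
intros Hb. destruct b as [[a b] c].
assert (H1 := Hb (1, 0)). assert (H2 := Hb (0, 1)). assert (H3 := Hb (- b, a)).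
unfold bil, sym_det, sym_trace in *. simpl in *.
assert (Ha : 0 < a).
{ enough (0 < a * (1 * 1) + b * (1 * 0 + 0 * 1) + c * (0 * 0)) by lra. apply H1.
  intros E. apply (f_equal fst) in E. simpl in E. unfold zero in E; simpl in E. lra. }
assert (Hc : 0 < c).
{ enough (0 < a * (0 * 0) + b * (0 * 1 + 1 * 0) + c * (1 * 1)) by lra. apply H2.
  intros E. apply (f_equal snd) in E. simpl in E. unfold zero in E; simpl in E. lra. }
split; [|lra].
enough (0 < a * (a * c - b * (b * 1))) by nra.
replace (a * (a * c - b * (b * 1))) with (a * (- b * - b) + b * (- b * a + a * - b) + c * (a * a)) by ring.
apply H3. intros E. apply (f_equal snd) in E. simpl in E. unfold zero in E; simpl in E. lra.
Qed.

Lemma col_cross_det Psi : dot (col_cross Psi) (col_cross Psi) = sym_det (pullback Psi).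
Proof. unfold col_cross. rewrite dot_cross_cross. reflexivity. Qed.

(** With coefficients x, y, z, the vector (-y, x) gives x det >= mu (x^2 + y^2) >= mu x^2, and (1,
    0) gives x >= mu. *)
Lemma sym_det_lower_bound (b : sym2) mu : 0 < mu -> (forall v : plane, mu * norm v ^ 2 <= bil b v v) ->
  mu ^ 2 <= sym_det b.
Proof.
intros Hmu Hb. assert (H1 := Hb (1, 0)). assert (H2 := Hb (- snd (fst b), fst (fst b))).
rewrite norm_plane_sqr in H1. rewrite norm_plane_sqr in H2.
destruct b as [[x y] z]. unfold sym_det, bil in *. simpl in *.
assert (Hx : mu <= x) by lra.
assert (Hd : x * (mu * x) <= x * (x * z - y * (y * 1))) by nra.
apply Rmult_le_reg_l in Hd; nra.
Qed.

Lemma injective_of_lower_bound Psi mu : 0 < mu ->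
  (forall v : plane, mu * norm v ^ 2 <= bil (pullback Psi) v v) -> injective_lin Psi.
Proof.
intros Hmu Hb. apply injective_of_pullback. intros v Hv. eapply Rlt_le_trans; [|apply Hb].
apply Rmult_lt_0_compat; [easy|]. apply pow_lt, (form_norm_pos v Hv).
Qed.

Lemma fcp_map_distance l Psi eta c :
  0 < dot (col_cross Psi) (col_cross Psi) -> l <> zero -> 0 <= eta -> -1 <= c <= 1 ->
  norm (minus (fcp_map l Psi eta c) Psi) <= sqrt (7 * eta) * norm l.
Proof.
intros HP Hl He Hc. unfold fcp_map.
assert (Hi := increment_le Psi l HP Hl eta c He Hc).
set (Z := increment _ _ _ _) in *. clearbody Z.
replace (minus (plus Psi (tensor Z l)) Psi) with (tensor Z l).
- rewrite norm_tensor. apply Rmult_le_compat_r; [apply norm_nonneg|].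
  rewrite norm_dot. now apply sqrt_le_1_alt.
- destruct Psi. e3_ext.
Qed.

Lemma pullback_fcp_map l Psi eta c :
  0 < dot (col_cross Psi) (col_cross Psi) -> l <> zero -> 0 <= eta ->
  pullback (fcp_map l Psi eta c) = plus (pullback Psi) (scal eta (square l)).
Proof. intros HP Hl He. now apply pullback_increment. Qed.

Lemma norm_le_plus_minus {V : NormedModule R_AbsRing} (x y : V) : norm x <= norm y + norm (minus x y).
Proof.
replace x with (plus y (minus x y)) at 1; [apply norm_triangle|].
unfold minus. by rewrite (plus_comm x) plus_assoc plus_opp_r plus_zero_l.
Qed.

Lemma norm_minus_chain {V : NormedModule R_AbsRing} (x y z : V) :
  norm (minus x z) <= norm (minus x y) + norm (minus y z).
Proof.
generalize (norm_minus_triangle y x z). rewrite -(norm_opp (minus y x)) opp_minus. lra.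
Qed.

Lemma norm_minus_sym {V : NormedModule R_AbsRing} (x y : V) : norm (minus x y) = norm (minus y x).
Proof. by rewrite -norm_opp opp_minus. Qed.

Lemma class_C_pullback D n (Psi : plane -> E3 * E3) : class_C D n Psi ->
  class_C D n (fun p => pullback (Psi p)).
Proof.
intros HP. assert (H1 := class_C_fst_of D n Psi HP). assert (H2 := class_C_snd_of D n Psi HP).
unfold pullback. apply class_C_pair; [apply class_C_pair|]; now apply class_C_dot.
Qed.

Lemma norm_lin_app_le {V : NormedModule R_AbsRing} (L : V * V) (v : plane) :
  norm (lin_app L v) <= norm (L : prod_NormedModule R_AbsRing V V) * norm v.
Proof.
apply Rle_trans with (Rabs (fst v) * norm (fst L) + Rabs (snd v) * norm (snd L)).
- rewrite -!norm_scal_R. exact (norm_triangle (scal (fst v) (fst L)) (scal (snd v) (snd L))).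
- apply pow2_le_inv; [apply Rmult_le_pos; apply norm_nonneg|].
  destruct L as [X Y]. rewrite Rpow_mult_distr norm_pair_sqr norm_plane_sqr. simpl fst. simpl snd.
  rewrite -(pow2_abs (fst v)) -(pow2_abs (snd v)).
  generalize (pow2_ge_0 (Rabs (fst v) * norm Y - Rabs (snd v) * norm X)).
  generalize (Rabs (fst v)) (Rabs (snd v)) (norm X) (norm Y). intros. nra.
Qed.

(** * Limits of differentials *)

(** Extends a function given on a segment to the whole line, so that the one-variable mean value
    theorem applies although the map is known only on the set Q, with one-sided differentials. *)
Definition clamp (s : R) : R := Rmax 0 (Rmin 1 s).

Lemma clamp_range s : 0 <= clamp s <= 1.
Proof.
unfold clamp. split; [apply Rmax_l|]. apply Rmax_lub; [lra|apply Rmin_l].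
Qed.

Lemma clamp_id s : 0 <= s <= 1 -> clamp s = s.
Proof. intros Hs. unfold clamp. rewrite Rmin_right; [|lra]. rewrite Rmax_right; lra. Qed.

Lemma clamp_lipschitz s t : Rabs (clamp s - clamp t) <= Rabs (s - t).
Proof.
unfold clamp, Rmax, Rmin.
destruct (Rle_dec 1 s), (Rle_dec 1 t); repeat destruct (Rle_dec _ _); unfold Rabs;
  repeat destruct (Rcase_abs _); lra.
Qed.

Lemma mean_value_scalar (Q : plane -> Prop) (h : plane -> R) (dh : plane -> R * R) p v t :
  (forall s, 0 <= s <= 1 -> Q (ray p v s)) ->
  (forall q, Q q -> has_differential Q h q (dh q)) ->
  (forall q, Q q -> Rabs (lin_app (V := R_NormedModule) (dh q) v) <= t) ->
  Rabs (h (ray p v 1) - h p) <= t.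
Proof.
intros HQ Hd Ht.
set (psi := fun s => h (ray p v (clamp s))).
assert (Hm : forall s s', minus (ray p v s') (ray p v s) = scal (s' - s) v).
{ intros s s'. destruct p, v. unfold ray. e3_ext. }
assert (Hpath : forall s (P : plane -> Prop), 0 <= s <= 1 -> within Q (locally (ray p v s)) P ->
  exists d : posreal, forall s', Rabs (s' - s) < d -> P (ray p v (clamp s'))).
{ intros s P Hs [d HP]. set (M := 1 + Rabs (fst v) + Rabs (snd v)).
  assert (V1 := Rabs_pos (fst v)). assert (V2 := Rabs_pos (snd v)).
  assert (HM : 0 < M) by (unfold M; lra).
  assert (Hdm : 0 < d / M) by (apply Rdiv_lt_0_compat; [apply cond_pos|easy]).
  exists (mkposreal _ Hdm). intros s' Hs'. simpl in Hs'. apply HP; [|apply HQ, clamp_range].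
  assert (Hc := clamp_lipschitz s' s). rewrite (clamp_id s Hs) in Hc.
  assert (Hcm : Rabs (clamp s' - s) * M < d).
  { apply Rlt_div_r; [easy|]. lra. }
  assert (C0 := Rabs_pos (clamp s' - s)). unfold M in Hcm.
  split.
  - change (Rabs (fst p + clamp s' * fst v - (fst p + s * fst v)) < d).
    replace (fst p + clamp s' * fst v - (fst p + s * fst v)) with ((clamp s' - s) * fst v) by ring.
    rewrite Rabs_mult. nra.
  - change (Rabs (snd p + clamp s' * snd v - (snd p + s * snd v)) < d).
    replace (snd p + clamp s' * snd v - (snd p + s * snd v)) with ((clamp s' - s) * snd v) by ring.
    rewrite Rabs_mult. nra. }
destruct (MVT_gen psi 0 1 (fun s => lin_app (V := R_NormedModule) (dh (ray p v s)) v)) as (c & Hc & E).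
- rewrite Rmin_left; [|lra]. rewrite Rmax_right; [|lra]. intros s Hs.
  apply is_derive_Reals. intros e He.
  assert (HQs : Q (ray p v s)) by (apply HQ; lra).
  assert (Hn : 0 < e / (norm v + 1)).
  { apply Rdiv_lt_0_compat; [easy|]. generalize (norm_nonneg v). lra. }
  assert (Hde := proj1 (has_differential_iff Q h _ _ HQs) (Hd _ HQs) (mkposreal _ Hn)).
  destruct (Hpath s _ ltac:(lra) Hde) as [d Hdd].
  assert (Hd' : 0 < Rmin d (Rmin s (1 - s))) by (repeat apply Rmin_case; [apply cond_pos|lra|lra]).
  exists (mkposreal _ Hd'). intros k Hk Hkd. simpl in Hkd.
  assert (K1 := Rlt_le_trans _ _ _ Hkd (Rmin_l _ _)).
  assert (K2 := Rlt_le_trans _ _ _ Hkd (Rmin_r _ _)).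
  assert (K3 := Rlt_le_trans _ _ _ K2 (Rmin_l _ _)).
  assert (K4 := Rlt_le_trans _ _ _ K2 (Rmin_r _ _)).
  assert (Hsk : 0 <= s + k <= 1) by (apply Rabs_lt_between in K3, K4; lra).
  assert (B := Hdd (s + k) ltac:(now replace (s + k - s) with k by ring)).
  unfold psi. rewrite (clamp_id s); [|lra]. rewrite (clamp_id (s + k)) // in B *.
  rewrite Hm in B. rewrite (linear_scal _ (lin_app_linear (V := R_NormedModule) (dh (ray p v s)))) in B.
  set (y := lin_app (V := R_NormedModule) (dh (ray p v s)) v) in *.
  assert (Env : norm (scal (s + k - s) v) = Rabs k * norm v).
  { replace (s + k - s) with k by ring.
    exact (norm_scal_R (V := R2mod) k v). }
  rewrite Env in B.
  change (Rabs (h (ray p v (s + k)) - h (ray p v s) - (s + k - s) * y) <= e / (norm v + 1) * (Rabs k * norm v)) in B.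
  replace (s + k - s) with k in B by ring.
  replace ((h (ray p v (s + k)) - h (ray p v s)) / k - y) with
    ((h (ray p v (s + k)) - h (ray p v s) - k * y) / k) by (field; exact Hk).
  unfold Rdiv at 1. rewrite Rabs_mult Rabs_inv. assert (Hk0 := Rabs_pos_lt k Hk).
  apply Rlt_div_l; [exact Hk0|]. apply (Rle_lt_trans _ _ _ B).
  assert (Hv := norm_nonneg v).
  replace (e / (norm v + 1) * (Rabs k * norm v)) with (e * Rabs k * (norm v / (norm v + 1))) by (field; lra).
  rewrite -{2}(Rmult_1_r (e * Rabs k)). apply Rmult_lt_compat_l; [now apply Rmult_lt_0_compat|].
  apply Rlt_div_l; lra.
- rewrite Rmin_left; [|lra]. rewrite Rmax_right; [|lra]. intros s Hs.
  assert (HQs : Q (ray p v s)) by (apply HQ; lra).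
  intros e He.
  assert (Hl := has_differential_continuous _ _ _ (Hd _ HQs) _ (locally_ball (h (ray p v s)) (mkposreal e He))).
  destruct (Hpath s _ Hs Hl) as [d Hdd]. exists d. split; [apply cond_pos|].
  intros s' [_ Hs']. unfold psi. rewrite (clamp_id s Hs). exact (Hdd s' Hs').
- rewrite Rmin_left in Hc; [|lra]. rewrite Rmax_right in Hc; [|lra].
  unfold psi in E. rewrite (clamp_id 1) in E; [|lra]. rewrite (clamp_id 0) in E; [|lra].
  rewrite Rminus_0_r Rmult_1_r in E.
  replace (ray p v 0) with p in E.
  2:{ destruct p. unfold ray; simpl. apply (f_equal2 pair); ring. }
  rewrite E. now apply Ht, HQ.
Qed.

(** The scalar mean value theorem is applied to each of the three coordinates, whence the factor
    3. *)
Lemma mean_value_E3 (Q : plane -> Prop) (h : plane -> E3) (dh : plane -> E3 * E3) p q t :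
  (forall s, 0 <= s <= 1 -> Q (ray p (minus q p) s)) ->
  (forall x, Q x -> has_differential Q h x (dh x)) ->
  (forall x, Q x -> norm (dh x) <= t) ->
  norm (minus (h q) (h p)) <= 3 * t * norm (minus q p).
Proof.
intros HQ Hd Ht. set (v := minus q p) in *.
assert (Eq : ray p v 1 = q).
{ destruct p as [p1 p2], q as [q1 q2]. unfold v, ray, minus, plus, opp; simpl. unfold plus, opp; simpl.
  apply (f_equal2 pair); ring. }
assert (HT : forall T : E3 -> R, is_linear (V := R_NormedModule) T -> (forall y, Rabs (T y) <= norm y) ->
  Rabs (T (h q) - T (h p)) <= t * norm v).
{ intros T HT HTn. rewrite -{1}Eq.
  apply (mean_value_scalar Q (fun x => T (h x)) (fun x => (T (fst (dh x)), T (snd (dh x)))) p v); [easy| |].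
  - intros x Qx. exact (has_differential_linear Q T h x (dh x) HT (Hd x Qx)).
  - intros x Qx.
    replace (lin_app (V := R_NormedModule) (T (fst (dh x)), T (snd (dh x))) v) with (T (lin_app (dh x) v)).
    + apply (Rle_trans _ _ _ (HTn _)), (Rle_trans _ _ _ (norm_lin_app_le (V := E3mod) (dh x) v)).
      apply Rmult_le_compat_r; [apply norm_nonneg|now apply Ht].
    + unfold lin_app. simpl. by rewrite (linear_plus _ HT) !(linear_scal _ HT). }
set (pr2 := R2mod).
assert (L1 : is_linear (U := E3mod) (V := pr2) (fun y : E3 => fst y)) by apply is_linear_fst.
assert (N1 : forall y : E3, norm (fst y : pr2) <= norm y) by (intros y; exact (norm_fst_le (U := pr2) (V := R_NormedModule) y)).
assert (A1 := HT (fun y => fst (fst y))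
  (is_linear_comp _ _ L1 (is_linear_fst (U := R_NormedModule) (V := R_NormedModule)))
  (fun y => Rle_trans _ _ _ (norm_fst_le (U := R_NormedModule) (V := R_NormedModule) (fst y)) (N1 y))).
assert (A2 := HT (fun y => snd (fst y))
  (is_linear_comp _ _ L1 (is_linear_snd (U := R_NormedModule) (V := R_NormedModule)))
  (fun y => Rle_trans _ _ _ (norm_snd_le (U := R_NormedModule) (V := R_NormedModule) (fst y)) (N1 y))).
assert (A3 := HT (fun y => snd y)
  (is_linear_snd (U := pr2) (V := R_NormedModule))
  (fun y => norm_snd_le (U := pr2) (V := R_NormedModule) y)).
generalize (norm_pair_le (U := pr2) (V := R_NormedModule) (minus (fst (h q)) (fst (h p))) (minus (snd (h q)) (snd (h p)))).
generalize (norm_pair_le (U := R_NormedModule) (V := R_NormedModule)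
  (minus (fst (fst (h q))) (fst (fst (h p)))) (minus (snd (fst (h q))) (snd (fst (h p))))).
intros B1 B2.
change (norm (minus (h q) (h p)) <= norm (minus (fst (h q)) (fst (h p))) + Rabs (snd (h q) - snd (h p))) in B2.
change (norm (minus (fst (h q)) (fst (h p))) <=
  Rabs (fst (fst (h q)) - fst (fst (h p))) + Rabs (snd (fst (h q)) - snd (fst (h p)))) in B1.
refine (Rle_trans _ _ _ (Rle_trans _ _ _ B2 (Rplus_le_compat _ _ _ _
  (Rle_trans _ _ _ B1 (Rplus_le_compat _ _ _ _ A1 A2)) A3)) _).
set (nv := norm v). change (t * nv + t * nv + t * nv <= 3 * t * nv). right; ring.
Qed.

(** * Convergent sequences, completeness and summable increments *)

Definition converges {V : NormedModule R_AbsRing} (X : nat -> V) (x : V) : Prop :=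
  forall e, 0 < e -> exists n0, forall n, (n0 <= n)%nat -> norm (minus (X n) x) <= e.

Definition cauchy_seq {V : NormedModule R_AbsRing} (X : nat -> V) : Prop :=
  forall e, 0 < e -> exists n0, forall n m, (n0 <= n)%nat -> (n0 <= m)%nat -> norm (minus (X n) (X m)) <= e.

Definition seq_complete (V : NormedModule R_AbsRing) : Prop :=
  forall X : nat -> V, cauchy_seq X -> exists x, converges X x.

Lemma seq_complete_R : seq_complete R_NormedModule.
Proof.
intros X HX. destruct (proj2 (ex_lim_seq_cauchy_corr X)) as [l Hl].
- intros e. destruct (HX (e / 2)) as [n0 H]; [generalize (cond_pos e); lra|]. exists n0.
  intros n m Hn Hm. apply Rle_lt_trans with (e / 2); [exact (H n m Hn Hm)|generalize (cond_pos e); lra].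
- exists l. intros e He. destruct (proj2 (is_lim_seq_spec X l) Hl (mkposreal e He)) as [n0 H].
  exists n0. intros n Hn. apply Rlt_le. exact (H n Hn).
Qed.

Lemma seq_complete_prod U V : seq_complete U -> seq_complete V ->
  seq_complete (prod_NormedModule R_AbsRing U V).
Proof.
intros HU HV X HX.
destruct (HU (fun n => fst (X n))) as [x Hx].
{ intros e He. destruct (HX e He) as [n0 H]. exists n0. intros n m Hn Hm.
  exact (Rle_trans _ _ _ (norm_fst_le (minus (X n) (X m))) (H n m Hn Hm)). }
destruct (HV (fun n => snd (X n))) as [y Hy].
{ intros e He. destruct (HX e He) as [n0 H]. exists n0. intros n m Hn Hm.
  exact (Rle_trans _ _ _ (norm_snd_le (minus (X n) (X m))) (H n m Hn Hm)). }
exists (x, y). intros e He. destruct (Hx (e / 2)) as [n1 H1]; [lra|]. destruct (Hy (e / 2)) as [n2 H2]; [lra|].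
exists (n1 + n2)%nat. intros n Hn.
apply (Rle_trans _ _ _ (norm_pair_le (minus (fst (X n)) x) (minus (snd (X n)) y))).
generalize (H1 n ltac:(lia)) (H2 n ltac:(lia)). lra.
Qed.

Lemma seq_complete_E3 : seq_complete E3mod.
Proof. apply seq_complete_prod; [apply seq_complete_prod|]; apply seq_complete_R. Qed.

Lemma seq_complete_L23 : seq_complete L23mod.
Proof. apply seq_complete_prod; apply seq_complete_E3. Qed.

Lemma converges_filterlim {V : NormedModule R_AbsRing} (X : nat -> V) x :
  converges X x -> filterlim X Hierarchy.eventually (locally x).
Proof.
intros HX. apply filterlim_locally. intros e. destruct (HX (e / 2)) as [n0 H]; [generalize (cond_pos e); lra|].
exists n0. intros n Hn. apply norm_compat1. apply Rle_lt_trans with (e / 2); [now apply H|].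
generalize (cond_pos e); lra.
Qed.

(** Sum of the first n terms, one fewer than [sum_n u n]: exactly the increments between X_0 and
    X_n. *)
Fixpoint psum (u : nat -> R) (n : nat) : R :=
  match n with O => 0 | S m => psum u m + u m end.

Lemma psum_dominated {V : NormedModule R_AbsRing} (X : nat -> V) (u : nat -> R) :
  (forall n, norm (minus (X (S n)) (X n)) <= u n) ->
  forall k m, (k <= m)%nat -> norm (minus (X m) (X k)) <= psum u m - psum u k.
Proof.
intros H k m Hkm. induction Hkm as [|m Hkm IH].
- rewrite minus_eq_zero norm_zero. lra.
- simpl. generalize (norm_minus_chain (X (S m)) (X m) (X k)) (H m). lra.
Qed.

Lemma psum_summable (u : nat -> R) : (forall n, 0 <= u n) -> ex_series u ->
  exists l, (forall n, psum u n <= l) /\ forall e, 0 < e -> exists k, l - psum u k <= e.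
Proof.
intros Hu [l Hl]. exists l.
assert (E : forall n, sum_n u n = psum u (S n)).
{ induction n as [|n IH]; [rewrite sum_O; simpl; ring|]. rewrite sum_Sn IH. reflexivity. }
assert (Hlim : is_lim_seq (sum_n u) l) by exact Hl.
assert (Hmono : forall n m, (n <= m)%nat -> psum u n <= psum u m).
{ intros n m Hnm. induction Hnm as [|m Hnm IH]; [lra|]. simpl. generalize (Hu m). lra. }
split.
- intros n. apply Rle_trans with (sum_n u n).
  + rewrite E. simpl. generalize (Hu n). lra.
  + apply (is_lim_seq_incr_compare (sum_n u) l Hlim). intros k. rewrite !E. apply Hmono. lia.
- intros e He. destruct (proj2 (is_lim_seq_spec _ _) Hlim (mkposreal e He)) as [n0 H].
  exists (S n0). rewrite -E. generalize (H n0 (le_n _)). simpl. intros B.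
  apply Rabs_lt_between in B. lra.
Qed.

Lemma converges_bound {V : NormedModule R_AbsRing} (X : nat -> V) x y c :
  converges X x -> (exists n0, forall n, (n0 <= n)%nat -> norm (minus (X n) y) <= c) -> norm (minus x y) <= c.
Proof.
intros HX [n0 H]. apply le_epsilon. intros e He. destruct (HX e He) as [n1 H1].
generalize (norm_minus_triangle (X (n0 + n1)%nat) x y) (H (n0 + n1)%nat ltac:(lia)) (H1 (n0 + n1)%nat ltac:(lia)). lra.
Qed.

Lemma has_differential_subset {V : NormedModule R_AbsRing} (D E : plane -> Prop) (f : plane -> V) p L :
  (forall q, E q -> D q) -> E p -> has_differential D f p L -> has_differential E f p L.
Proof.
intros HED Ep HL. apply has_differential_iff; [exact Ep|]. intros eps.
generalize (proj1 (has_differential_iff D f p L (HED p Ep)) HL eps). unfold within.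
apply filter_imp. auto.
Qed.

Lemma converges_minus {V : NormedModule R_AbsRing} (X Y : nat -> V) x y :
  converges X x -> converges Y y -> converges (fun n => minus (X n) (Y n)) (minus x y).
Proof.
intros HX HY e He. destruct (HX (e / 2)) as [n1 H1]; [lra|]. destruct (HY (e / 2)) as [n2 H2]; [lra|].
exists (n1 + n2)%nat. intros n Hn.
replace (minus (minus (X n) (Y n)) (minus x y)) with (minus (minus (X n) x) (minus (Y n) y)).
- unfold minus at 1. eapply Rle_trans; [apply norm_triangle|]. rewrite norm_opp.
  generalize (H1 n ltac:(lia)) (H2 n ltac:(lia)). lra.
- unfold minus. rewrite !opp_plus !opp_opp. apply plus_interchange.
Qed.

Lemma converges_const {V : NormedModule R_AbsRing} (x : V) : converges (fun _ => x) x.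
Proof. intros e He. exists O. intros n _. rewrite minus_eq_zero norm_zero. lra. Qed.

Lemma mean_value_difference (D Q : plane -> Prop) (h1 h2 : plane -> E3) (d1 d2 : plane -> E3 * E3) p q t :
  (forall x, Q x -> D x) ->
  (forall s, 0 <= s <= 1 -> Q (ray p (minus q p) s)) ->
  (forall x, D x -> has_differential D h1 x (d1 x)) ->
  (forall x, D x -> has_differential D h2 x (d2 x)) ->
  (forall x, Q x -> norm (minus (d1 x) (d2 x)) <= t) ->
  norm (minus (minus (h1 q) (h2 q)) (minus (h1 p) (h2 p))) <= 3 * t * norm (minus q p).
Proof.
intros HQD Hs H1 H2 Ht.
refine (mean_value_E3 Q (fun x => minus (h1 x) (h2 x)) (fun x => minus (d1 x) (d2 x)) p q t Hs _ Ht).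
intros x Qx. apply (has_differential_subset D Q); [exact HQD|exact Qx|].
exact (has_differential_plus D h1 (fun x => opp (h2 x)) x _ _ (H1 x (HQD x Qx))
  (has_differential_linear D opp h2 x _ is_linear_opp (H2 x (HQD x Qx)))).
Qed.

Lemma converges_norm_le {V : NormedModule R_AbsRing} (X : nat -> V) x c :
  converges X x -> (exists n0, forall n, (n0 <= n)%nat -> norm (X n) <= c) -> norm x <= c.
Proof.
intros HX [n0 H]. apply le_epsilon. intros e He. destruct (HX e He) as [n1 H1].
generalize (norm_le_plus_minus x (X (n0 + n1)%nat)) (H (n0 + n1)%nat ltac:(lia)) (H1 (n0 + n1)%nat ltac:(lia)).
rewrite (norm_minus_sym x). lra.
Qed.

Lemma norm_remainder_split (a b c d : E3) (M L : E3 * E3) (v : plane) :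
  norm (minus (minus a b) (lin_app L v)) <=
  norm (minus (minus a c) (minus b d)) + norm (minus (minus c d) (lin_app M v))
  + norm (lin_app (minus M L) v).
Proof.
assert (E : minus (minus a b) (lin_app L v) =
  plus (plus (minus (minus a c) (minus b d)) (minus (minus c d) (lin_app M v))) (lin_app (minus M L) v)).
{ destruct M as [x1 x2], L as [y1 y2], v. e3_ext. }
rewrite E. apply (Rle_trans _ _ _ (norm_triangle (V := E3mod) _ _)), Rplus_le_compat_r.
exact (norm_triangle (V := E3mod) _ _).
Qed.

Section UniformLimits.

Variables (D E Q : plane -> Prop) (p : plane) (T : nat -> R).
Hypotheses (HQE : forall q, Q q -> E q) (HED : forall q, E q -> D q) (Ep : E p) (Qp : Q p)
  (HQ : within E (locally p) Q) (HT0 : forall k, 0 <= T k)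
  (HT : forall e, 0 < e -> exists k, T k <= e).

(** The approximations live on [D], the limit is studied relative to [E], and [Q] is a neighbourhood
    of [p] in [E] on which the tail bound [T] is uniform. *)
Lemma uniform_limit_continuous {V : NormedModule R_AbsRing} (X : nat -> plane -> V) (x : plane -> V) :
  (forall n, continuous_on D (X n)) ->
  (forall n q, Q q -> norm (minus (x q) (X n q)) <= T n) ->
  filterlim x (within E (locally p)) (locally (x p)).
Proof.
intros HX Hx. assert (FE : Filter (within E (locally p))) by apply within_filter, locally_filter.
apply filterlim_locally_ball_norm. intros e. assert (He : 0 < e / 4) by (generalize (cond_pos e); lra).
destruct (HT _ He) as [k Hk].
assert (FF : Filter (within D (locally p))) by apply within_filter, locally_filter.
assert (H := proj1 (filterlim_locally_ball_norm (X k) (X k p)) (HX k p (HED p Ep)) (pos_div_2 e)).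
unfold within in *. generalize (filter_and _ _ HQ H). apply filter_imp. intros q [H1 H2] Eq.
specialize (H1 Eq). specialize (H2 (HED q Eq)). unfold ball_norm in *. simpl in H2.
assert (A1 := Hx k q H1). assert (A2 := Hx k p Qp).
apply (Rle_lt_trans _ _ _ (norm_minus_chain (x q) (X k q) (x p))).
assert (A3 := norm_minus_chain (X k q) (X k p) (x p)).
rewrite (norm_minus_sym (X k p)) in A3. lra.
Qed.

(** On the convex set [Q] the increments of F_m - F_k are at most 3 T_k |q - p|, a bound that
    survives m -> infinity. Adding the remainder of F_k and T_k for the change of differential gives
    (4 T_k + eps / 2) |q - p|, hence the requirement T_k <= eps / 8. *)
Lemma limit_differential (F : nat -> plane -> E3) (dF : nat -> plane -> E3 * E3)
    (f : plane -> E3) (L : plane -> E3 * E3) :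
  (forall a b s, Q a -> Q b -> 0 <= s <= 1 -> Q (ray a (minus b a) s)) ->
  (forall n q, D q -> has_differential D (F n) q (dF n q)) ->
  (forall n m q, (n <= m)%nat -> Q q -> norm (minus (dF m q) (dF n q)) <= T n) ->
  (forall n q, Q q -> norm (minus (L q) (dF n q)) <= T n) ->
  (forall q, Q q -> converges (fun n => F n q) (f q)) ->
  has_differential E f p (L p).
Proof.
intros Hconv HF Hcau HL Hf. apply has_differential_iff; [exact Ep|]. intros eps.
assert (He := cond_pos eps).
assert (He8 : 0 < eps / 8) by lra. destruct (HT _ He8) as [k Hk].
assert (He2 : 0 < eps / 2) by lra.
assert (H := proj1 (has_differential_iff D (F k) p (dF k p) (HED p Ep)) (HF k p (HED p Ep)) (mkposreal _ He2)).
unfold within in *. generalize (filter_and _ _ HQ H). apply filter_imp. intros q [H1 H2] Eq.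
specialize (H1 Eq). specialize (H2 (HED q Eq)). simpl in H2.
set (v := minus q p) in *.
assert (A1 : norm (minus (minus (f q) (F k q)) (minus (f p) (F k p))) <= 3 * T k * norm v).
{ refine (converges_norm_le (V := E3mod) _ _ _
    (converges_minus (V := E3mod) (fun m => minus (F m q) (F k q)) (fun m => minus (F m p) (F k p)) _ _
      (converges_minus (V := E3mod) (fun m => F m q) (fun _ => F k q) _ _ (Hf q H1) (converges_const (V := E3mod) _))
      (converges_minus (V := E3mod) (fun m => F m p) (fun _ => F k p) _ _ (Hf p Qp) (converges_const (V := E3mod) _))) _).
  exists k. intros m Hm.
  exact (mean_value_difference D Q (F m) (F k) (dF m) (dF k) p q (T k) (fun x Qx => HED x (HQE x Qx))
    (fun s => Hconv p q s Qp H1) (HF m) (HF k) (fun x => Hcau k m x Hm)). }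
assert (A2 : norm (lin_app (minus (dF k p) (L p)) v) <= T k * norm v).
{ apply (Rle_trans _ _ _ (norm_lin_app_le (V := E3mod) _ v)), Rmult_le_compat_r; [apply norm_nonneg|].
  rewrite (norm_minus_sym (V := L23mod)). now apply HL. }
set (nv := norm v) in *.
assert (Hnv : 0 <= nv) by apply norm_nonneg.
refine (Rle_trans _ _ _ (norm_remainder_split (f q) (f p) (F k q) (F k p) (dF k p) (L p) v)
  (Rle_trans _ _ _ (Rplus_le_compat _ _ _ _ (Rplus_le_compat _ _ _ _ A1 H2) A2) _)).
apply Rle_trans with ((4 * T k + eps / 2) * nv); [right; ring|]. apply Rmult_le_compat_r; [exact Hnv|].
clear -Hk He. lra.
Qed.

End UniformLimits.

(** * Compact boxes in the annulus and norms as suprema *)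

(** A convex compact neighbourhood of [p] in the half-open strip: the outer radius stops midway
    between that of [p] and 1. *)
Definition cstar_box (rho0 : R) (p q : plane) : Prop :=
  (rho0 <= fst q <= (1 + fst p) / 2) /\ (snd p - 1 <= snd q <= snd p + 1).

Lemma cstar_box_compact rho0 p : strip_star rho0 p -> compact_in_Cstar rho0 (cstar_box rho0 p).
Proof.
intros [H1 H2]. split.
- apply compact_of_gcompact.
  exact (gcompact_prod _ _ (gcompact_interval rho0 ((1 + fst p) / 2)) (gcompact_interval (snd p - 1) (snd p + 1))).
- intros q [[H3 H4] _]. split; lra.
Qed.

Lemma cstar_box_center rho0 p : strip_star rho0 p -> cstar_box rho0 p p.
Proof. intros [H1 H2]. split; lra. Qed.

Lemma cstar_box_locally rho0 p : strip_star rho0 p ->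
  within (strip_star rho0) (locally p) (cstar_box rho0 p).
Proof.
intros [H1 H2]. assert (Hd : 0 < Rmin 1 ((1 - fst p) / 2)) by (apply Rmin_case; lra).
assert (G : forall q : plane, Rabs (fst q - fst p) < Rmin 1 ((1 - fst p) / 2) ->
  Rabs (snd q - snd p) < Rmin 1 ((1 - fst p) / 2) -> rho0 <= fst q -> cstar_box rho0 p q).
{ intros q B1 B2 Q1.
  apply Rlt_le_trans with (2 := Rmin_r _ _) in B1. apply Rlt_le_trans with (2 := Rmin_l _ _) in B2.
  apply Rabs_lt_between in B1, B2. split; lra. }
exists (mkposreal _ Hd). intros q [B1 B2] [Q1 _]. exact (G q B1 B2 Q1).
Qed.

Lemma cstar_box_convex rho0 p a b s : cstar_box rho0 p a -> cstar_box rho0 p b -> 0 <= s <= 1 ->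
  cstar_box rho0 p (ray a (minus b a) s).
Proof.
intros [A1 A2] [B1 B2] Hs. unfold cstar_box, ray.
change (fst (minus b a)) with (fst b - fst a). change (snd (minus b a)) with (snd b - snd a). simpl.
split; split; nra.
Qed.

Lemma op_norm_le (Psi : E3 * E3) : Rbar_le (op_norm Psi) (norm (Psi : L23mod)).
Proof.
apply (proj2 (Lub_Rbar_correct _)). intros x (v & Hv & ->). simpl.
assert (Hn := form_norm_pos v Hv). apply Rle_div_l; [exact Hn|].
exact (norm_lin_app_le (V := E3mod) Psi v).
Qed.

Lemma sup_on_le (K : plane -> Prop) (F : plane -> Rbar) (c : Rbar) :
  (forall p, K p -> Rbar_le (F p) c) -> Rbar_le (sup_on K F) c.
Proof.
intros H. apply (proj2 (Lub_Rbar_correct _)). intros x (p & Kp & Hx).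
apply Rbar_le_trans with (F p); auto.
Qed.

Lemma le_sup_on (K : plane -> Prop) (F : plane -> Rbar) (p : plane) x :
  K p -> Rbar_le (Finite x) (F p) -> Rbar_le x (sup_on K F).
Proof. intros Kp Hx. apply (proj1 (Lub_Rbar_correct _)). now exists p. Qed.

Lemma bil_le_coefficients (b : sym2) (v : plane) (r : R) :
  Rabs (fst (fst b)) <= r -> Rabs (snd (fst b)) <= r -> Rabs (snd b) <= r ->
  Rabs (bil b v v) <= 2 * r * (fst v ^ 2 + snd v ^ 2).
Proof.
destruct b as [[x y] z], v as [s t]. unfold bil. simpl. intros M1 M2 M3.
apply Rabs_le_between in M1, M2, M3. apply Rabs_le.
generalize (pow2_ge_0 s) (pow2_ge_0 t) (pow2_ge_0 (s - t)) (pow2_ge_0 (s + t)). intros.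
split; nra.
Qed.

Lemma bil_le (b : sym2) v : Rabs (bil b v v) <= 2 * norm b * norm v ^ 2.
Proof.
rewrite norm_plane_sqr.
set (pr2 := R2mod).
assert (N1 := norm_fst_le (U := pr2) (V := R_NormedModule) b).
assert (N2 := norm_fst_le (U := R_NormedModule) (V := R_NormedModule) (fst b)).
assert (N3 := norm_snd_le (U := R_NormedModule) (V := R_NormedModule) (fst b)).
assert (N4 := norm_snd_le (U := pr2) (V := R_NormedModule) b).
assert (M1 := Rle_trans _ _ _ N2 N1). assert (M2 := Rle_trans _ _ _ N3 N1).
change (Rabs (fst (fst b)) <= norm b) in M1. change (Rabs (snd (fst b)) <= norm b) in M2.
change (Rabs (snd b) <= norm b) in N4.
exact (bil_le_coefficients b v _ M1 M2 N4).
Qed.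

(** The vectors (1,0), (0,1), (1,1) bound the coefficients by c, c and, by polarisation, 2 c for the
    mixed one. *)
Lemma norm_le_of_bil (b : sym2) c : (forall v : plane, Rabs (bil b v v) <= c * norm v ^ 2) ->
  norm b <= 4 * c.
Proof.
intros Hb. assert (H1 := Hb (1, 0)). assert (H2 := Hb (0, 1)). assert (H3 := Hb (1, 1)).
rewrite !norm_plane_sqr in H1, H2, H3.
destruct b as [[x y] z]. unfold bil in *. simpl in *.
apply Rabs_le_between in H1, H2, H3.
set (pr2 := R2mod).
apply (Rle_trans _ _ _ (norm_pair_le (U := pr2) (V := R_NormedModule) (x, y) z)).
apply (Rle_trans _ _ _ (Rplus_le_compat_r _ _ _ (norm_pair_le (U := R_NormedModule) (V := R_NormedModule) x y))).
change (Rabs x + Rabs y + Rabs z <= 4 * c).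
unfold Rabs. repeat destruct (Rcase_abs _); lra.
Qed.

(** The bound M makes the supremum finite; [real] would send an infinite one to 0. *)
Lemma sym_norm_sup (K : plane -> Prop) (b : plane -> sym2) M p :
  (forall q, K q -> norm (b q) <= M) -> K p ->
  norm (b p) <= 4 * real (sup_on K (fun q => sym_norm (b q))).
Proof.
intros HM Kp. set (S := sup_on K (fun q => sym_norm (b q))).
assert (Hup : Rbar_le S (2 * M)).
{ apply sup_on_le. intros q Kq. apply (proj2 (Lub_Rbar_correct _)). intros x (v & Hv & ->). simpl.
  assert (Hn := pow_lt _ 2 (form_norm_pos v Hv)). apply Rle_div_l; [exact Hn|].
  apply (Rle_trans _ _ _ (bil_le (b q) v)). apply Rmult_le_compat_r; [lra|].
  apply Rmult_le_compat_l; [lra|now apply HM]. }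
assert (Hlo : forall v : plane, v <> zero -> Rbar_le (Rabs (bil (b p) v v) / norm v ^ 2) S).
{ intros v Hv. apply (le_sup_on K _ p); [exact Kp|]. apply (proj1 (Lub_Rbar_correct _)). now exists v. }
apply norm_le_of_bil. intros v.
destruct (classic (v = zero)) as [->|Hv].
{ rewrite norm_plane_sqr. unfold bil, zero; simpl. unfold zero; simpl.
  match goal with |- Rabs ?x <= ?y => replace x with 0 by ring; replace y with 0 by ring end.
  rewrite Rabs_R0. lra. }
specialize (Hlo v Hv). destruct S as [s| |]; simpl in *; [|easy|easy].
assert (Hn := pow_lt _ 2 (form_norm_pos v Hv)).
apply Rle_div_l in Hlo; [exact Hlo|]. simpl in Hn. exact Hn.
Qed.

(** * The three-step rounds *)

Section Data.

Variables (rho0 : R) (w : nat -> affine_form) (H : nat -> sym2 -> R)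
  (f0 : plane -> E3) (g : nat -> plane -> sym2).
Hypothesis Hdata : corrugation_data rho0 w H f0 g.

Let D := strip rho0.
Let l i := aff_lin (w i).

Lemma H_linear i : (1 <= i <= 3)%nat -> is_linear (H i).
Proof. apply (data_H _ _ _ _ _ Hdata). Qed.

Lemma H_square i j : (1 <= i <= 3)%nat -> (1 <= j <= 3)%nat ->
  H i (square (l j)) = if Nat.eqb i j then 1 else 0.
Proof. apply (data_H _ _ _ _ _ Hdata). Qed.

Lemma H_plus i b c : (1 <= i <= 3)%nat -> H i (plus b c) = H i b + H i c.
Proof. intros Hi. apply (linear_plus _ (H_linear i Hi)). Qed.

Lemma H_scal i a b : (1 <= i <= 3)%nat -> H i (scal a b) = a * H i b.
Proof. intros Hi. apply (linear_scal _ (H_linear i Hi)). Qed.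

Lemma H_minus i b c : (1 <= i <= 3)%nat -> H i (minus b c) = H i b - H i c.
Proof. intros Hi. apply (linear_minus _ _ _ (H_linear i Hi)). Qed.

Lemma H_sum i (c : nat -> R) : (1 <= i <= 3)%nat ->
  H i (sum_n_m (fun j => scal (c j) (square (l j))) 1 3) = c i.
Proof.
intros Hi. rewrite sum_n_m_1_3 !H_plus // !H_scal // !H_square //; try lia.
destruct (index_cases i Hi) as [->|[->| ->]]; simpl; ring.
Qed.

Lemma sym2_decomposition (b : sym2) :
  b = plus (plus (scal (H 1 b) (square (l 1%nat))) (scal (H 2 b) (square (l 2%nat))))
        (scal (H 3 b) (square (l 3%nat))).
Proof.
destruct (proj1 (data_w_basis _ _ _ _ _ Hdata) b) as [c Hc].
assert (E : forall i, (1 <= i <= 3)%nat -> H i b = c i).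
{ intros i Hi. rewrite {1}Hc. now apply H_sum. }
rewrite !E; try lia. rewrite {1}Hc. apply sum_n_m_1_3.
Qed.

Lemma l_neq_0 i : (1 <= i <= 3)%nat -> l i <> zero.
Proof.
intros Hi E. assert (E1 := H_square i i Hi Hi). rewrite E Nat.eqb_refl in E1.
replace (square zero) with (scal 0 (square (l i))) in E1.
- rewrite H_scal in E1; [lra|easy].
- destruct (l i). e3_ext.
Qed.

Lemma H_bounded : exists C, 0 < C /\ forall i b, (1 <= i <= 3)%nat -> Rabs (H i b) <= C * norm b.
Proof.
destruct (linear_norm _ (H_linear 1 ltac:(lia))) as (C1 & P1 & B1).
destruct (linear_norm _ (H_linear 2 ltac:(lia))) as (C2 & P2 & B2).
destruct (linear_norm _ (H_linear 3 ltac:(lia))) as (C3 & P3 & B3).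
exists (C1 + C2 + C3). split; [lra|]. intros i b Hi. assert (Hn := norm_nonneg b).
destruct (index_cases i Hi) as [->|[->| ->]].
- apply (Rle_trans _ _ _ (B1 b)), Rmult_le_compat_r; [exact Hn|lra].
- apply (Rle_trans _ _ _ (B2 b)), Rmult_le_compat_r; [exact Hn|lra].
- apply (Rle_trans _ _ _ (B3 b)), Rmult_le_compat_r; [exact Hn|lra].
Qed.

Definition inc (n : nat) (p : plane) : sym2 := minus (g (S n) p) (g n p).

Lemma H_inc n j p : (1 <= j <= 3)%nat -> H j (g (S n) p) = H j (g n p) + H j (inc n p).
Proof. intros Hj. unfold inc. rewrite H_minus //. ring. Qed.

Lemma H_inc_pos n j p : (1 <= j <= 3)%nat -> D p -> 0 < H j (inc n p).
Proof.
intros Hj Dp. destruct (proj2 (data_g_cone _ _ _ _ _ Hdata n) p Dp) as (c & Hc & E).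
unfold inc. rewrite E H_sum //. now apply Hc.
Qed.

Lemma smooth_linear {V W : NormedModule R_AbsRing} (T : V -> W) (f : plane -> V) :
  is_linear T -> smooth_on_C rho0 f -> smooth_on_C rho0 (fun p => T (f p)).
Proof.
intros HT [Hp Hf]. split.
- intros p Dp. now rewrite (Hp p Dp).
- intros n. now apply class_C_linear.
Qed.

Lemma smooth_g n : smooth_on_C rho0 (g n).
Proof. apply (data_g_metric _ _ _ _ _ Hdata n). Qed.

Lemma smooth_H_inc n j : (1 <= j <= 3)%nat -> smooth_on_C rho0 (fun p => H j (inc n p)).
Proof.
intros Hj. apply smooth_linear; [now apply H_linear|]. apply (data_g_cone _ _ _ _ _ Hdata n).
Qed.

Lemma smooth_lower_bound (h : plane -> R) : smooth_on_C rho0 h ->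
  (forall p, D p -> 0 < h p) -> exists m, 0 < m /\ forall p, D p -> m <= h p.
Proof. intros [Hp Hh] Hpos. now apply strip_lower_bound; [apply (Hh 0%nat)|..]. Qed.

Lemma inc_lower_bound n : exists m, 0 < m /\
  forall j p, (1 <= j <= 3)%nat -> D p -> m <= H j (inc n p).
Proof.
assert (B : forall j, (1 <= j <= 3)%nat -> exists m, 0 < m /\ forall p, D p -> m <= H j (inc n p)).
{ intros j Hj. apply smooth_lower_bound; [now apply smooth_H_inc|]. intros p; now apply H_inc_pos. }
destruct (B 1%nat ltac:(lia)) as (m1 & P1 & B1), (B 2%nat ltac:(lia)) as (m2 & P2 & B2),
  (B 3%nat ltac:(lia)) as (m3 & P3 & B3).
exists (Rmin m1 (Rmin m2 m3)). split; [repeat apply Rmin_case; easy|].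
generalize (Rmin_l m1 (Rmin m2 m3)) (Rmin_r m1 (Rmin m2 m3)) (Rmin_l m2 m3) (Rmin_r m2 m3).
intros L1 L2 L3 L4 j p Hj Dp. destruct (index_cases j Hj) as [->|[->| ->]].
- generalize (B1 p Dp). lra.
- generalize (B2 p Dp). lra.
- generalize (B3 p Dp). lra.
Qed.

Lemma smooth_sym_det (h : plane -> sym2) : smooth_on_C rho0 h -> smooth_on_C rho0 (fun p => sym_det (h p)).
Proof.
intros [Hp Hh]. split; [intros p Dp; now rewrite (Hp p Dp)|]. intros n. now apply (class_C_sym_det D).
Qed.

Lemma g_mono n p v : D p -> bil (g 0 p) v v <= bil (g n p) v v.
Proof.
intros Dp. induction n as [|n IH]; [lra|].
generalize (data_g_incr _ _ _ _ _ Hdata n p v Dp). lra.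
Qed.

(** One constant serves all n because the metrics increase from g_0, for which det / trace bounds
    the form from below by [bil_det_trace]. The trace is at most 2 M. *)
Lemma g_lower_bound : exists m, 0 < m /\
  forall n p v, D p -> m * norm v ^ 2 <= bil (g n p) v v.
Proof.
assert (Hg := smooth_g 0).
assert (Hpd : forall p, D p -> 0 < sym_det (g 0 p) /\ 0 < sym_trace (g 0 p)).
{ intros p Dp. apply pos_def_det. now apply (data_g_metric _ _ _ _ _ Hdata 0%nat). }
destruct (smooth_lower_bound _ (smooth_sym_det _ Hg) (fun p Dp => proj1 (Hpd p Dp))) as (d & d0 & Hd).
destruct (smooth_norm_bounded rho0 _ Hg) as (M & M0 & HM).
exists (d / (2 * M)). split; [apply Rdiv_lt_0_compat; lra|]. intros n p v Dp.
apply Rle_trans with (bil (g 0 p) v v); [|now apply g_mono].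
assert (HT : sym_trace (g 0 p) <= 2 * M).
{ assert (A1 := norm_fst_le (g 0 p)). assert (A2 := norm_snd_le (g 0 p)).
  assert (A3 := norm_fst_le (fst (g 0 p) : R2mod)).
  assert (A4 := HM p Dp).
  assert (A5 : fst (fst (g 0 p)) <= M) by exact (Rle_trans _ _ _ (Rle_abs _) (Rle_trans _ _ _ A3 (Rle_trans _ _ _ A1 A4))).
  assert (A6 : snd (g 0 p) <= M) by exact (Rle_trans _ _ _ (Rle_abs _) (Rle_trans _ _ _ A2 A4)).
  unfold sym_trace. lra. }
assert (B := bil_det_trace (g 0 p) v). destruct (Hpd p Dp) as [P1 P2]. assert (P3 := Hd p Dp).
assert (Hv := pow2_ge_0 (norm v)).
assert (Hb : 0 <= bil (g 0 p) v v).
{ apply (Rmult_le_reg_l (sym_trace (g 0 p))); [easy|]. rewrite Rmult_0_r. nra. }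
apply (Rmult_le_reg_l (2 * M)); [lra|].
replace (2 * M * (d / (2 * M) * norm v ^ 2)) with (d * norm v ^ 2) by (field; lra). nra.
Qed.

(** The form is the sum of the H_j(b) l_j(v)^2, and l_j(v)^2 <= |l_j|^2 |v|^2; it suffices that m' L
    <= m / 2 with L at least the sum of the |l_j|^2. The added 1 makes L positive. *)
Lemma coefficients_small m : 0 < m -> exists m', 0 < m' /\ forall b v,
  (forall j, (1 <= j <= 3)%nat -> - m' <= H j b) -> - (m / 2) * norm v ^ 2 <= bil b v v.
Proof.
intros Hm. set (L := norm (l 1%nat) ^ 2 + norm (l 2%nat) ^ 2 + norm (l 3%nat) ^ 2 + 1).
assert (L1 := pow2_ge_0 (norm (l 1%nat))). assert (L2 := pow2_ge_0 (norm (l 2%nat))).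
assert (L3 := pow2_ge_0 (norm (l 3%nat))). assert (HL : 0 < L) by (unfold L; lra).
exists (m / (2 * L)). assert (Hm' : 0 < m / (2 * L)) by (apply Rdiv_lt_0_compat; lra).
split; [easy|]. intros b v Hb.
rewrite (sym2_decomposition b) !bil_plus !bil_scal !bil_square.
assert (T : forall j, (1 <= j <= 3)%nat ->
  - (m / (2 * L)) * (norm (l j) ^ 2 * norm v ^ 2) <= H j b * (form_app (l j) v * form_app (l j) v)).
{ intros j Hj. generalize (Hb j Hj) (form_app_le (l j) v) (pow2_ge_0 (form_app (l j) v)). intros. nra. }
generalize (T 1%nat ltac:(lia)) (T 2%nat ltac:(lia)) (T 3%nat ltac:(lia)). intros.
assert (E : - (m / 2) * norm v ^ 2 = - (m / (2 * L)) * (L * norm v ^ 2)) by (field; lra).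
rewrite E. unfold L at 2. assert (Hv := pow2_ge_0 (norm v)). nra.
Qed.

Let Hrho : 0 < rho0 < 1.
Proof. apply (data_rho0 _ _ _ _ _ Hdata). Qed.

Variables (cm : nat -> R) (m m' CH : R).
Hypotheses (Hcm0 : forall n, 0 < cm n)
  (Hcm : forall n j p, (1 <= j <= 3)%nat -> D p -> cm n <= H j (inc n p))
  (Hm0 : 0 < m) (Hm : forall n p v, D p -> m * norm v ^ 2 <= bil (g n p) v v)
  (Hm'0 : 0 < m') (Hm' : forall b v,
    (forall j, (1 <= j <= 3)%nat -> - m' <= H j b) -> - (m / 2) * norm v ^ 2 <= bil b v v)
  (HCH0 : 0 < CH) (HCH : forall i b, (1 <= i <= 3)%nat -> Rabs (H i b) <= CH * norm b).

(** An error produced by round n and inherited by round n + 1, hence measured against both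
    [cm (pred n)] and [cm n]. Thanks to the division by 4, inherited and new errors together are at
    most cm n / 2, which keeps eta positive, and at most m' / 2, which keeps the metric definite. *)
Definition sigma (n : nat) : R := Rmin (Rmin (cm (pred n)) (cm n)) m' / 4.

Lemma sigma_spec n : 0 < sigma n /\ sigma n <= cm n / 4 /\ sigma (S n) <= cm n / 4 /\ sigma n <= m' / 4.
Proof.
unfold sigma. simpl pred.
assert (0 < Rmin (Rmin (cm (Nat.pred n)) (cm n)) m') by (repeat apply Rmin_case; auto).
generalize (Rmin_l (Rmin (cm (Nat.pred n)) (cm n)) m') (Rmin_r (Rmin (cm (Nat.pred n)) (cm n)) m')
  (Rmin_r (cm (Nat.pred n)) (cm n)) (Rmin_l (Rmin (cm n) (cm (S n))) m') (Rmin_l (cm n) (cm (S n))).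
intros. lra.
Qed.

(* Metrics are compared through their coefficients H_j.  Up to the error made by the
   corrugation, step i of round n+1 sets coefficient i to that of g_(n+1) and leaves the
   other two unchanged: after three steps the error inherited from round n is gone, and
   only the three new ones, of size sigma (n+1) / 3, remain. *)
Definition target (n i j : nat) (p : plane) : R :=
  H j (g n p) + (if Nat.leb j i then H j (inc n p) else 0).

Definition tolerance (n i j : nat) : R :=
  (if Nat.leb j i then 0 else sigma n) + INR i * (sigma (S n) / 3).

Definition good (n i : nat) (F : plane -> E3) : Prop :=
  smooth_immersion rho0 F /\ forall p j, (1 <= j <= 3)%nat -> D p ->
    Rabs (H j (pullback (differential D F p)) - target n i j p) <= tolerance n i j.

Definition formal_good (n i : nat) (Phi : plane -> E3 * E3) : Prop :=
  forall p j, (1 <= j <= 3)%nat -> D p -> H j (pullback (Phi p)) = target n i j p.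

Lemma tolerance_le n i j : (i <= 3)%nat -> 0 <= tolerance n i j <= sigma n + sigma (S n).
Proof.
intros Hi. unfold tolerance. generalize (sigma_spec n) (sigma_spec (S n)). intros S1 S2.
assert (0 <= INR i <= 3).
{ split; [apply pos_INR|]. apply le_INR in Hi. simpl in Hi. lra. }
destruct (Nat.leb j i); nra.
Qed.

(** The targets add nonnegative amounts to the coefficients of g_n, so those of b - g_n are at least
    - m'; this costs half of the constant m. *)
Lemma target_lower_bound n i p (b : sym2) : D p ->
  (forall j, (1 <= j <= 3)%nat -> target n i j p - m' <= H j b) ->
  forall v, m / 2 * norm v ^ 2 <= bil b v v.
Proof.
intros Dp Hb v. replace b with (plus (g n p) (minus b (g n p))).
2:{ destruct b as [[b1 b2] b3], (g n p) as [[g1 g2] g3]. e3_ext. }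
rewrite bil_plus. generalize (Hm n p v Dp). intros.
assert (HH := Hm' (minus b (g n p)) v).
enough (- (m / 2) * norm v ^ 2 <= bil (minus b (g n p)) v v) by lra. apply HH.
intros j Hj. rewrite H_minus //. specialize (Hb j Hj). unfold target in Hb.
generalize (Hcm n j p Hj Dp) (Hcm0 n). destruct (Nat.leb j i); lra.
Qed.

Lemma formal_good_lower_bound n i Phi p v : formal_good n i Phi -> D p ->
  m / 2 * norm v ^ 2 <= bil (pullback (Phi p)) v v.
Proof.
intros HF Dp. apply (target_lower_bound n i p); [easy|]. intros j Hj.
rewrite (HF p j Hj Dp). lra.
Qed.

Lemma formal_good_nondegenerate n i Phi p : formal_good n i Phi -> D p ->
  (m / 2) ^ 2 <= dot (col_cross (Phi p)) (col_cross (Phi p)).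
Proof.
intros HF Dp. rewrite col_cross_det. apply sym_det_lower_bound; [lra|].
intros v. now apply (formal_good_lower_bound n i).
Qed.

Lemma formal_good_nondegenerate_pos n i Phi p : formal_good n i Phi -> D p ->
  0 < dot (col_cross (Phi p)) (col_cross (Phi p)).
Proof.
intros HF Dp. generalize (formal_good_nondegenerate n i Phi p HF Dp) (pow_lt (m / 2) 2). lra.
Qed.

Definition eta_real (n i : nat) (F : plane -> E3) : plane -> R :=
  eta_of (H i) (g (S n)) (differential D F).

Lemma target_next n i p : target n i (S i) p = H (S i) (g n p).
Proof.
unfold target. replace (Nat.leb (S i) i) with false; [ring|]. symmetry. apply Nat.leb_gt. lia.
Qed.

Lemma eta_real_bounds n i F p : (i < 3)%nat -> good n i F -> D p ->
  Rabs (eta_real n (S i) F p - H (S i) (inc n p)) <= cm n / 2 /\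
  cm n / 2 <= eta_real n (S i) F p <= 2 * H (S i) (inc n p).
Proof.
intros Hi [_ HF] Dp. unfold eta_real, eta_of. rewrite H_minus; [|lia].
rewrite H_inc; [|lia].
assert (B := HF p (S i) ltac:(lia) Dp). rewrite target_next in B.
generalize (tolerance_le n i (S i) ltac:(lia)) (sigma_spec n) (Hcm n (S i) p ltac:(lia) Dp) (Hcm0 n).
intros T S C C0. apply Rabs_le_between in B.
split; [apply Rabs_le|]; lra.
Qed.

Lemma eta_formal n i Phi p : (i < 3)%nat -> formal_good n i Phi -> D p ->
  eta_of (H (S i)) (g (S n)) Phi p = H (S i) (inc n p).
Proof.
intros Hi HF Dp. unfold eta_of. rewrite H_minus; [|lia].
rewrite H_inc; [|lia]. rewrite (HF p (S i) ltac:(lia) Dp) target_next.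
ring.
Qed.

Lemma smooth_eta_real n i F : (1 <= i <= 3)%nat -> smooth_immersion rho0 F ->
  smooth_on_C rho0 (eta_real n i F).
Proof.
intros Hi [HF _]. assert (HdF := smooth_differential rho0 Hrho F HF).
assert (Hg := smooth_g (S n)).
unfold eta_real, eta_of. apply smooth_linear; [now apply H_linear|]. split.
- intros p Dp. rewrite (proj1 Hg p Dp). f_equal. f_equal. exact (proj1 HdF p Dp).
- intros k. apply class_C_minus; [apply Hg|]. apply class_C_pullback, HdF.
Qed.

Lemma target_step n i j p : (1 <= j <= 3)%nat -> target n (S i) j p =
  target n i j p + (if Nat.eqb j (S i) then H j (inc n p) else 0).
Proof.
intros Hj. unfold target.
destruct (Nat.leb_spec j i), (Nat.leb_spec j (S i)), (Nat.eqb_spec j (S i)); try lia; ring.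
Qed.

Lemma tolerance_step n i j : (1 <= j <= 3)%nat ->
  tolerance n (S i) j = (if Nat.eqb j (S i) then INR i * (sigma (S n) / 3) else tolerance n i j) + sigma (S n) / 3.
Proof.
intros Hj. unfold tolerance. rewrite S_INR.
destruct (Nat.leb_spec j i), (Nat.leb_spec j (S i)), (Nat.eqb_spec j (S i)); try lia; ring.
Qed.

(** Duality of H and the l_i: adding eta times the square of l_(i+1) replaces coefficient i + 1 by
    that of g_(n+1), erasing its error, and leaves the others alone. *)
Lemma corrected_coefficient n i j p (b : sym2) : (i < 3)%nat -> (1 <= j <= 3)%nat ->
  H j (plus b (scal (H (S i) (minus (g (S n) p) b)) (square (l (S i))))) - target n (S i) j p =
  if Nat.eqb j (S i) then 0 else H j b - target n i j p.
Proof.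
intros Hi Hj. rewrite target_step // H_plus // H_scal //.
rewrite H_square //; [|lia].
rewrite H_minus; [|lia]. rewrite H_inc; [|lia].
destruct (Nat.eqb_spec j (S i)) as [->|Hn]; [|ring]. rewrite target_next. ring.
Qed.

(** A step moves the differential by sqrt (7 eta) |l_i| and eta <= 2 H_i(inc), whence sqrt 14. The
    sum of the norms makes the constant independent of i. *)
Definition step_const : R := sqrt 14 * (norm (l 1%nat) + norm (l 2%nat) + norm (l 3%nat)).

Lemma step_const_pos : 0 <= step_const.
Proof.
apply Rmult_le_pos; [apply sqrt_pos|].
generalize (norm_nonneg (l 1%nat)) (norm_nonneg (l 2%nat)) (norm_nonneg (l 3%nat)). lra.
Qed.

Lemma step_const_le n i eta p : (1 <= i <= 3)%nat -> D p -> 0 <= eta <= 2 * H i (inc n p) ->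
  sqrt (7 * eta) * norm (l i) <= step_const * sqrt (H i (inc n p)).
Proof.
intros Hi Dp He. assert (H0 := Hcm n i p Hi Dp). assert (C0 := Hcm0 n).
assert (E : sqrt (7 * eta) <= sqrt 14 * sqrt (H i (inc n p))).
{ rewrite -sqrt_mult_alt; [|lra]. apply sqrt_le_1_alt. lra. }
assert (L : norm (l i) <= norm (l 1%nat) + norm (l 2%nat) + norm (l 3%nat)).
{ generalize (norm_nonneg (l 1%nat)) (norm_nonneg (l 2%nat)) (norm_nonneg (l 3%nat)).
  destruct (index_cases i Hi) as [->|[->| ->]]; lra. }
unfold step_const. rewrite Rmult_assoc (Rmult_comm (_ + _ + _)) -Rmult_assoc.
apply Rmult_le_compat; [apply sqrt_pos|apply norm_nonneg|easy|easy].
Qed.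

Lemma formal_step n i Phi N : (i < 3)%nat -> formal_good n i Phi ->
  let Phi' := FCP Phi (eta_of (H (S i)) (g (S n)) Phi) (w (S i)) N in
  formal_good n (S i) Phi' /\ forall p, D p ->
    norm (minus (Phi' p) (Phi p)) <= step_const * sqrt (H (S i) (inc n p)).
Proof.
intros Hi HF Phi'.
assert (Hl : l (S i) <> zero) by (apply l_neq_0; lia).
assert (HE : forall p, D p -> 0 < eta_of (H (S i)) (g (S n)) Phi p).
{ intros p Dp. rewrite (eta_formal n i); auto. generalize (Hcm n (S i) p ltac:(lia) Dp) (Hcm0 n). lra. }
split.
- intros p j Hj Dp. assert (Hnd := formal_good_nondegenerate_pos n i Phi p HF Dp).
  unfold Phi'. rewrite FCP_E // pullback_fcp_map //; [|now apply Rlt_le, HE].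
  apply Rminus_diag_uniq. unfold eta_of. fold (l (S i)).
  rewrite (corrected_coefficient n i) //. rewrite (HF p j Hj Dp). destruct (Nat.eqb j (S i)); ring.
- intros p Dp. assert (Hnd := formal_good_nondegenerate_pos n i Phi p HF Dp).
  unfold Phi'. rewrite FCP_E //.
  eapply Rle_trans; [apply fcp_map_distance; [easy|easy|now apply Rlt_le, HE|apply COS_bound]|].
  apply step_const_le; [lia|easy|]. rewrite (eta_formal n i); auto.
  generalize (Hcm n (S i) p ltac:(lia) Dp) (Hcm0 n). lra.
Qed.

Lemma formal_step_continuous n i Phi N : (i < 3)%nat -> formal_good n i Phi ->
  continuous_on D Phi ->
  continuous_on D (FCP Phi (eta_of (H (S i)) (g (S n)) Phi) (w (S i)) N).
Proof.
intros Hi HF Hc.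
assert (Hl : l (S i) <> zero) by (apply l_neq_0; lia).
apply (continuous_on_ext_on D (fun p => fcp_map (l (S i)) (Phi p) (H (S i) (inc n p))
  (cos (2 * PI * INR N * aff_app (w (S i)) p)))).
- intros p Dp. rewrite FCP_E //; [now rewrite (eta_formal n i)|].
  now apply (formal_good_nondegenerate_pos n i).
- intros p Dp.
  refine (filterlim_comp _ _ _ (fun q => (Phi q, (H (S i) (inc n q), cos (2 * PI * INR N * aff_app (w (S i)) q))))
    (fcp_map_uncurried (l (S i))) _
    (locally (Phi p, (H (S i) (inc n p), cos (2 * PI * INR N * aff_app (w (S i)) p)))) _ _
    (continuous_fcp_map_uncurried (l (S i))
      (Phi p, (H (S i) (inc n p), cos (2 * PI * INR N * aff_app (w (S i)) p))) Hl _ _)).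
  + assert (FF : Filter (within D (locally p))) by apply within_filter, locally_filter.
    apply filterlim_pair_locally; [exact FF|now apply Hc|].
    apply filterlim_pair_locally; [exact FF|..].
    * apply (class_C_continuous (V := R_NormedModule) D 0 (fun q => H (S i) (inc n q))); [|exact Dp].
      apply smooth_H_inc; lia.
    * apply (class_C_continuous (V := R_NormedModule) D 0 (fun q => cos (2 * PI * INR N * aff_app (w (S i)) q))); [|exact Dp].
      apply (class_C_comp_ind D (fun _ => True) cos (fun x => - sin x)).
      -- intros x _. auto_derive; [easy|ring].
      -- intros k Hk. lia.
      -- unfold aff_app, form_app.
         apply class_C_mult; [apply class_C_const|].
         apply class_C_Rplus; [|apply class_C_const].
         apply class_C_Rplus; (apply class_C_mult; [apply class_C_const|]); [apply class_C_fst|apply class_C_snd].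
      -- easy.
  + now apply (formal_good_nondegenerate_pos n i).
  + generalize (Hcm n (S i) p ltac:(lia) Dp) (Hcm0 n). simpl. lra.
Qed.

(** [Q N] is the formal step applied to the true differential: it corrects coefficient i + 1
    exactly. The new differential is within tau' of [Q N], which costs sigma (n+1) / 3 on each
    coefficient. The coefficients then bound the new metric from below, which gives an immersion
    again. *)
Lemma good_step n i F tau : (i < 3)%nat -> good n i F -> 0 < tau ->
  exists N, (1 <= N)%nat /\
  let F' := CP rho0 F (eta_real n (S i) F) (w (S i)) N in
  good n (S i) F' /\ forall p, D p ->
    norm (minus (F' p) (F p)) <= tau /\
    norm (minus (differential D F' p)
      (FCP (differential D F) (eta_real n (S i) F) (w (S i)) N p)) <= tau /\
    norm (minus (differential D F' p) (differential D F p)) <=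
      step_const * sqrt (H (S i) (inc n p)) + tau.
Proof.
intros Hi HF Ht.
assert (Hl : l (S i) <> zero) by (apply l_neq_0; lia).
assert (Hi3 : (1 <= S i <= 3)%nat) by lia.
assert (Hse := smooth_eta_real n (S i) F Hi3 (proj1 HF)).
assert (He : forall p, strip rho0 p -> 0 < eta_real n (S i) F p).
{ intros p Dp. generalize (eta_real_bounds n i F p Hi HF Dp) (Hcm0 n). lra. }
assert (Hnd : forall p, D p -> 0 < dot (col_cross (differential D F p)) (col_cross (differential D F p))).
{ intros p Dp. apply injective_col_cross. now apply HF. }
set (Q := fun N => FCP (differential D F) (eta_real n (S i) F) (w (S i)) N).
assert (HQ : forall N p, D p -> Q N p = fcp_map (l (S i)) (differential D F p) (eta_real n (S i) F p)
  (cos (2 * PI * INR N * aff_app (w (S i)) p))).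
{ intros N p Dp. apply FCP_E; [now apply Hnd|exact Hl]. }
assert (HQd : forall N p, D p -> norm (minus (Q N p) (differential D F p)) <=
  step_const * sqrt (H (S i) (inc n p))).
{ intros N p Dp. rewrite HQ //.
  eapply Rle_trans; [apply fcp_map_distance; [now apply Hnd|easy|now apply Rlt_le, He|apply COS_bound]|].
  apply step_const_le; [lia|easy|]. generalize (eta_real_bounds n i F p Hi HF Dp) (Hcm0 n). lra. }
destruct (smooth_norm_bounded rho0 _ (smooth_differential rho0 Hrho F (proj1 (proj1 HF)))) as (M1 & M10 & HM1).
destruct (smooth_norm_bounded rho0 _ (smooth_H_inc n (S i) Hi3)) as (M2 & M20 & HM2).
set (M := M1 + step_const * sqrt M2).
assert (Hsc := step_const_pos). assert (Hs2 := sqrt_pos M2).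
assert (HMQ : forall N p, D p -> norm (Q N p) <= M).
{ intros N p Dp. apply (Rle_trans _ _ _ (norm_le_plus_minus (V := L23mod) (Q N p) (differential D F p))).
  apply Rplus_le_compat; [now apply HM1|]. apply (Rle_trans _ _ _ (HQd N p Dp)).
  apply Rmult_le_compat_l; [easy|]. apply sqrt_le_1_alt.
  exact (Rle_trans _ _ _ (Rle_abs _) (HM2 p Dp)). }
assert (HMp : 0 < M) by (unfold M; nra).
(* Lipschitz constant of the coefficients of the pullback on maps of norm at most M + 1 and M; the
   bound tau' <= 1 provides M + 1. *)
set (B := CH * (3 * (M + 1 + M))).
assert (HB : 0 < B) by (unfold B; apply Rmult_lt_0_compat; lra).
destruct (sigma_spec (S n)) as [Hsig _].
set (tau' := Rmin 1 (Rmin tau (sigma (S n) / 3 / B))).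
assert (Ht' : 0 < tau' /\ tau' <= 1 /\ tau' <= tau /\ tau' * B <= sigma (S n) / 3).
{ assert (0 < sigma (S n) / 3 / B) by (apply Rdiv_lt_0_compat; lra).
  generalize (Rmin_l 1 (Rmin tau (sigma (S n) / 3 / B))) (Rmin_r 1 (Rmin tau (sigma (S n) / 3 / B)))
   (Rmin_l tau (sigma (S n) / 3 / B)) (Rmin_r tau (sigma (S n) / 3 / B)).
  fold tau'. intros. repeat split; try lra.
  - unfold tau'. repeat apply Rmin_case; lra.
  - apply Rle_trans with (sigma (S n) / 3 / B * B); [|right; field; lra].
    apply Rmult_le_compat_r; lra. }
destruct (step_exists rho0 F (eta_real n (S i) F) (w (S i)) Hrho (proj1 HF) Hse He Hl
  tau' (proj1 Ht')) as (N & HN & Hest).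
exists N. split; [exact HN|]. intros F'.
assert (Hsm : smooth_on_C rho0 F').
{ apply CP_smooth; try assumption; [apply HF|]. apply (data_w_period _ _ _ _ _ Hdata (S i) Hi3). }
assert (Hcoef : forall p j, (1 <= j <= 3)%nat -> D p ->
  Rabs (H j (pullback (differential D F' p)) - target n (S i) j p) <= tolerance n (S i) j).
{ intros p j Hj Dp. destruct (Hest p Dp) as [E1 _]. fold F' D in E1. fold (Q N) in E1.
  set (dF' := differential D F' p) in *.
  assert (P : norm (minus (pullback dF') (pullback (Q N p))) <= 3 * (M + 1 + M) * tau').
  { eapply Rle_trans; [apply pullback_lipschitz|]. assert (A1 := HMQ N p Dp).
    assert (A2 := norm_le_plus_minus (V := L23mod) dF' (Q N p)).
    assert (A2' : norm dF' <= M + 1).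
    { apply (Rle_trans _ _ _ A2). apply Rplus_le_compat; [exact A1|].
      apply (Rle_trans _ _ _ E1), Ht'. }
    apply Rmult_le_compat; [|apply norm_nonneg| |exact E1].
    - apply Rmult_le_pos; [lra|]. apply Rplus_le_le_0_compat; apply norm_nonneg.
    - apply Rmult_le_compat_l; [lra|]. now apply Rplus_le_compat. }
  assert (R1 := HCH j (minus (pullback dF') (pullback (Q N p))) Hj).
  rewrite H_minus // in R1.
  assert (R2 : CH * norm (minus (pullback dF') (pullback (Q N p))) <= sigma (S n) / 3).
  { apply Rle_trans with (tau' * B); [|apply Ht']. unfold B.
    replace (tau' * (CH * (3 * (M + 1 + M)))) with (CH * (3 * (M + 1 + M) * tau')) by ring.
    apply Rmult_le_compat_l; [lra|exact P]. }
  assert (R3 : H j (pullback (Q N p)) - target n (S i) j p =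
    if Nat.eqb j (S i) then 0 else H j (pullback (differential D F p)) - target n i j p).
  { rewrite HQ // pullback_fcp_map; [|now apply Hnd|exact Hl|now apply Rlt_le, He].
    unfold eta_real, eta_of. now apply (corrected_coefficient n i). }
  replace (H j (pullback dF') - target n (S i) j p) with
    ((H j (pullback dF') - H j (pullback (Q N p))) + (H j (pullback (Q N p)) - target n (S i) j p)) by ring.
  eapply Rle_trans; [apply Rabs_triang|]. rewrite R3 tolerance_step //.
  rewrite Rplus_comm. apply Rplus_le_compat; [|lra].
  destruct (Nat.eqb j (S i)).
  - rewrite Rabs_R0. apply Rmult_le_pos; [apply pos_INR|lra].
  - now apply HF. }
split.
- split; [|exact Hcoef]. split; [exact Hsm|]. intros p Dp.
  apply (injective_of_lower_bound _ (m / 2)); [lra|]. intros v.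
  apply (target_lower_bound n (S i) p); [exact Dp|]. intros j Hj.
  generalize (Hcoef p j Hj Dp) (tolerance_le n (S i) j ltac:(lia)) (sigma_spec n) (sigma_spec (S n)). intros C.
  apply Rabs_le_between in C. unfold D in C. lra.
- intros p Dp. destruct (Hest p Dp) as [E1 E2]. fold F' D in E1. fold F' in E2. fold (Q N) in E1. fold (Q N).
  split; [apply (Rle_trans _ _ _ E2), Ht'|]. split; [apply (Rle_trans _ _ _ E1), Ht'|].
  apply (Rle_trans _ _ _ (norm_minus_chain (V := L23mod) _ (Q N p) _)).
  rewrite Rplus_comm. apply Rplus_le_compat; [now apply HQd|]. apply (Rle_trans _ _ _ E1), Ht'.
Qed.

(** The squared norm of Phi is the trace of its pullback, that is the sum of H_j(pullback) |l_j|^2,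
    and these coefficients are prescribed. The bound is thus common to all formal maps, whatever
    numbers produced them. *)
Lemma good_bounded n : exists M, 0 < M /\ forall i Phi p, formal_good n i Phi -> D p ->
  norm (Phi p) <= M /\ forall j, (1 <= j <= 3)%nat -> H j (inc n p) <= M.
Proof.
assert (B : exists T, 0 < T /\ forall j p, (1 <= j <= 3)%nat -> D p ->
  Rabs (H j (g n p)) <= T /\ H j (inc n p) <= T).
{ assert (B1 : forall j, (1 <= j <= 3)%nat -> exists T, 0 < T /\ forall p, D p ->
    Rabs (H j (g n p)) <= T /\ H j (inc n p) <= T).
  { intros j Hj.
    destruct (smooth_norm_bounded rho0 _ (smooth_linear _ _ (H_linear j Hj) (smooth_g n))) as (T1 & P1 & Q1).
    destruct (smooth_norm_bounded rho0 _ (smooth_H_inc n j Hj)) as (T2 & P2 & Q2).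
    exists (T1 + T2). split; [lra|]. intros p Dp. split.
    - apply (Rle_trans _ _ _ (Q1 p Dp)). lra.
    - apply (Rle_trans _ _ _ (Rle_abs _)), (Rle_trans _ _ _ (Q2 p Dp)). lra. }
  destruct (B1 1%nat ltac:(lia)) as (T1 & P1 & Q1), (B1 2%nat ltac:(lia)) as (T2 & P2 & Q2),
    (B1 3%nat ltac:(lia)) as (T3 & P3 & Q3).
  exists (T1 + T2 + T3). split; [lra|]. intros j p Hj Dp.
  destruct (index_cases j Hj) as [->|[->| ->]].
  - generalize (Q1 p Dp). lra.
  - generalize (Q2 p Dp). lra.
  - generalize (Q3 p Dp). lra. }
destruct B as (T & T0 & HT).
set (Q := 2 * T * (norm (l 1%nat) ^ 2 + norm (l 2%nat) ^ 2 + norm (l 3%nat) ^ 2)).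
assert (N1 := pow2_ge_0 (norm (l 1%nat))). assert (N2 := pow2_ge_0 (norm (l 2%nat))).
assert (N3 := pow2_ge_0 (norm (l 3%nat))).
assert (HQ : 0 <= Q) by (unfold Q; nra).
exists (Q + 1 + T). split; [lra|]. intros i Phi p HF Dp. split.
2:{ intros j Hj. generalize (proj2 (HT j p Hj Dp)). lra. }
assert (E : norm (Phi p) ^ 2 = sym_trace (pullback (Phi p))).
{ destruct (Phi p) as [X Y]. rewrite norm_pair_sqr !norm_sqr. reflexivity. }
rewrite (sym2_decomposition (pullback (Phi p))) in E.
assert (E' : sym_trace (plus (plus (scal (H 1 (pullback (Phi p))) (square (l 1%nat)))
   (scal (H 2 (pullback (Phi p))) (square (l 2%nat)))) (scal (H 3 (pullback (Phi p))) (square (l 3%nat)))) =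
   H 1 (pullback (Phi p)) * norm (l 1%nat) ^ 2 + H 2 (pullback (Phi p)) * norm (l 2%nat) ^ 2
   + H 3 (pullback (Phi p)) * norm (l 3%nat) ^ 2).
{ rewrite !norm_plane_sqr. unfold sym_trace. e3_ring. }
assert (E2 : norm (Phi p) ^ 2 = H 1 (pullback (Phi p)) * norm (l 1%nat) ^ 2 + H 2 (pullback (Phi p)) * norm (l 2%nat) ^ 2
   + H 3 (pullback (Phi p)) * norm (l 3%nat) ^ 2) by (rewrite -E'; exact E).
assert (HH : forall j, (1 <= j <= 3)%nat -> H j (pullback (Phi p)) <= 2 * T).
{ intros j Hj. rewrite (HF p j Hj Dp). unfold target. destruct (HT j p Hj Dp) as [A1 A2].
  apply Rabs_le_between in A1. destruct (Nat.leb j i); lra. }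
assert (N0 := norm_nonneg (Phi p)).
assert (HQ2 : norm (Phi p) ^ 2 <= Q).
{ rewrite E2. unfold Q. generalize (HH 1%nat ltac:(lia)) (HH 2%nat ltac:(lia)) (HH 3%nat ltac:(lia)).
  intros. rewrite !Rmult_plus_distr_l.
  repeat apply Rplus_le_compat; apply Rmult_le_compat_r; assumption. }
(* r^2 <= Q implies r <= Q + 1. *)
clear -HQ2 N0 HQ T0. revert HQ2 N0. generalize (norm (Phi p)). intros r. nra.
Qed.

(** The modulus [d] precedes F, Phi and N. Both formal steps use the same cosine [c], so
    [fcp_map_stable] accounts for e / 2; the other half is left to the distance between the real and
    the formal step. *)
Lemma close_step n i e : (i < 3)%nat -> 0 < e -> exists d, 0 < d /\ forall F Phi N F',
  good n i F -> formal_good n i Phi ->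
  (forall p, D p -> norm (minus (Phi p) (differential D F p)) <= d) ->
  (forall p, D p -> norm (minus (F' p)
     (FCP (differential D F) (eta_real n (S i) F) (w (S i)) N p)) <= e / 2) ->
  forall p, D p ->
    norm (minus (FCP Phi (eta_of (H (S i)) (g (S n)) Phi) (w (S i)) N p) (F' p)) <= e.
Proof.
intros Hi He.
assert (Hl : l (S i) <> zero) by (apply l_neq_0; lia).
destruct (good_bounded n) as (M & M0 & HM).
destruct (fcp_map_stable (l (S i)) M ((m / 2) ^ 2) (cm n) Hl (pow_lt (m / 2) 2 ltac:(lra)) (Hcm0 n) (e / 2) ltac:(lra))
  as (d0 & Hd0 & Hst).
set (B := CH * (3 * (M + (M + 1)))).
assert (HB : 0 < B) by (unfold B; apply Rmult_lt_0_compat; lra).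
set (d := Rmin 1 (Rmin d0 (d0 / B))).
assert (HdB : 0 < d0 / B) by now apply Rdiv_lt_0_compat.
assert (Hd : 0 < d /\ d <= 1 /\ d <= d0 /\ B * d <= d0).
{ generalize (Rmin_l 1 (Rmin d0 (d0 / B))) (Rmin_r 1 (Rmin d0 (d0 / B)))
   (Rmin_l d0 (d0 / B)) (Rmin_r d0 (d0 / B)). fold d. intros. repeat split; try lra.
  - unfold d. repeat apply Rmin_case; lra.
  - replace d0 with (B * (d0 / B)) by (field; lra). apply Rmult_le_compat_l; lra. }
exists d. split; [apply Hd|]. intros F Phi N F' HF HP Hcl HF' p Dp.
assert (Hnd := formal_good_nondegenerate_pos n i Phi p HP Dp).
assert (HndF : 0 < dot (col_cross (differential D F p)) (col_cross (differential D F p))).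
{ apply injective_col_cross. now apply HF. }
destruct (HM i Phi p HP Dp) as [HMP HMi].
assert (Hc1 := Hcl p Dp).
assert (Hc2 : norm (minus (differential D F p) (Phi p)) <= d).
{ rewrite (norm_minus_sym (V := L23mod)). exact Hc1. }
assert (HdF : norm (differential D F p) <= M + 1).
{ apply (Rle_trans _ _ _ (norm_le_plus_minus (V := L23mod) (differential D F p) (Phi p))).
  apply Rplus_le_compat; [exact HMP|]. apply (Rle_trans _ _ _ Hc2), Hd. }
assert (Heta : Rabs (eta_real n (S i) F p - eta_of (H (S i)) (g (S n)) Phi p) <= d0).
{ unfold eta_real, eta_of. rewrite !H_minus; [|lia..].
  replace (H (S i) (g (S n) p) - _ - _) with
    (H (S i) (pullback (Phi p)) - H (S i) (pullback (differential D F p))) by ring.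
  rewrite -H_minus; [|lia].
  eapply Rle_trans; [apply HCH; lia|]. apply Rle_trans with (B * d); [|apply Hd].
  unfold B. rewrite Rmult_assoc. apply Rmult_le_compat_l; [lra|].
  eapply Rle_trans; [apply pullback_lipschitz|].
  apply Rmult_le_compat; [|apply norm_nonneg| |exact Hc1].
  - apply Rmult_le_pos; [lra|]. apply Rplus_le_le_0_compat; apply norm_nonneg.
  - apply Rmult_le_compat_l; [lra|]. now apply Rplus_le_compat. }
assert (EtaE := eta_formal n i Phi p Hi HP Dp).
specialize (HF' p Dp). rewrite FCP_E // in HF'. rewrite FCP_E //.
set (c := cos _) in *.
assert (S1 := Hst (Phi p) (differential D F p) (eta_of (H (S i)) (g (S n)) Phi p)
  (eta_real n (S i) F p) c HMP (formal_good_nondegenerate n i Phi p HP Dp)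
  ltac:(rewrite EtaE; split; [apply Hcm; [lia|exact Dp]|apply HMi; lia]) (COS_bound _)
  (Rle_trans _ _ _ Hc2 (proj1 (proj2 (proj2 Hd)))) Heta).
apply (Rle_trans _ _ _ (norm_minus_chain (V := L23mod) _
  (fcp_map (l (S i)) (differential D F p) (eta_real n (S i) F p) c) _)).
rewrite (norm_minus_sym (V := L23mod) (fcp_map (aff_lin (w (S i))) (Phi p) _ c)).
rewrite (norm_minus_sym (V := L23mod) _ (F' p)).
replace e with (e / 2 + e / 2) by field. apply Rplus_le_compat; assumption.
Qed.

(** After three steps the tolerance is 3 (sigma (n+1) / 3), which is what round n + 2 accepts at its
    start. *)
Lemma good_next n F : good n 3 F -> good (S n) 0 F.
Proof.
intros [HF HC]. split; [exact HF|]. intros p j Hj Dp. generalize (HC p j Hj Dp).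
unfold target, tolerance. rewrite H_inc //.
replace (Nat.leb j 3) with true by (symmetry; apply Nat.leb_le; lia).
replace (Nat.leb j 0) with false by (symmetry; apply Nat.leb_gt; lia).
rewrite Rplus_0_r. simpl INR. intros. lra.
Qed.

Lemma formal_good_next n Phi : formal_good n 3 Phi -> formal_good (S n) 0 Phi.
Proof.
intros HC p j Hj Dp. rewrite (HC p j Hj Dp). unfold target.
rewrite H_inc //.
replace (Nat.leb j 3) with true by (symmetry; apply Nat.leb_le; lia).
replace (Nat.leb j 0) with false by (symmetry; apply Nat.leb_gt; lia).
now rewrite Rplus_0_r.
Qed.

Lemma target_0 p j : (1 <= j <= 3)%nat -> target 0 0 j p = H j (g 0 p).
Proof.
intros Hj. unfold target. replace (Nat.leb j 0) with false; [ring|].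
symmetry; apply Nat.leb_gt; lia.
Qed.

Lemma formal_good_0 : formal_good 0 0 (differential D f0).
Proof.
intros p j Hj Dp. rewrite target_0 //. f_equal. symmetry. now apply (data_g_0 _ _ _ _ _ Hdata).
Qed.

Lemma good_0 : good 0 0 f0.
Proof.
split; [apply (data_f0 _ _ _ _ _ Hdata)|]. intros p j Hj Dp.
rewrite (formal_good_0 p j Hj Dp) Rminus_diag_eq // Rabs_R0.
destruct (tolerance_le 0 0 j ltac:(lia)). assumption.
Qed.

Definition root_sum (n : nat) (p : plane) : R :=
  sqrt (H 1 (inc n p)) + sqrt (H 2 (inc n p)) + sqrt (H 3 (inc n p)).

Lemma formal_round_good N n Phi : formal_good n 0 Phi ->
  (forall i, (i <= 3)%nat -> formal_good n i (formal_round w H g N (S n) Phi i)) /\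
  (continuous_on D Phi -> continuous_on D (formal_round w H g N (S n) Phi 3)) /\
  forall p, D p -> norm (minus (formal_round w H g N (S n) Phi 3 p) (Phi p)) <= step_const * root_sum n p.
Proof.
intros H0.
destruct (formal_step n 0 Phi (N (S n) 1%nat) ltac:(lia) H0) as [H1 D1].
destruct (formal_step n 1 _ (N (S n) 2%nat) ltac:(lia) H1) as [H2 D2].
destruct (formal_step n 2 _ (N (S n) 3%nat) ltac:(lia) H2) as [H3 D3].
split; [|split].
- intros [|[|[|[|i]]]] Hi; [exact H0|exact H1|exact H2|exact H3|lia].
- intros C0. assert (C1 := formal_step_continuous n 0 Phi (N (S n) 1%nat) ltac:(lia) H0 C0).
  assert (C2 := formal_step_continuous n 1 _ (N (S n) 2%nat) ltac:(lia) H1 C1).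
  exact (formal_step_continuous n 2 _ (N (S n) 3%nat) ltac:(lia) H2 C2).
- intros p Dp. unfold root_sum. rewrite !Rmult_plus_distr_l.
  apply (Rle_trans _ _ _ (norm_minus_chain (V := L23mod) _ (formal_round w H g N (S n) Phi 2 p) _)).
  rewrite Rplus_comm. apply Rplus_le_compat; [|exact (D3 p Dp)].
  apply (Rle_trans _ _ _ (norm_minus_chain (V := L23mod) _ (formal_round w H g N (S n) Phi 1 p) _)).
  rewrite Rplus_comm. apply Rplus_le_compat; [exact (D1 p Dp)|exact (D2 p Dp)].
Qed.

(** The accuracy [d] required at the start is independent of F: it composes the moduli of the three
    steps. The function [fun _ => nu] supplies numbers for this round alone, the only ones it
    reads. *)
Lemma good_round n e : 0 < e -> exists d, 0 < d /\ forall F, good n 0 F ->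
  exists nu : nat -> nat, (forall i, (1 <= nu i)%nat) /\
  let G := corr_round rho0 w H g (fun _ => nu) (S n) F in
  (forall i, (i <= 3)%nat -> good n i (G i)) /\
  (forall p, D p -> norm (minus (G 3%nat p) (F p)) <= 3 * (1 / 2) ^ n) /\
  (forall p, D p -> norm (minus (differential D (G 3%nat) p) (differential D F p)) <=
     step_const * root_sum n p + 3 * (1 / 2) ^ n) /\
  forall Phi, formal_good n 0 Phi ->
    (forall p, D p -> norm (minus (Phi p) (differential D F p)) <= d) ->
    forall p, D p -> norm (minus (formal_round w H g (fun _ => nu) (S n) Phi 3 p)
      (differential D (G 3%nat) p)) <= e.
Proof.
intros He.
(* Moduli are taken from the last step to the first, each being the accuracy demanded of the step
   before. *)
destruct (close_step n 2 e ltac:(lia) He) as (d2 & Hd2 & C3).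
destruct (close_step n 1 d2 ltac:(lia) Hd2) as (d1 & Hd1 & C2).
destruct (close_step n 0 d1 ltac:(lia) Hd1) as (d & Hd & C1).
exists d. split; [exact Hd|]. intros F G0.
assert (Ht : 0 < (1 / 2) ^ n) by (apply pow_lt; lra).
(* (1/2)^n makes the errors summable over the rounds; half of [d1] is the share left by [close_step]
   to the corrugation error. *)
destruct (good_step n 0 F (Rmin ((1 / 2) ^ n) (d1 / 2)) ltac:(lia) G0) as (N1 & P1 & G1 & E1);
  [apply Rmin_case; lra|].
destruct (good_step n 1 _ (Rmin ((1 / 2) ^ n) (d2 / 2)) ltac:(lia) G1) as (N2 & P2 & G2 & E2);
  [apply Rmin_case; lra|].
destruct (good_step n 2 _ (Rmin ((1 / 2) ^ n) (e / 2)) ltac:(lia) G2) as (N3 & P3 & G3 & E3);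
  [apply Rmin_case; lra|].
assert (L1 := Rmin_l ((1 / 2) ^ n) (d1 / 2)). assert (R1 := Rmin_r ((1 / 2) ^ n) (d1 / 2)).
assert (L2 := Rmin_l ((1 / 2) ^ n) (d2 / 2)). assert (R2 := Rmin_r ((1 / 2) ^ n) (d2 / 2)).
assert (L3 := Rmin_l ((1 / 2) ^ n) (e / 2)). assert (R3 := Rmin_r ((1 / 2) ^ n) (e / 2)).
exists (fun i => match i with 1%nat => N1 | 2%nat => N2 | _ => N3 end).
split; [intros [|[|[|]]]; assumption|]. intros G.
set (F1 := CP rho0 F (eta_real n 1 F) (w 1%nat) N1) in *.
set (F2 := CP rho0 F1 (eta_real n 2 F1) (w 2%nat) N2) in *.
set (F3 := CP rho0 F2 (eta_real n 3 F2) (w 3%nat) N3) in *.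
change (G 3%nat) with F3.
split; [|split; [|split]].
- intros [|[|[|[|i]]]] Hi; [exact G0|exact G1|exact G2|exact G3|lia].
- intros p Dp. destruct (E1 p Dp) as (A1 & _), (E2 p Dp) as (A2 & _), (E3 p Dp) as (A3 & _).
  assert (T1 := norm_minus_chain (V := E3mod) (F3 p) (F2 p) (F p)).
  assert (T2 := norm_minus_chain (V := E3mod) (F2 p) (F1 p) (F p)).
  apply (Rle_trans _ _ _ T1), (Rle_trans _ _ _ (Rplus_le_compat _ _ _ _ (Rle_trans _ _ _ A3 L3)
    (Rle_trans _ _ _ T2 (Rplus_le_compat _ _ _ _ (Rle_trans _ _ _ A2 L2) (Rle_trans _ _ _ A1 L1))))).
  right; ring.
- intros p Dp. destruct (E1 p Dp) as (_ & _ & A1), (E2 p Dp) as (_ & _ & A2), (E3 p Dp) as (_ & _ & A3).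
  assert (T1 := norm_minus_chain (V := L23mod) (differential D F3 p) (differential D F2 p) (differential D F p)).
  assert (T2 := norm_minus_chain (V := L23mod) (differential D F2 p) (differential D F1 p) (differential D F p)).
  apply (Rle_trans _ _ _ T1), (Rle_trans _ _ _ (Rplus_le_compat _ _ _ _ A3
    (Rle_trans _ _ _ T2 (Rplus_le_compat _ _ _ _ A2 A1)))).
  unfold root_sum. lra.
- intros Phi H0 Hcl.
  destruct (formal_step n 0 Phi N1 ltac:(lia) H0) as [H1 _].
  destruct (formal_step n 1 _ N2 ltac:(lia) H1) as [H2 _].
  assert (K1 := C1 F Phi N1 (differential D F1) G0 H0 Hcl
    (fun p Dp => Rle_trans _ _ _ (proj1 (proj2 (E1 p Dp))) R1)).
  assert (K2 := C2 F1 _ N2 (differential D F2) G1 H1 K1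
    (fun p Dp => Rle_trans _ _ _ (proj1 (proj2 (E2 p Dp))) R2)).
  exact (C3 F2 _ N3 (differential D F3) G2 H2 K2
    (fun p Dp => Rle_trans _ _ _ (proj1 (proj2 (E3 p Dp))) R3)).
Qed.

(** Each H_j(inc) is at most CH times the norm of the increment, itself at most 4 times the supremum
    in the summability hypothesis. *)
Lemma root_sum_summable K : compact_in_Cstar rho0 K -> exists A : nat -> R,
  (forall n, 0 <= A n) /\ ex_series A /\ forall n p, K p -> root_sum n p <= A n.
Proof.
intros HK.
set (S := fun n => real (sup_on K (fun p => sym_norm (inc n p)))).
exists (fun n => 3 * sqrt (4 * CH) * sqrt (S n)). split; [|split].
- intros n. generalize (sqrt_pos (4 * CH)) (sqrt_pos (S n)). intros. nra.
- apply (ex_series_scal_l (K := R_AbsRing) (V := R_NormedModule) (3 * sqrt (4 * CH))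
    (fun n => sqrt (S n))).
  exact (data_g_summable _ _ _ _ _ Hdata K HK).
- intros n p Kp.
  assert (KD : forall q, K q -> D q).
  { intros q Kq. destruct (proj2 HK q Kq). split; lra. }
  destruct (smooth_norm_bounded rho0 (inc n) (proj1 (data_g_cone _ _ _ _ _ Hdata n))) as (M & M0 & HM).
  assert (B := sym_norm_sup K (inc n) M p (fun q Kq => HM q (KD q Kq)) Kp).
  assert (R : forall j, (1 <= j <= 3)%nat -> sqrt (H j (inc n p)) <= sqrt (4 * CH) * sqrt (S n)).
  { intros j Hj. rewrite -sqrt_mult_alt; [|lra]. apply sqrt_le_1_alt.
    apply (Rle_trans _ _ _ (Rle_abs _)), (Rle_trans _ _ _ (HCH j (inc n p) Hj)).
    replace (4 * CH * S n) with (CH * (4 * S n)) by ring.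
    apply Rmult_le_compat_l; [lra|exact B]. }
  unfold root_sum. generalize (R 1%nat ltac:(lia)) (R 2%nat ltac:(lia)) (R 3%nat ltac:(lia)). lra.
Qed.

(* The numbers are chosen round by round.  Before round k0 the accuracy required of the
   real process is propagated backwards from e, through the moduli of good_round. *)
Lemma process_exists (k0 : nat) (e : R) : 0 < e -> exists N : nat -> nat -> nat,
  (forall k i, (1 <= N k i)%nat) /\
  let F := corr_end rho0 w H f0 g N in
  let Phi := formal_end rho0 w H f0 g N in
  (forall n i, (i <= 3)%nat -> good n i (corr_round rho0 w H g N (S n) (F n) i)) /\
  (forall n i, (i <= 3)%nat -> formal_good n i (formal_round w H g N (S n) (Phi n) i)) /\
  (forall n, continuous_on D (Phi n)) /\
  (forall n p, D p -> norm (minus (F (S n) p) (F n p)) <= 3 * (1 / 2) ^ n) /\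
  (forall n p, D p -> norm (minus (differential D (F (S n)) p) (differential D (F n) p)) <=
     step_const * root_sum n p + 3 * (1 / 2) ^ n) /\
  (forall n p, D p -> norm (minus (Phi (S n) p) (Phi n p)) <= step_const * root_sum n p) /\
  forall p, D p -> norm (minus (Phi k0 p) (differential D (F k0) p)) <= e.
Proof.
intros He.
set (P := fun n (e d : R) (F : plane -> E3) (nu : nat -> nat) => (forall i, (1 <= nu i)%nat) /\
  let G := corr_round rho0 w H g (fun _ => nu) (S n) F in
  (forall i, (i <= 3)%nat -> good n i (G i)) /\
  (forall p, D p -> norm (minus (G 3%nat p) (F p)) <= 3 * (1 / 2) ^ n) /\
  (forall p, D p -> norm (minus (differential D (G 3%nat) p) (differential D F p)) <=
     step_const * root_sum n p + 3 * (1 / 2) ^ n) /\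
  forall Phi, formal_good n 0 Phi ->
    (forall p, D p -> norm (minus (Phi p) (differential D F p)) <= d) ->
    forall p, D p -> norm (minus (formal_round w H g (fun _ => nu) (S n) Phi 3 p)
      (differential D (G 3%nat) p)) <= e).
destruct (choice_on (fun u : nat * R => 0 < snd u) (fun u d => 0 < d /\
  forall F, good (fst u) 0 F -> exists nu, P (fst u) (snd u) d F nu) 0) as [dd Hdd].
{ intros [n e'] He'. exact (good_round n e' He'). }
(* [a j] is the accuracy required j rounds before [k0], starting from [e] at [k0] itself. *)
set (a := fix a (j : nat) : R := match j with O => e | S j' => dd ((k0 - S j')%nat, a j') end).
assert (Ha : forall j, 0 < a j).
{ induction j as [|j IH]; [exact He|]. exact (proj1 (Hdd ((k0 - S j)%nat, a j) IH)). }
(* For n >= k0 the truncated subtraction gives acc n = e, an arbitrary positive demand there. *)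
set (acc := fun n => a (k0 - n)%nat).
assert (Hacc : forall n, (n < k0)%nat -> acc n = dd (n, acc (S n))).
{ intros n Hn. unfold acc. replace (k0 - n)%nat with (S (k0 - S n)) by lia. simpl.
  now replace (k0 - S (k0 - S n))%nat with n by lia. }
destruct (choice_on (fun u : nat * (plane -> E3) => good (fst u) 0 (snd u))
  (fun u nu => P (fst u) (acc (S (fst u))) (dd (fst u, acc (S (fst u)))) (snd u) nu)
  (fun _ => 1%nat)) as [ch Hch].
{ intros [n F] HF. exact (proj2 (Hdd (n, acc (S n)) (Ha _)) F HF). }
(* The numbers of a round depend on the map reached so far, so maps are built first, each round with
   its own numbers. *)
set (Fs := fix Fs (n : nat) : plane -> E3 := match n with
  | O => f0 | S n' => corr_round rho0 w H g (fun _ => ch (n', Fs n')) (S n') (Fs n') 3 end).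
assert (HFs : forall n, good n 0 (Fs n)).
{ induction n as [|n IH]; [exact good_0|]. apply good_next.
  exact (proj1 (proj2 (Hch (n, Fs n) IH)) 3%nat (le_n _)). }
(* Round k starts from [Fs (pred k)]; a round reads only its own row of [N], so the process driven
   by [N] is [Fs]. *)
set (N := fun k => ch (pred k, Fs (pred k))).
assert (EF : forall n, corr_end rho0 w H f0 g N n = Fs n).
{ induction n as [|n IH]; [reflexivity|]. simpl. rewrite IH. reflexivity. }
assert (HN : forall n, P n (acc (S n)) (dd (n, acc (S n))) (Fs n) (N (S n))).
{ intros n. exact (Hch (n, Fs n) (HFs n)). }
exists N. split.
{ intros k. exact (proj1 (Hch (pred k, Fs (pred k)) (HFs (pred k)))). }
intros F Phi.
assert (HPhi0 : forall n, formal_good n 0 (Phi n)).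
{ induction n as [|n IH]; [exact formal_good_0|]. apply formal_good_next.
  exact (proj1 (formal_round_good N n (Phi n) IH) 3%nat (le_n _)). }
assert (Hc0 : continuous_on D (differential D f0)).
{ destruct (smooth_differential rho0 Hrho f0 (proj1 (data_f0 _ _ _ _ _ Hdata))) as [_ Hs].
  exact (Hs 0%nat). }
split; [|split; [|split; [|split; [|split; [|split]]]]].
- intros n i Hi. unfold F. rewrite EF.
  destruct i as [|[|[|[|i]]]]; [| | | |lia].
  + exact (proj1 (proj2 (HN n)) 0%nat Hi).
  + exact (proj1 (proj2 (HN n)) 1%nat Hi).
  + exact (proj1 (proj2 (HN n)) 2%nat Hi).
  + exact (proj1 (proj2 (HN n)) 3%nat Hi).
- intros n. exact (proj1 (formal_round_good N n (Phi n) (HPhi0 n))).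
- induction n as [|n IH]; [exact Hc0|].
  exact (proj1 (proj2 (formal_round_good N n (Phi n) (HPhi0 n))) IH).
- intros n p Dp. unfold F. rewrite !EF. exact (proj1 (proj2 (proj2 (HN n))) p Dp).
- intros n p Dp. unfold F. rewrite !EF. exact (proj1 (proj2 (proj2 (proj2 (HN n)))) p Dp).
- intros n p Dp. exact (proj2 (proj2 (formal_round_good N n (Phi n) (HPhi0 n))) p Dp).
- assert (Hclose : forall n, (n <= k0)%nat -> forall p, D p ->
    norm (minus (Phi n p) (differential D (F n) p)) <= acc n).
  { induction n as [|n IH]; intros Hn p Dp.
    - change (norm (minus (differential D f0 p) (differential D f0 p)) <= acc 0%nat).
      rewrite minus_eq_zero. change (norm (zero : L23mod) <= acc 0%nat). rewrite norm_zero.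
      apply Rlt_le, Ha.
    - assert (IH' := IH ltac:(lia)). rewrite (Hacc n ltac:(lia)) in IH'.
      unfold F in *. rewrite EF in IH'. rewrite EF.
      exact (proj2 (proj2 (proj2 (proj2 (HN n)))) (Phi n) (HPhi0 n) IH' p Dp). }
  intros p Dp. generalize (Hclose k0 (le_n _) p Dp). unfold acc. now rewrite Nat.sub_diag.
Qed.

End Data.

(** * Convergence *)

Definition vanishing (T : nat -> R) : Prop := forall e, 0 < e -> exists k, T k <= e.

Definition tail_bounded {V : NormedModule R_AbsRing} (T : nat -> R) (X : nat -> V) : Prop :=
  forall n m, (n <= m)%nat -> norm (minus (X m) (X n)) <= T n.

Lemma tail_bounded_cauchy {V : NormedModule R_AbsRing} T (X : nat -> V) :
  vanishing T -> tail_bounded T X -> cauchy_seq X.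
Proof.
intros HT HX e He. destruct (HT (e / 2)) as [k Hk]; [lra|]. exists k. intros n m Hn Hm.
generalize (norm_minus_triangle (X k) (X n) (X m)) (HX k n Hn) (HX k m Hm).
rewrite (norm_minus_sym (X k) (X n)) (norm_minus_sym (X k) (X m)). lra.
Qed.

Lemma tail_bounded_limit {V : NormedModule R_AbsRing} T (X : nat -> V) x n :
  tail_bounded T X -> converges X x -> norm (minus x (X n)) <= T n.
Proof. intros HX Hx. apply (converges_bound X); [exact Hx|]. exists n. intros m Hm. now apply HX. Qed.

(** The tail is fixed before the space and the sequence, so that it serves the differentials and the
    formal maps alike. *)
Lemma summable_tail (u : nat -> R) : (forall n, 0 <= u n) -> ex_series u -> exists T : nat -> R,
  (forall k, 0 <= T k) /\ vanishing T /\
  forall (V : NormedModule R_AbsRing) (X : nat -> V),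
    (forall n, norm (minus (X (S n)) (X n)) <= u n) -> tail_bounded T X.
Proof.
intros Hu Hs. destruct (psum_summable u Hu Hs) as (l & Hl & Ht).
exists (fun k => l - psum u k). split; [|split].
- intros k. generalize (Hl k). lra.
- exact Ht.
- intros V X HX n m Hnm. generalize (psum_dominated X u HX n m Hnm) (Hl m). lra.
Qed.

Lemma geometric_summable : ex_series (fun n => 3 * (1 / 2) ^ n).
Proof.
apply (ex_series_scal_l (K := R_AbsRing) (V := R_NormedModule) 3 (fun n => (1 / 2) ^ n)), ex_series_geom.
rewrite Rabs_pos_eq; lra.
Qed.

Theorem theorem4 (rho0 : R) (w : nat -> affine_form) (H : nat -> sym2 -> R)
    (f0 : plane -> E3) (g : nat -> plane -> sym2)
    (Hdata : corrugation_data rho0 w H f0 g)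
    (K : plane -> Prop) (HK : compact_in_Cstar rho0 K)
    (eps : R) (Heps : 0 < eps) :
  exists N : nat -> nat -> nat,
    (forall k i, (1 <= k)%nat -> (1 <= i <= 3)%nat -> (1 <= N k i)%nat) /\
    corr_well_defined rho0 w H f0 g N /\
    formal_well_defined rho0 w H f0 g N /\
    exists (f_inf : plane -> E3) (Phi_inf : plane -> E3 * E3),
      (forall e : R, 0 < e -> exists k0 : nat, forall k, (k0 <= k)%nat ->
         forall p, strip rho0 p ->
           norm (minus (corr_end rho0 w H f0 g N k p) (f_inf p)) < e) /\
      class_C (strip_star rho0) 1 f_inf /\
      (forall p, strip_star rho0 p ->
         filterlim (fun k => formal_end rho0 w H f0 g N k p)
           eventually (locally (Phi_inf p))) /\
      continuous_on (strip_star rho0) Phi_inf /\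
      Rbar_le
        (sup_on K (fun p =>
           op_norm (minus (Phi_inf p) (differential (strip_star rho0) f_inf p))))
        eps.
Proof.
assert (Hrho := data_rho0 _ _ _ _ _ Hdata).
destruct (choice_on (fun _ : nat => True) (fun n m => 0 < m /\
  forall j p, (1 <= j <= 3)%nat -> strip rho0 p -> m <= H j (inc g n p)) 0) as [cm Hcm].
{ intros n _. exact (inc_lower_bound _ _ _ _ _ Hdata n). }
assert (Hcm0 : forall n, 0 < cm n) by (intros n; apply (Hcm n I)).
assert (Hcm1 : forall n j p, (1 <= j <= 3)%nat -> strip rho0 p -> cm n <= H j (inc g n p)).
{ intros n. apply (Hcm n I). }
destruct (g_lower_bound _ _ _ _ _ Hdata) as (m & Hm0 & Hm).
destruct (coefficients_small _ _ _ _ _ Hdata m Hm0) as (m' & Hm'0 & Hm').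
destruct (H_bounded _ _ _ _ _ Hdata) as (CH & HCH0 & HCH).
assert (Hsc := step_const_pos w).
(* The geometric term absorbs the corrugation errors of the real process; the formal increments
   satisfy the same bound a fortiori. *)
assert (Htail : forall K', compact_in_Cstar rho0 K' -> exists T : nat -> R,
  (forall k, 0 <= T k) /\ vanishing T /\
  forall (V : NormedModule R_AbsRing) (X : nat -> V) p, K' p ->
    (forall n, norm (minus (X (S n)) (X n)) <= step_const w * root_sum H g n p + 3 * (1 / 2) ^ n) ->
    tail_bounded T X).
{ intros K' HK'.
  destruct (root_sum_summable _ _ _ _ _ Hdata CH HCH0 HCH K' HK') as (A & HA0 & HAs & HA).
  destruct (summable_tail (fun n => step_const w * A n + 3 * (1 / 2) ^ n)) as (T & T0 & HT & HX).
  - intros n. generalize (HA0 n) (pow_lt (1 / 2) n). nra.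
  - apply (ex_series_plus (K := R_AbsRing) (V := R_NormedModule)); [|exact geometric_summable].
    apply (ex_series_scal_l (K := R_AbsRing) (V := R_NormedModule)), HAs.
  - exists T. split; [exact T0|]. split; [exact HT|]. intros V X p Kp H1. apply HX. intros n.
    apply (Rle_trans _ _ _ (H1 n)), Rplus_le_compat_r, Rmult_le_compat_l; [exact Hsc|now apply HA]. }
destruct (Htail K HK) as (TK & _ & HTK & HXK).
(* The tail depends on the data only, so [k0] is available before any number is chosen. *)
destruct (HTK (eps / 3)) as [k0 Hk0]; [lra|].
destruct (process_exists _ _ _ _ _ Hdata cm m m' CH Hcm0 Hcm1 Hm0 Hm Hm'0 Hm' HCH0 HCH k0 (eps / 3) ltac:(lra))
  as (N & HN & Hgood & Hfgood & Hcont & HF & HdF & HPhi & Hclose).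
set (F := corr_end rho0 w H f0 g N) in *. set (Phi := formal_end rho0 w H f0 g N) in *.
assert (Hgeo : forall n, 0 <= 3 * (1 / 2) ^ n).
{ intros n. generalize (pow_lt (1 / 2) n). lra. }
assert (HPhi' : forall n p, strip rho0 p -> norm (minus (Phi (S n) p) (Phi n p)) <=
  step_const w * root_sum H g n p + 3 * (1 / 2) ^ n).
{ intros n p Dp. generalize (HPhi n p Dp) (Hgeo n). lra. }
assert (Hstar : forall p, strip_star rho0 p -> strip rho0 p).
{ intros p [H1 H2]. split; lra. }
assert (Hsm : forall n, smooth_on_C rho0 (F n)).
{ intros n. exact (proj1 (proj1 (Hgood n 0%nat (Nat.le_0_l 3)))). }
exists N. split; [intros; apply HN|]. split; [|split].
- intros [|n] [|i] Hk Hi; try lia. split.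
  + exact (proj1 (Hgood n i ltac:(lia))).
  + intros p Dp. generalize (eta_real_bounds _ _ _ _ _ Hdata cm m' Hcm0 Hcm1 Hm'0 n i _ p ltac:(lia) (Hgood n i ltac:(lia)) Dp)
      (Hcm0 n). intros [_ [B _]] B0. apply Rlt_le_trans with (cm n / 2); [lra|exact B].
- intros [|n] [|i] Hk Hi p Dp; try lia. split.
  + apply (injective_of_lower_bound _ (m / 2)); [lra|]. intros v.
    exact (formal_good_lower_bound _ _ _ _ _ Hdata cm m m' Hcm0 Hcm1 Hm Hm'0 Hm' n i _ p v (Hfgood n i ltac:(lia)) Dp).
  + change (0 <= eta_of (H (S i)) (g (S n)) (formal_round w H g N (S n) (Phi n) i) p).
    rewrite (eta_formal _ _ _ _ _ Hdata n i _ p ltac:(lia) (Hfgood n i ltac:(lia)) Dp).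
    generalize (Hcm1 n (S i) p Hi Dp) (Hcm0 n). lra.
(* The maps themselves move by at most 3 (1/2)^n per round, whatever the metrics: they converge
   uniformly up to the edge rho = 1. *)
- destruct (summable_tail _ Hgeo geometric_summable) as (T0 & _ & HT0 & HX0).
  assert (HF0 : forall p, strip rho0 p -> tail_bounded (V := E3mod) T0 (fun n => F n p)).
  { intros p Dp. apply HX0. intros n. now apply HF. }
  destruct (choice_on (strip rho0) (fun p x => converges (V := E3mod) (fun n => F n p) x) zero) as [f_inf Hf_inf].
  { intros p Dp. exact (seq_complete_E3 _ (tail_bounded_cauchy T0 _ HT0 (HF0 p Dp))). }
  (* Differentials converge only locally uniformly, so each point of the half-open strip gets a tail
     on its own box. *)
  assert (Hbox : forall p, strip_star rho0 p -> exists T : nat -> R,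
    (forall k, 0 <= T k) /\ vanishing T /\ forall q, cstar_box rho0 p q ->
      tail_bounded (V := L23mod) T (fun n => differential (strip rho0) (F n) q) /\
      tail_bounded (V := L23mod) T (fun n => Phi n q)).
  { intros p Sp. assert (HC := cstar_box_compact rho0 p Sp).
    destruct (Htail _ HC) as (T & T1 & HT & HX). exists T. split; [exact T1|]. split; [exact HT|].
    intros q Qq. assert (Dq := Hstar q (proj2 HC q Qq)). split; apply (HX _ _ q Qq); intros n.
    - exact (HdF n q Dq).
    - exact (HPhi' n q Dq). }
  destruct (choice_on (strip_star rho0) (fun p x => converges (V := L23mod) (fun n => differential (strip rho0) (F n) p) x)
    (zero, zero)) as [L HL].
  { intros p Sp. destruct (Hbox p Sp) as (T & _ & HT & HX).
    exact (seq_complete_L23 _ (tail_bounded_cauchy T _ HT (proj1 (HX p (cstar_box_center rho0 p Sp))))). }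
  destruct (choice_on (strip_star rho0) (fun p x => converges (V := L23mod) (fun n => Phi n p) x)
    (zero, zero)) as [Phi_inf HPi].
  { intros p Sp. destruct (Hbox p Sp) as (T & _ & HT & HX).
    exact (seq_complete_L23 _ (tail_bounded_cauchy T _ HT (proj2 (HX p (cstar_box_center rho0 p Sp))))). }
  assert (Hdiff : forall p, strip_star rho0 p -> has_differential (strip_star rho0) f_inf p (L p)).
  { intros p Sp. destruct (Hbox p Sp) as (T & T1 & HT & HX). assert (HC := cstar_box_compact rho0 p Sp).
    apply (limit_differential (strip rho0) (strip_star rho0) (cstar_box rho0 p) p T (proj2 HC) Hstar Sp
      (cstar_box_center rho0 p Sp) (cstar_box_locally rho0 p Sp) HT F
      (fun n => differential (strip rho0) (F n))).
    - intros a b s. apply cstar_box_convex.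
    - intros n q Dq. now apply smooth_has_differential.
    - intros n k q Hnk Qq. exact (proj1 (HX q Qq) n k Hnk).
    - intros n q Qq. exact (tail_bounded_limit T _ _ n (proj1 (HX q Qq)) (HL q (proj2 HC q Qq))).
    - intros q Qq. exact (Hf_inf q (Hstar q (proj2 HC q Qq))). }
  assert (HcL : continuous_on (U := L23mod) (strip_star rho0) L).
  { intros p Sp. destruct (Hbox p Sp) as (T & T1 & HT & HX). assert (HC := cstar_box_compact rho0 p Sp).
    apply (uniform_limit_continuous (strip rho0) (strip_star rho0) (cstar_box rho0 p) p T Hstar Sp
      (cstar_box_center rho0 p Sp) (cstar_box_locally rho0 p Sp) HT (V := L23mod)
      (fun n => differential (strip rho0) (F n))).
    - intros n. exact (proj2 (smooth_differential rho0 Hrho (F n) (Hsm n)) 0%nat).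
    - intros n q Qq. exact (tail_bounded_limit T _ _ n (proj1 (HX q Qq)) (HL q (proj2 HC q Qq))). }
  exists f_inf, Phi_inf. split; [|split; [|split; [|split]]].
  + intros e He. destruct (HT0 (e / 4)) as [k Hk]; [lra|]. exists k. intros n Hn p Dp.
    assert (A1 := HF0 p Dp k n Hn).
    assert (A2 := tail_bounded_limit (V := E3mod) T0 (fun n => F n p) _ k (HF0 p Dp) (Hf_inf p Dp)).
    rewrite (norm_minus_sym (V := E3mod)) in A2.
    apply Rle_lt_trans with (e / 2 + e / 4); [|lra].
    refine (Rle_trans _ _ _ (norm_minus_chain (V := E3mod) _ (F k p) _) (Rplus_le_compat _ _ _ _ _ _)).
    * apply (Rle_trans _ _ _ A1). lra.
    * apply (Rle_trans _ _ _ A2). exact Hk.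
  + exists (fun p => fst (L p)), (fun p => snd (L p)). split; [|split].
    * intros p Sp. rewrite -surjective_pairing. now apply Hdiff.
    * exact (class_C_fst_of (strip_star rho0) 0 L HcL).
    * exact (class_C_snd_of (strip_star rho0) 0 L HcL).
  + intros p Sp. exact (converges_filterlim (V := L23mod) _ _ (HPi p Sp)).
  + intros p Sp. destruct (Hbox p Sp) as (T & T1 & HT & HX). assert (HC := cstar_box_compact rho0 p Sp).
    apply (uniform_limit_continuous (strip rho0) (strip_star rho0) (cstar_box rho0 p) p T Hstar Sp
      (cstar_box_center rho0 p Sp) (cstar_box_locally rho0 p Sp) HT (V := L23mod) Phi Phi_inf Hcont).
    intros n q Qq. exact (tail_bounded_limit T _ _ n (proj2 (HX q Qq)) (HPi q (proj2 HC q Qq))).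
  + apply sup_on_le. intros p Kp. assert (Sp := proj2 HK p Kp). assert (Dp := Hstar p Sp).
    (* Uniqueness identifies the chosen differential of the limit with the limit [L] of the
       differentials; three terms eps / 3 then remain. *)
    rewrite (differential_unique (strip_star rho0) f_inf p (L p) (strip_star_thick rho0) Sp (Hdiff p Sp)).
    apply (Rbar_le_trans _ _ _ (op_norm_le _)). simpl.
    assert (A1 := tail_bounded_limit TK _ _ k0
      (HXK L23mod (fun n => Phi n p) p Kp (fun n => HPhi' n p Dp)) (HPi p Sp)).
    assert (A2 := tail_bounded_limit TK _ _ k0
      (HXK L23mod (fun n => differential (strip rho0) (F n) p) p Kp (fun n => HdF n p Dp)) (HL p Sp)).
    assert (A3 := Hclose p Dp).
    rewrite (norm_minus_sym (V := L23mod)) in A2.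
    assert (B1 := norm_minus_chain (V := L23mod) (Phi_inf p) (Phi k0 p) (L p)).
    assert (B2 := norm_minus_chain (V := L23mod) (Phi k0 p) (differential (strip rho0) (F k0) p) (L p)).
    refine (Rle_trans _ _ _ B1 (Rle_trans _ _ _ (Rplus_le_compat _ _ _ _ (Rle_trans _ _ _ A1 Hk0)
      (Rle_trans _ _ _ B2 (Rplus_le_compat _ _ _ _ A3 (Rle_trans _ _ _ A2 Hk0)))) _)).
    lra.
Qed.
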